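(* Let $1\le k\le n$ be integers and $K=k(n-k+1)$. Then $$s_{(k-1)^{n-k}}^{\perp}\sum_{\pi\in \mathrm{WPF}_{K,k}}t^{\mathrm{area}(\pi)}q^{\mathrm{dinv}(\pi)}x^{\pi}=\sum_{P\in \mathrm{WLD}_{n,k}^{\mathrm{stack}}} t^{\mathrm{area}(P)} q^{\mathrm{hdinv}(P)} x^P ,$$ where $(k-1)^{n-k}$ is the partition with $n-k$ parts equal to $k-1$ and $s_\lambda^\perp$ is the adjoint of multiplication by the Schur function $s_\lambda$ with respect to the Hall inner product on symmetric functions in $x_1,x_2,\dots$ (extended linearly over the coefficients in $q,t$).
   Context: Put $r=n-k+1$, so $K=kr$. Boxes of a grid are named by the coordinates $(x,y)$ of their lower left corner. Rational parking functions. A $(K,k)$ Dyck path is a lattice path of unit north and east steps from $(0,0)$ to $(k,K)$ staying weakly above the line $y=rx$. Its labeled boxes are the $K$ boxes immediately to the right of its vertical steps. An element $\pi\in\mathrm{WPF}_{K,k}$ (word parking function) is a $(K,k)$ Dyck path $D$ together with a labeling of these boxes by positive integers, strictly increasing going up each column; $x^\pi=\prod x_{\text{label}}$ over all labels. $\mathrm{area}(\pi)=\mathrm{area}(D)$ is the number of boxes lying between $D$ and the line $y=rx$ whose interior is not crossed by that line. An ordered pair of boxes $(a,b)$ is attacking if, with $\delta(x,y)=y-rx$, either $\delta(a)=\delta(b)$ and $a$ is to the left of $b$, or $\delta(a)=\delta(b)-1$ and $a$ is strictly to the right of $b$. $\mathrm{tdinv}(\pi)$ is the number of attacking pairs $(a,b)$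 of labeled boxes with label of $a$ $<$ label of $b$; $\mathrm{maxtdinv}(D)$ is the maximum of $\mathrm{tdinv}$ over all labelings of $D$ (equivalently the number of attacking pairs of boxes immediately right of vertical steps). $\mathrm{pathdinv}(D)$ is the number of boxes $c$ of the grid above $D$ with $\frac{\mathrm{arm}(c)}{\mathrm{leg}(c)+1}\le \frac kK<\frac{\mathrm{arm}(c)+1}{\mathrm{leg}(c)}$ (the right inequality being automatic if $\mathrm{leg}(c)=0$), where $\mathrm{arm}(c)$, $\mathrm{leg}(c)$ are the numbers of boxes strictly to the right of, respectively strictly below, $c$ in its row, respectively column, that still lie above $D$. Finally $\mathrm{dinv}(\pi)=\mathrm{pathdinv}(D)+\mathrm{tdinv}(\pi)-\mathrm{maxtdinv}(D)$. Stacked parking functions. A stack $S$ in the grid with $n$ rows and $k$ columns is a set of boxes with exactly one box in each row, at least one in each column, each box weakly to the right of the one in the row below. An element of $\mathrm{WLD}(S)$ is a north-east lattice path from $(0,0)$ to $(k,n)$ such that every box of $S$ lies below the path, together with a labeling by positive integers of the $n$ boxes immediately right of its vertical steps, strictly increasing up each column. $\mathrm{WLD}^{\mathrm{stack}}_{n,k}=\bigcup_S\mathrm{WLD}(S)$ over all such stacks (the stack being part of the data). $x^P$ is the product of $x_{\text{label}}$. $\mathrm{area}(P)$ is the number of boxes between the path and the stack, i.e. the number of boxes under the path and strictly above the topmost box of $S$ in their column. For $\mathrm{hdinv}(P)$: let $w_i$ be the number of boxes of $S$ in column $i$; insert $w_i-1$ empty columns immediately after column $i$ for each $i$, joining the path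 by horizontal steps, to get a labeled path $P'$ in the $n\times n$ grid (a label in column $i$ moves to column $w_1+\dots+w_{i-1}+1$ of the same row, columns numbered from 1). Then $\mathrm{hdinv}(P)$ is the number of pairs $(a,b)$ of labeled boxes of $P'$ with label of $a$ $<$ label of $b$ such that either $a,b$ lie on the same slope-one diagonal with $b$ to the right of $a$, or $a$ lies one diagonal lower than $b$ and to the right of $b$. *)

(* Defs.v *)
From HB Require Import structures.
From mathcomp Require Import all_boot all_order all_algebra fraction.
From mathcomp Require Export mpoly.

Set Implicit Arguments.
Unset Strict Implicit.
Unset Printing Implicit Defensive.

Import GRing.Theory.
Local Open Scope ring_scope.

(* A formal power series in x_1, x_2, ... is given by its truncations
   F N = F(x_1, ..., x_N, 0, 0, ...); the variable x_(i+1) is 'X_i. *)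
Definition series (R : comNzRingType) := forall N : nat, {mpoly R[N]}.

Definition is_symfun (R : comNzRingType) (F : series R) : Prop :=
  [/\ forall N, F N \is symmetric,
      forall N (m : 'X_{1..N}), (F N.+1)@_(mnmwiden m) = (F N)@_m
    & exists d : nat, forall N, (msize (F N) <= d)%N].

Definition is_partition (la : seq nat) : bool :=
  sorted geq la && (0%N \notin la).

Definition msym_fun (R : comNzRingType) (mu : seq nat) : series R :=
  fun N => \sum_(m : 'X_{1..N < (sumn mu).+1} |
                   perm_eq [seq e <- bmnm m | e != 0%N] mu) 'X_[m].

Definition complete (R : comNzRingType) (d : nat) : series R :=
  fun N => \sum_(m : 'X_{1..N < d.+1} | mdeg m == d) 'X_[m].

Definition hsym_fun (R : comNzRingType) (mu : seq nat) : series R :=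
  fun N => \prod_(d <- mu) complete R d N.

(* Parts of la equal to 0 contribute no cell. *)
Definition cell (la : seq nat) : finType :=
  {i : 'I_(size la) & 'I_(nth 0%N la i)}.

Definition cell_row (la : seq nat) (c : cell la) : nat := tag c.
Definition cell_col (la : seq nat) (c : cell la) : nat := tagged c.

Definition is_ssyt (la : seq nat) (N : nat) (T : {ffun cell la -> 'I_N}) :
    bool :=
  [forall c : cell la, forall d : cell la,
    ((cell_row c == cell_row d) && (cell_col c < cell_col d)%N
       ==> (T c <= T d)%N) &&
    ((cell_col c == cell_col d) && (cell_row c < cell_row d)%N
       ==> (T c < T d)%N)].

Definition schur (R : comNzRingType) (la : seq nat) : series R :=
  fun N => \sum_(T : {ffun cell la -> 'I_N} | is_ssyt T) \prod_c 'X_(T c).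

(* hall F G c : the Hall inner product <F, G> is c, the R-bilinear form on
   symmetric functions being fixed by <h_la, m_mu> = (la == mu). *)
Definition hall (R : comNzRingType) (F G : series R) (c : R) : Prop :=
  exists (S : seq (seq nat)) (a b : seq nat -> R),
    [/\ uniq S && all is_partition S,
        forall N, F N = \sum_(mu <- S) a mu *: hsym_fun R mu N,
        forall N, G N = \sum_(mu <- S) b mu *: msym_fun R mu N
      & c = \sum_(mu <- S) a mu * b mu].

(* schur_perp la F G : s_la^perp F = G, where s_la^perp is the adjoint of
   multiplication by s_la, i.e. <H, s_la^perp F> = <s_la * H, F> for every
   symmetric function H. As the Hall inner product is nondegenerate, there is
   at most one such G. *)
Definition schur_perp (R : comNzRingType) (la : seq nat) (F G : series R) :
    Prop :=
  [/\ is_symfun F, is_symfun G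
    & forall H : series R, is_symfun H ->
        exists c : R, hall H G c /\ hall (fun N => schur R la N * H N) F c].

(* A north-east lattice path from (0,0) to (k,m) is given by the abscissae
   X y of its vertical steps from height y to height y + 1. The box to the
   right of this step is (X y, y), and a box (x, y) is under the path iff
   X y <= x and above it iff x < X y. A label i : 'I_N stands for the
   positive integer i + 1. *)
Definition lattice_path (k m : nat) := {ffun 'I_m -> 'I_k.+1}.
Definition labeling (m N : nat) := {ffun 'I_m -> 'I_N}.

Definition is_path (k m : nat) (X : lattice_path k m) : bool :=
  [forall y : 'I_m, forall y' : 'I_m, (y <= y')%N ==> (X y <= X y')%N].

Definition is_labeling (k m N : nat) (X : lattice_path k m)
    (l : labeling m N) : bool :=
  [forall y : 'I_m, forall y' : 'I_m,
    (X y == X y') && (y < y')%N ==> (l y < l y')%N].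

(* The next two definitions concern boxes (x i, i), one in each row i < m. *)
Definition attacking (r m : nat) (x : 'I_m -> nat) (a b : 'I_m) : bool :=
  let delta (i : 'I_m) : int := (i : nat)%:Z - (r * x i)%:Z in
  ((delta a == delta b) && (x a < x b)%N) ||
  ((delta a == delta b - 1) && (x b < x a)%N).

Definition tdinv (r m N : nat) (x : 'I_m -> nat) (l : labeling m N) : nat :=
  #|[set p : 'I_m * 'I_m | attacking r x p.1 p.2 && (l p.1 < l p.2)%N]|.

(* Weakly above y = rx: it suffices to look at the lower ends of the vertical
   steps and at the end point (k, kr). *)
Definition is_dyck (r k : nat) (X : lattice_path k (k * r)) : bool :=
  is_path X && [forall y : 'I_(k * r), (r * X y <= y)%N].

(* The interior of the box (x, y) lies above the line y = rx iff its lower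
   right corner (x + 1, y) lies weakly above it. *)
Definition wpf_area (r k : nat) (X : lattice_path k (k * r)) : nat :=
  #|[set c : 'I_k * 'I_(k * r) |
      (X c.2 <= c.1)%N && (r * c.1.+1 <= c.2)%N]|.

Definition arm (k m : nat) (X : lattice_path k m) (x : 'I_k) (y : 'I_m) : nat :=
  #|[set x' : 'I_k | (x < x')%N && (x' < X y)%N]|.

Definition leg (k m : nat) (X : lattice_path k m) (x : 'I_k) (y : 'I_m) : nat :=
  #|[set y' : 'I_m | (y' < y)%N && (x < X y')%N]|.

(* arm / (leg + 1) <= k / K < (arm + 1) / leg with K = kr, denominators
   cleared; the right inequality then holds automatically if leg = 0. *)
Definition pathdinv (r k : nat) (X : lattice_path k (k * r)) : nat :=
  #|[set c : 'I_k * 'I_(k * r) |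
      [&& (c.1 < X c.2)%N,
          (arm X c.1 c.2 * (k * r) <= k * (leg X c.1 c.2).+1)%N
        & (k * leg X c.1 c.2 < (arm X c.1 c.2).+1 * (k * r))%N]]|.

(* Only the relative order of the labels matters, and there are at most kr
   distinct ones, so labels in {1, ..., kr} realize the maximum. *)
Definition maxtdinv (r k : nat) (X : lattice_path k (k * r)) : nat :=
  \max_(l : labeling (k * r) (k * r) | is_labeling X l)
    tdinv r (fun y => X y) l.

Definition dinv (r k N : nat) (X : lattice_path k (k * r))
    (l : labeling (k * r) N) : int :=
  (pathdinv X)%:Z + (tdinv r (fun y => X y) l)%:Z - (maxtdinv X)%:Z.

Definition WPF (r k N : nat) :
    {set lattice_path k (k * r) * labeling (k * r) N} :=
  [set p | is_dyck p.1 && is_labeling p.1 p.2].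

Definition wpf_series (F : fieldType) (q t : F) (r k : nat) : series F :=
  fun N => \sum_(p in WPF r k N)
    (t ^+ wpf_area p.1 * q ^ dinv p.1 p.2) *: \prod_y 'X_(p.2 y).

(* The box of the stack in row y is (s y, y). *)
Definition stack (n k : nat) := {ffun 'I_n -> 'I_k}.

Definition is_stack (n k : nat) (s : stack n k) : bool :=
  [forall y : 'I_n, forall y' : 'I_n, (y <= y')%N ==> (s y <= s y')%N] &&
  [forall x : 'I_k, exists y : 'I_n, s y == x].

Definition stack_area (n k : nat) (s : stack n k) (X : lattice_path k n) :
    nat :=
  #|[set c : 'I_k * 'I_n |
      (X c.2 <= c.1)%N && [forall y : 'I_n, (s y == c.1) ==> (y < c.2)%N]]|.

(* The column of P' to which column x of P moves (columns numbered from 0). *)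
Definition stretch (n k : nat) (s : stack n k) (x : nat) : nat :=
  \sum_(i < k | (i < x)%N) #|[set y : 'I_n | s y == i]|.

Definition hdinv (n k N : nat) (s : stack n k) (X : lattice_path k n)
    (l : labeling n N) : nat :=
  tdinv 1 (fun y => stretch s (X y)) l.

Definition WLD_stack (n k N : nat) :
    {set stack n k * (lattice_path k n * labeling n N)} :=
  [set p | [&& is_stack p.1, is_path p.2.1,
               [forall y : 'I_n, (p.2.1 y <= p.1 y)%N]
             & is_labeling p.2.1 p.2.2]].

Definition wld_series (F : fieldType) (q t : F) (n k : nat) : series F :=
  fun N => \sum_(p in WLD_stack n k N)
    (t ^+ stack_area p.1 p.2.1 * q ^+ hdinv p.1 p.2.1 p.2.2)
      *: \prod_y 'X_(p.2.2 y).

Definition Qqt : fieldType := {fraction {mpoly rat[2]}}.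
Definition qvar : Qqt := tofrac ('X_ord0 : {mpoly rat[2]}).
Definition tvar : Qqt := tofrac ('X_ord_max : {mpoly rat[2]}).

(* Main.v *)
(* Since <h_mu, F> is the coefficient of x^mu in F, the Jacobi-Trudi formula
   gives the coefficient of x^m in s_la^perp F as the alternating sum over
   s of the coefficients of F at the exponent (m, la_i + s(i) - i). For the
   rectangle la = (k-1)^M the letters of m may be taken small and the M others
   large: a parking function then amounts to a set A of small labels in each
   column together with the sets t_0, ..., t_(M-1) of columns that do NOT contain
   a given large letter. The sum over s turns into a Hessenberg determinant in
   the cardinals #|t_u|, and a sign-reversing cancellation collapses the sum over
   all t missing column j exactly e_j times to a single power of q. This e is the
   excess of the columns of a stack (column j has e_j + 1 boxes), and the
   remaining statistics on A are the area and hdinv of the stacked parking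
   functions. The symmetry of the left-hand side, which is an LLT polynomial for
   each Dyck path, reduces to exchanging two consecutive letters. *)

Require Import Defs.
From mathcomp Require Import all_boot all_order all_algebra all_fingroup fraction.
From mathcomp Require Import zify ring mpoly.

Set Implicit Arguments.
Unset Strict Implicit.
Unset Printing Implicit Defensive.

Import Order.TTheory GRing.Theory Num.Theory.
Local Open Scope ring_scope.

(** * Two-letter LLT sums *)

(** Symmetry of the left-hand side lets its coefficients be read at exponent lists in any order;
    since the Jacobi-Trudi sum inherits this invariance, the symmetry of the stacked series needs no
    combinatorial proof. The auxiliary letters are placed above all small ones because this
    separates the dinv. Small boxes keep their levels, and in every column j the large letter u is
    compared at the level f_j minus the number of earlier sets t_v containing j, up to a shift u
    common to all columns. The sets t_u thus act as successive moves of k particles, each move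
    lowering the particles of one set by one, and dinv becomes tdinv of A plus [final_stat] minus
    [drop_stat], where only [drop_stat] sees the order of the moves. The collapse is applied with
    1/q in place of q, and its value cancels [final_stat]. The pathdinv has no counterpart on the
    stacked side. It is absorbed by an identity between counts of levels: each count is a difference
    of positive parts, and the defects telescope over the columns because the path starts and ends
    on the line y = rx. *)

Definition rank_in (T : finType) (pos : T -> int) (Z : {set T}) (x : T) : nat :=
  #|[set z in Z | pos z < pos x]|.

Lemma sum_rank_in (T : finType) (pos : T -> int) (Z : {set T}) (M : Type)
    (idx : M) (op : Monoid.com_law idx) (phi : nat -> M) :
  {in Z &, injective pos} ->
  \big[op/idx]_(x in Z) phi (rank_in pos Z x) = \big[op/idx]_(s < #|Z|) phi s.
Proof.
move: {2}#|Z| (erefl #|Z|) => n; elim: n Z => [|n IHn] Z cZ pinj.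
  by rewrite cZ big_ord0 big1 // => x; rewrite (cards0_eq cZ) inE.
have [x0 x0Z]: exists x, x \in Z by apply/set0Pn; rewrite -cards_eq0 cZ.
case: (@Order.TotalTheory.arg_maxP _ _ T x0 (mem Z) pos x0Z) => x xZ0 xmax; have xZ : x \in Z := xZ0.
have {}xmax z : z \in Z -> pos z <= pos x by move=> zZ; exact: xmax.
have cZ' : #|Z :\ x| = n by move: (cardsD1 x Z); rewrite xZ cZ => -[].
have le_x z : z \in Z -> z != x -> pos z < pos x.
  move=> zZ zx; rewrite lt_neqAle xmax // andbT.
  by apply: contraNneq zx => /pinj ->.
rewrite cZ big_ord_recr /=.
have -> : \big[op/idx]_(s < n) phi s = \big[op/idx]_(s < #|Z :\ x|) phi s by rewrite cZ'.
rewrite -IHn //; last first.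
  by move=> y z; rewrite !inE => /andP[_ yZ] /andP[_ zZ]; exact: pinj.
rewrite (big_setD1 x) //= Monoid.mulmC; congr (op _ (phi _)); last first.
  rewrite /rank_in -cZ'; apply: eq_card => z; rewrite !inE.
  case zZ : (z \in Z); rewrite ?andbF //=.
  by have [->|zx] := eqVneq z x; rewrite ?ltxx // le_x.
apply: eq_bigr => y; rewrite !inE => /andP[yx yZ]; congr phi.
apply: eq_card => z; rewrite !inE.
have [->|//] := eqVneq z x; have := le_x _ yZ yx.
by case: ltgtP; rewrite ?andbF.
Qed.

(** A geometric sum over ranks. It breaks the power of q created by one box into terms attached to
    single elements, each of which [two_letter_add] can absorb. *)
Lemma expr_card_rank (A : comPzRingType) (q : A) (T : finType) (pos : T -> int)
    (Z : {set T}) : {in Z &, injective pos} ->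
  q ^+ #|Z| = 1 + (q - 1) * \sum_(i in Z) q ^+ rank_in pos Z i.
Proof.
move=> pinj; rewrite sum_rank_in // -subrX1 addrC subrK //.
Qed.

Lemma big_powersetD1 (T : finType) (M : nmodType) (V : {set T}) (v : T)
    (F : {set T} -> M) : v \in V ->
  \sum_(S : {set T} | S \subset V) F S =
  \sum_(S : {set T} | S \subset V :\ v) (F S + F (v |: S)).
Proof.
move=> vV; rewrite (bigID (fun S : {set T} => v \in S)) /= addrC big_split /=.
congr (_ + _).
  by apply: eq_bigl => S; rewrite subsetD1.
rewrite (reindex_onto (fun S => v |: S) (fun S => S :\ v)) /=; last first.
  by move=> S /andP[_ vS]; rewrite setD1K.
apply: eq_bigl => S; rewrite setU11 andbT subUset sub1set vV /= subsetD1.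
congr (_ && _); apply/eqP/idP => [<-|vS]; first by rewrite !inE eqxx.
by rewrite setU1K.
Qed.

(** An attack is a window of width C in a linear order. Distance exactly C is kept apart: it means
    adjacency in a column, see [valid]. *)
Definition attacks (T : finType) (pos : T -> int) (C : int) (x y : T) : bool :=
  (pos x < pos y) && (pos y < pos x + C).

Definition n_asc (T : finType) (pos : T -> int) (C : int) (V S : {set T}) : nat :=
  \sum_(y in S) #|[set x in V :\: S | attacks pos C x y]|.

Definition valid (T : finType) (pos : T -> int) (C : int) (V S : {set T}) : bool :=
  [forall x in V, forall y in V,
     (pos y == pos x + C) ==> (x \notin S) && (y \in S)].

(** S is the set of positions of the larger letter, of weight b; the other positions of V carry the
    smaller one, of weight a. *)
Definition two_letter (T : finType) (pos : T -> int) (C : int)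
    (A : comPzRingType) (q a b : A) (V : {set T}) : A :=
  \sum_(S : {set T} | S \subset V)
    (valid pos C V S)%:R * a ^+ #|V :\: S| * b ^+ #|S| * q ^+ n_asc pos C V S.

(** With nothing exactly C below it, i can only be the lower end of a column pair, and a lower end
    must not carry the larger letter. *)
Lemma valid_add (T : finType) (pos : T -> int) (C : int) (V S : {set T}) (i : T) :
  injective pos -> 0 < C ->
  i \in V -> S \subset V :\ i -> (forall x, x \in V -> pos i != pos x + C) ->
  valid pos C V (i |: S) =
    [forall y in V, pos y != pos i + C] && valid pos C (V :\ i) S.
Proof.
move=> pinj C0 iV /subsetP SV below.
apply/forall_inP/andP => [H|[/forall_inP Hi /forall_inP H] x xV].
  split.
    apply/forall_inP => y yV; apply/negP => E.
    by have /forall_inP/(_ y yV) := H i iV; rewrite E setU11.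
  apply/forall_inP => x; rewrite !inE => /andP[xi xV].
  apply/forall_inP => y; rewrite !inE => /andP[yi yV].
  have /forall_inP/(_ y yV) := H x xV.
  by rewrite !inE (negPf xi) (negPf yi).
apply/forall_inP => y yV; apply/implyP => E.
have yi : y != i by apply/negP => /eqP yi; move: (below x xV); rewrite -yi E.
have xi : x != i by apply/negP => /eqP xi; move: (Hi y yV); rewrite -xi E.
have xV' : x \in V :\ i by rewrite !inE xi.
have /forall_inP/(_ y) := H x xV'; rewrite !inE yi yV E => /(_ isT) /=.
by rewrite (negPf xi) (negPf yi).
Qed.

Lemma n_asc_add (T : finType) (pos : T -> int) (C : int) (V S : {set T}) (i : T) :
  i \in V -> S \subset V :\ i ->
  n_asc pos C V (i |: S) =
    (n_asc pos C (V :\ i) S + #|[set x in V :\: (i |: S) | attacks pos C x i]|)%N.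
Proof.
move=> iV /subsetP SV.
have iS : i \notin S by apply/negP => /SV; rewrite !inE eqxx.
rewrite /n_asc big_setU1 //= addnC; congr (_ + _)%N.
apply: eq_bigr => y yS; apply: eq_card => x; rewrite !inE.
by case: (x == i); case: (x \in S); case: (x \in V).
Qed.

(** Attackers of i outside S are counted by [n_asc] and those in S by the extra exponent. Together
    they are all attackers of i, a number independent of S, so the contribution of i factors out. *)
Lemma two_letter_add (T : finType) (pos : T -> int) (C : int)
    (A : comPzRingType) (q a b : A) (V : {set T}) (i : T) :
  injective pos -> 0 < C -> i \in V ->
  (forall x, x \in V -> pos i != pos x + C) ->
  \sum_(S : {set T} | (S \subset V) && (i \in S))
    (valid pos C V S)%:R * a ^+ #|V :\: S| * b ^+ #|S|
      * q ^+ (n_asc pos C V S + #|[set x in S | attacks pos C x i]|) =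
  [forall y in V, pos y != pos i + C]%:R * b * q ^+ #|[set x in V | attacks pos C x i]|
    * two_letter pos C q a b (V :\ i).
Proof.
move=> pinj C0 iV below.
have atti : attacks pos C i i = false by rewrite /attacks ltxx.
rewrite /two_letter mulr_sumr.
rewrite (reindex_onto (fun S => i |: S) (fun S => S :\ i)) /=; last first.
  by move=> S /andP[_ iS]; rewrite setD1K.
apply: eq_big => [S|S].
  rewrite setU11 andbT subUset sub1set iV /= subsetD1; congr (_ && _).
  apply/eqP/idP => [<-|vS]; first by rewrite !inE eqxx.
  by rewrite setU1K.
rewrite setU11 andbT => /andP[SV /eqP ES].
have iS : i \notin S by rewrite -ES !inE eqxx.
have SVi : S \subset V :\ i.
  by move: SV; rewrite subUset sub1set subsetD1 iS andbT => /andP[].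
rewrite valid_add // n_asc_add // cardsU1 iS -addnA.
have -> : V :\: (i |: S) = (V :\ i) :\: S.
  by apply/setP => x; rewrite !inE; case: (x \in V); rewrite ?andbF ?andbT // negb_or andbC.
have -> : (#|[set x in (V :\ i) :\: S | attacks pos C x i]| +
           #|[set x in i |: S | attacks pos C x i]|)%N = #|[set x in V | attacks pos C x i]|.
  rewrite -cardsUI (_ : _ :&: _ = set0) ?cards0 ?addn0; last first.
    apply/setP => x; rewrite !inE; have [->|xi] := eqVneq x i; first by rewrite atti !andbF.
    by case: (x \in S); rewrite /= ?andbF.
  apply: eq_card => x; rewrite !inE; have [->|xi] := eqVneq x i.
    by rewrite atti !andbF.
  rewrite /=; case xS : (x \in S); rewrite ?andbF ?orbF //=.
  by have := subsetP SVi x xS; rewrite !inE => /andP[_ ->].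
rewrite -mulnb natrM !exprD expr1; ring.
Qed.

(* Removing the element of least position gives a recursion symmetric in the
   two letters; its form depends on whether some element sits exactly C above. *)
Lemma two_letterC (T : finType) (pos : T -> int) (C : int)
    (A : comPzRingType) (q a b : A) (V : {set T}) :
  injective pos -> 0 < C ->
  two_letter pos C q a b V = two_letter pos C q b a V.
Proof.
move=> pinj C0; move: {2}(#|V|.+1) (ltnSn #|V|) => n.
elim: n V => // n IHn V; rewrite ltnS => Vn.
have [->|[v0 v0V]] := set_0Vmem V.
  rewrite /two_letter; apply: eq_bigr => S; rewrite subset0 => /eqP ->.
  rewrite setD0 cards0 /= !expr0; ring.
case: (@Order.TotalTheory.arg_minP _ _ T v0 (mem V) pos v0V) => v vV0 vmin0.
have vV : v \in V := vV0.
have vmin z : z \in V -> pos v <= pos z by move=> zV; exact: vmin0.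
move=> {vV0 vmin0 v0 v0V}.
have vltx x : x \in V :\ v -> pos v < pos x.
  rewrite !inE => /andP[xv xV]; rewrite lt_neqAle vmin // andbT.
  by apply: contraNneq xv => /pinj ->.
have cV1 : (#|V :\ v| < n)%N.
  by move: Vn; rewrite (cardsD1 v V) vV.
(* When v has the smaller letter it makes one ascent with each element of N holding the larger
   one. *)
pose N := [set x in V :\ v | attacks pos C v x].
have below i : i \in V :\ v -> i \in N \/ pos i = pos v + C ->
    forall x, x \in V :\ v -> pos i != pos x + C.
  move=> iV iN x /vltx vx; apply/negP => /eqP E.
  have : pos i <= pos v + C.
    by case: iN => [|-> //]; rewrite !inE /attacks => /andP[_ /andP[_ /ltW]].
  by rewrite E lerD2r leNgt vx.
have asc_v (S : {set T}) : S \subset V :\ v -> n_asc pos C V (v |: S) = n_asc pos C (V :\ v) S.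
  move=> SV; rewrite n_asc_add // (_ : [set x in _ | _] = set0) ?cards0 ?addn0 //.
  apply/setP => x; rewrite !inE /attacks; case xV: (x \in V); rewrite ?andbF //.
  by rewrite [pos x < _]ltNge vmin ?andbF.
have asc_nv (S : {set T}) : S \subset V :\ v ->
    n_asc pos C V S = (n_asc pos C (V :\ v) S + #|S :&: N|)%N.
  move=> /subsetP SV; rewrite /n_asc.
  rewrite -[RHS]/(_ + _)%N -sum1_card.
  rewrite [X in (_ + X)%N](_ : _ = \sum_(y in S) attacks pos C v y)%N; last first.
    rewrite big_mkcond [RHS]big_mkcond /=; apply: eq_bigr => y _.
    rewrite !inE; case yS : (y \in S) => //=.
    by have := SV y yS; rewrite !inE => /andP[-> ->] /=; case: attacks.
  rewrite -big_split; apply: eq_bigr => y yS /=.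
  have vS : v \notin S by apply/negP => /SV; rewrite !inE eqxx.
  rewrite (cardsD1 v) !inE vS vV /= addnC; congr (_ + _)%N.
  by apply: eq_card => x; rewrite !inE -!andbA; do ?bool_congr.
have card_nv (S : {set T}) : S \subset V :\ v -> #|V :\: S| = #|(V :\ v) :\: S|.+1.
  move=> /subsetP SV.
  have vS : v \notin S by apply/negP => /SV; rewrite !inE eqxx.
  rewrite (cardsD1 v) !inE vS vV /= add1n; congr _.+1.
  by apply: eq_card => x; rewrite !inE; do ?bool_congr.
have card_v (S : {set T}) : S \subset V :\ v -> V :\: (v |: S) = (V :\ v) :\: S.
  by move=> _; apply/setP => x; rewrite !inE; case: (x \in V); rewrite ?andbF ?andbT // negb_or andbC.
have vNS (S : {set T}) : S \subset V :\ v -> v \notin S.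
  by move/subsetP => SV; apply/negP => /SV; rewrite !inE eqxx.
have [[w wV Ew]|now] : {w | w \in V & pos w = pos v + C} +
    {forall w, w \in V -> pos w != pos v + C}.
  case: (pickP [pred w in V | pos w == pos v + C]) => [w /andP[wV /eqP Ew]|H].
    by left; exists w.
  by right => w wV; have := H w; rewrite /= wV /= => ->.
(* The pair (v, w) forces v small and w large. The elements of S that v attacks are exactly those
   that attack w, so the ascents leaving v supply the extra exponent of [two_letter_add] at w. *)
- have wV' : w \in V :\ v.
    by rewrite !inE wV andbT; apply: contraTneq isT => E; move: Ew; rewrite E; lia.
  have step a' b' : two_letter pos C q a' b' V =
      a' * ([forall y in V :\ v, pos y != pos w + C]%:R * b' *
         q ^+ #|[set x in V :\ v | attacks pos C x w]|
         * two_letter pos C q a' b' ((V :\ v) :\ w)).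
    rewrite -two_letter_add //; last by apply: below => //; right.
    rewrite {1}/two_letter (big_powersetD1 _ vV) mulr_sumr big_mkcondr /=.
    apply: eq_bigr => S SV.
    have vinv : valid pos C V (v |: S) = false.
      apply/negP => /forall_inP/(_ v vV)/forall_inP/(_ w wV).
      by rewrite Ew eqxx setU11.
    rewrite vinv !mul0r addr0.
    have -> : valid pos C V S = (w \in S) && valid pos C (V :\ v) S.
      apply/forall_inP/andP => [H|[wS /forall_inP H] x xV].
        split; first by have /forall_inP/(_ w wV) := H v vV; rewrite Ew eqxx => /andP[].
        apply/forall_inP => x; rewrite inE => /andP[_ xV].
        apply/forall_inP => y; rewrite inE => /andP[_ yV].
        by have /forall_inP/(_ y yV) := H x xV.
      apply/forall_inP => y yV; apply/implyP => E.
      have [Exv|xv] := eqVneq x v.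
        have -> : y = w by apply: pinj; rewrite (eqP E) Exv Ew.
        by rewrite Exv wS vNS.
      have yv : y != v.
        apply/negP => /eqP yv; have := vmin _ xV; rewrite -yv (eqP E); lia.
      have xV' : x \in V :\ v by rewrite !inE xv.
      have yV' : y \in V :\ v by rewrite !inE yv.
      exact: (implyP (forall_inP (H x xV') y yV') E).
    case wS : (w \in S) => /=; last by rewrite !mul0r.
    rewrite card_nv // asc_nv // exprS.
    have -> : S :&: N = [set x in S | attacks pos C x w].
      apply/setP => x; rewrite !inE; case xS : (x \in S) => //=.
      have xV := subsetP SV x xS; move: (vltx x xV); rewrite !inE in xV *.
      by rewrite xV /attacks Ew => vx; rewrite ltrD2r vx andbT.
    ring.
  rewrite !step IHn; first by ring.
  by apply: leq_trans cV1; rewrite ltnS subset_leq_card // subsetDl.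
(* Here v is free: small it contributes a' q^#|S :&: N|, large it contributes b'. Expanding the
   power by [expr_card_rank] leaves a' + b' and terms indexed by i in N, from which [two_letter_add]
   extracts the factor b' that turns a' into the symmetric a' b'. *)
have step a' b' : two_letter pos C q a' b' V =
   (a' + b') * two_letter pos C q a' b' (V :\ v) +
   (q - 1) * a' * b' * \sum_(i in N)
     ([forall y in V :\ v, pos y != pos i + C]%:R *
         q ^+ #|[set x in V :\ v | attacks pos C x i]|
         * two_letter pos C q a' b' ((V :\ v) :\ i)).
  have -> : (q - 1) * a' * b' * \sum_(i in N)
     ([forall y in V :\ v, pos y != pos i + C]%:R *
         q ^+ #|[set x in V :\ v | attacks pos C x i]|
         * two_letter pos C q a' b' ((V :\ v) :\ i)) =
    \sum_(S : {set T} | S \subset V :\ v) \sum_(i in S :&: N)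
      (q - 1) * a' * ((valid pos C (V :\ v) S)%:R * a' ^+ #|(V :\ v) :\: S|
       * b' ^+ #|S| * q ^+ (n_asc pos C (V :\ v) S + #|[set x in S | attacks pos C x i]|)).
    rewrite (exchange_big_dep (mem N)) /=; last by move=> S i _; rewrite inE => /andP[].
    rewrite mulr_sumr; apply: eq_bigr => i iN.
    have iV : i \in V :\ v by move: iN; rewrite inE => /andP[].
    rewrite -mulr_sumr.
    rewrite [X in _ = _ * X](eq_bigl (fun S : {set T} => (S \subset V :\ v) && (i \in S))).
      rewrite two_letter_add //; first by ring.
      by apply: below => //; left.
    by move=> S; rewrite inE iN andbT.
  rewrite /two_letter mulr_sumr -big_split (big_powersetD1 _ vV) /=.
  apply: eq_bigr => S SV.
  have val1 : valid pos C V S = valid pos C (V :\ v) S.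
    apply/forall_inP/forall_inP => H x.
      rewrite inE => /andP[_ xV]; apply/forall_inP => y; rewrite inE => /andP[_ yV].
      by have /forall_inP/(_ y yV) := H x xV.
    move=> xV; apply/forall_inP => y yV; apply/implyP => E.
    have xv : x != v.
      by apply/negP => /eqP xv; have := now y yV; rewrite -xv E.
    have yv : y != v.
      by apply/negP => /eqP yv; have := vmin _ xV; rewrite -yv (eqP E); lia.
    have xV' : x \in V :\ v by rewrite !inE xv.
    have yV' : y \in V :\ v by rewrite !inE yv.
    exact: (implyP (forall_inP (H x xV') y yV') E).
  have val2 : valid pos C V (v |: S) = valid pos C (V :\ v) S.
    rewrite valid_add //; last by move=> x xV; have := vmin x xV; lia.
    by rewrite (_ : [forall y in V, _] = true) //; apply/forall_inP => y /now.
  rewrite val1 val2 asc_v // asc_nv // card_nv // card_v // cardsU1 vNS //.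
  have -> : q ^+ (n_asc pos C (V :\ v) S + #|S :&: N|) =
      q ^+ n_asc pos C (V :\ v) S + (q - 1) * \sum_(i in S :&: N)
      q ^+ (n_asc pos C (V :\ v) S + #|[set x in S | attacks pos C x i]|).
    rewrite exprD (@expr_card_rank _ _ _ pos); last by move=> x y _ _ /pinj.
    rewrite mulrDr mulr1; congr (_ + _).
    rewrite mulrCA; congr (_ * _); rewrite mulr_sumr; apply: eq_bigr => i.
    rewrite !inE => /and3P[iS _ /andP[_ iC]]; rewrite -exprD; congr (_ ^+ (_ + _)%N).
    apply: eq_card => x; rewrite !inE; case xS : (x \in S) => //=.
    have xV := subsetP SV x xS; move: (vltx x xV); rewrite !inE in xV.
    rewrite xV /attacks /= => vx; rewrite vx /=; lia.
  rewrite -!mulr_sumr exprS exprD expr1; ring.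
rewrite !step IHn //; congr (_ + _); first by ring.
rewrite ![_ * a * b](mulrAC _ a b); congr (_ * _); apply: eq_bigr => i _.
rewrite IHn //; apply: leq_trans cV1; rewrite ltnS subset_leq_card // subsetDl //.
Qed.

(** * Symmetry of the parking function series *)

Lemma msymXi (R : comNzRingType) (N : nat) (s : 'S_N) (i : 'I_N) :
  msym s ('X_i : {mpoly R[N]}) = 'X_(s i).
Proof.
rewrite msymX; congr 'X_[_]; apply/mnmP => j; rewrite !mnmE.
by rewrite -(inj_eq (@perm_inj _ s)) permKV.
Qed.

Lemma symmetric_adjacent (R : comNzRingType) (N : nat) (p : {mpoly R[N]}) :
  (forall i j : 'I_N, j = i.+1 :> nat -> msym (tperm i j) p = p) ->
  p \is symmetric.
Proof.
move=> adj.
have lt_fix (d : nat) (i j : 'I_N) : j = (i + d).+1 :> nat -> msym (tperm i j) p = p.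
  elim: d i j => [|d IHd] i j ij; first by apply: adj; rewrite ij addn0.
  have lt_h : ((i + d).+1 < N)%N by apply: leq_ltn_trans (ltn_ord j); lia.
  pose h := Ordinal lt_h.
  have -> : tperm i j = (tperm h j * (tperm i h * tperm h j))%g.
    have ih : i != h by rewrite -val_eqE /=; lia.
    have ij' : i != j by rewrite -val_eqE /=; lia.
    have := tpermJ i h (tperm h j); rewrite tpermL tpermD //; last first.
      by rewrite eq_sym.
      by rewrite eq_sym.
    by rewrite /conjg tpermV.
  have E1 : msym (tperm h j) p = p by apply: adj; rewrite ij /=; lia.
  by rewrite !msymMm E1 (IHd i h) // E1.
have all_fix (i j : 'I_N) : msym (tperm i j) p = p.
  case: (ltngtP i j) => [ij|ji|/val_inj ->].
  - by apply: (lt_fix (j - i.+1)%N); lia.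
  - by rewrite tpermC; apply: (lt_fix (i - j.+1)%N); lia.
  - by rewrite tperm1 msym1m.
apply/issymP => s; have [ts -> _] := prod_tpermP s.
elim/big_rec: _ => [|t s' _ IH]; first exact: msym1m.
by rewrite msymMm all_fix.
Qed.

Definition col_strict (T : finType) (pos : T -> int) (C : int) (N : nat)
    (l : {ffun T -> 'I_N}) : bool :=
  [forall y, forall y', (pos y' == pos y + C) ==> (l y < l y')%N].

Definition ninv (T : finType) (pos : T -> int) (C : int) (N : nat)
    (l : {ffun T -> 'I_N}) : nat :=
  #|[set p : T * T | attacks pos C p.1 p.2 && (l p.1 < l p.2)%N]|.

(** An LLT polynomial indexed by columns: chains of steps C are the columns, windows of width C give
    the inversions. *)
Definition llt (T : finType) (pos : T -> int) (C : int) (R : comNzRingType)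
    (q : R) (N : nat) : {mpoly R[N]} :=
  \sum_(l : {ffun T -> 'I_N} | col_strict pos C l)
    q ^+ ninv pos C l *: \prod_y 'X_(l y).

Section LLTSymmetry.
Variables (T : finType) (pos : T -> int) (C : int) (R : comNzRingType) (q : R).
Variables (N : nat) (i0 i1 : 'I_N).
Hypotheses (pinj : injective pos) (C0 : 0 < C) (i01 : i1 = i0.+1 :> nat).

(** The fibre of [merge] over l0 consists of the ways to raise a part S of the boxes [V l0] from i0
    to i1. As i1 immediately follows i0, comparisons with all other letters, collected in [cond] and
    [const], do not depend on S. *)
Let merge (l : {ffun T -> 'I_N}) : {ffun T -> 'I_N} :=
  [ffun y => if l y == i1 then i0 else l y].
Let lab (l0 : {ffun T -> 'I_N}) (S : {set T}) : {ffun T -> 'I_N} :=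
  [ffun y => if y \in S then i1 else l0 y].
Let V (l0 : {ffun T -> 'I_N}) := [set y | l0 y == i0].
Let cond (l0 : {ffun T -> 'I_N}) : bool :=
  [forall y, forall y', (pos y' == pos y + C) ==>
    ((y \in V l0) && (y' \in V l0)) || (l0 y < l0 y')%N].
Let const (l0 : {ffun T -> 'I_N}) : nat :=
  #|[set p : T * T | [&& attacks pos C p.1 p.2, (l0 p.1 < l0 p.2)%N &
     ~~ ((p.1 \in V l0) && (p.2 \in V l0))]]|.

Lemma neq_i01 : (i0 == i1) = false.
Proof. by apply/negP => /eqP E; have := i01; rewrite E; lia. Qed.

Let lt_mergeE (l0 : {ffun T -> 'I_N}) (S : {set T}) y y' :
  (forall z, l0 z != i1) -> S \subset V l0 ->
  (lab l0 S y < lab l0 S y')%N =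
  if (y \in V l0) && (y' \in V l0) then (y \notin S) && (y' \in S)
  else (l0 y < l0 y')%N.
Proof.
move=> no1 /subsetP SV; rewrite !ffunE.
have V0 z : z \in V l0 -> l0 z = i0 :> nat by rewrite inE => /eqP ->.
have nV0 z : z \notin V l0 -> (z \in S) = false /\ l0 z <> i0 :> nat.
  move=> zV; split; first by apply: contraNF zV => /SV.
  by move=> E; move: zV; rewrite inE (val_inj E : l0 z = i0) eqxx.
have n1 z : l0 z <> i1 :> nat by move=> E; have := no1 z; rewrite (val_inj E : l0 z = i1) eqxx.
have := i01; have := n1 y; have := n1 y'.
case yV : (y \in V l0); case y'V : (y' \in V l0) => /=.
- have := V0 _ yV; have := V0 _ y'V.
  by case: (y \in S); case: (y' \in S) => /=; lia.
- have := V0 _ yV; have [-> ] := nV0 _ (negbT y'V).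
  by case: (y \in S) => /=; lia.
- have := V0 _ y'V; have [-> ] := nV0 _ (negbT yV).
  by case: (y' \in S) => /=; lia.
- by have [-> ] := nV0 _ (negbT yV); have [-> ] := nV0 _ (negbT y'V).
Qed.

Let col_strict_lab (l0 : {ffun T -> 'I_N}) (S : {set T}) :
  (forall z, l0 z != i1) -> S \subset V l0 ->
  col_strict pos C (lab l0 S) = cond l0 && valid pos C (V l0) S.
Proof.
move=> no1 SV; apply/forallP/andP => [H|[/forallP Hc /forall_inP Hv] y].
  split.
    apply/forallP => y; apply/forallP => y'; apply/implyP => E.
    have := implyP (forallP (H y) y') E; rewrite lt_mergeE //.
    by case: ifP => //= _ ->.
  apply/forall_inP => y yV; apply/forall_inP => y' y'V; apply/implyP => E.
  by have := implyP (forallP (H y) y') E; rewrite lt_mergeE // yV y'V.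
apply/forallP => y'; apply/implyP => E; rewrite lt_mergeE //.
have := implyP (forallP (Hc y) y') E.
case yV : (y \in V l0); case y'V : (y' \in V l0) => //= _.
exact: (implyP (forall_inP (Hv y yV) y' y'V) E).
Qed.

Let ninv_lab (l0 : {ffun T -> 'I_N}) (S : {set T}) :
  (forall z, l0 z != i1) -> S \subset V l0 ->
  ninv pos C (lab l0 S) = (const l0 + n_asc pos C (V l0) S)%N.
Proof.
move=> no1 SV; have /subsetP SVs := SV.
have -> : n_asc pos C (V l0) S =
    #|[set p : T * T | [&& attacks pos C p.1 p.2, p.1 \in V l0 :\: S & p.2 \in S]]|.
  rewrite /n_asc -sum1_card.
  under eq_bigr do rewrite -sum1_card.
  rewrite (exchange_big_dep predT) //= pair_big_dep /=.
  apply: eq_bigl => -[x y]; rewrite !inE /=.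
  by case: (y \in S); rewrite ?andbF /= ?andbT // andbC.
rewrite /ninv /const -cardsUI [X in (_ = _ + X)%N](_ : _ = 0%N) ?addn0; last first.
  apply/eqP; rewrite cards_eq0; apply/eqP/setP => -[x y]; rewrite !inE /=.
  case yS : (y \in S); rewrite ?andbF //.
  have := SVs y yS; rewrite !inE => ->.
  by case: (l0 x == i0); rewrite ?andbF.
apply: eq_card => -[x y]; rewrite [LHS]inE lt_mergeE // !inE /=.
case: (attacks _ _ _ _) => //=.
case yS : (y \in S).
  by have := SVs y yS; rewrite inE => ->; case: (l0 x == i0); rewrite ?andbF ?andbT ?orbF.
by rewrite !andbF orbF; case: (_ && _); rewrite ?andbF ?andbT.
Qed.

Let prod_lab (l0 : {ffun T -> 'I_N}) (S : {set T}) :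
  S \subset V l0 ->
  \prod_y 'X_(lab l0 S y) = \prod_(y in ~: V l0) 'X_(l0 y)
    * ('X_i0 ^+ #|V l0 :\: S| * 'X_i1 ^+ #|S|) :> {mpoly R[N]}.
Proof.
move=> SV; have /subsetP SVs := SV.
rewrite (bigID (mem (V l0))) /= mulrC; congr (_ * _).
  apply: eq_big => y; first by rewrite in_setC.
  by move=> yV; rewrite ffunE; case: ifP => // /SVs yV'; rewrite yV' in yV.
rewrite (bigID (mem S)) /= mulrC; congr (_ * _).
  rewrite -prodr_const; apply: eq_big => y; first by rewrite in_setD andbC.
  by case/andP; rewrite inE => /eqP E yS; rewrite ffunE (negPf yS) E.
rewrite -prodr_const; apply: eq_big => y.
  by case yS : (y \in S); rewrite ?andbF // SVs.
by case/andP=> _ yS; rewrite ffunE yS.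
Qed.

Let llt_fiber (l0 : {ffun T -> 'I_N}) : (forall z, l0 z != i1) ->
  \sum_(l : {ffun T -> 'I_N} | col_strict pos C l && (merge l == l0))
    q ^+ ninv pos C l *: \prod_y 'X_(l y) =
  ((cond l0)%:R * q ^+ const l0) *: (\prod_(y in ~: V l0) 'X_(l0 y)
    * two_letter pos C (q%:MP_[N]) 'X_i0 'X_i1 (V l0)).
Proof.
move=> no1; rewrite /two_letter.
rewrite (reindex_onto (lab l0) (fun l => [set y | l y == i1])) /=; last first.
  move=> l /andP[_ /eqP <-]; apply/ffunP => y; rewrite !ffunE inE.
  by case: eqP.
rewrite mulr_sumr scaler_sumr [LHS]big_mkcond [RHS]big_mkcond /=.
apply: eq_bigr => S _; rewrite -andbA.
have -> : (merge (lab l0 S) == l0) && ([set y | lab l0 S y == i1] == S) =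
    (S \subset V l0).
  apply/andP/idP => [[/eqP E1 _]|/subsetP SV].
    apply/subsetP => y yS; have /ffunP/(_ y) := E1.
    by rewrite !ffunE yS eqxx inE => ->.
  split; apply/eqP.
    apply/ffunP => y; rewrite !ffunE; case yS : (y \in S).
      by rewrite eqxx; have := SV y yS; rewrite inE => /eqP.
    by rewrite (negPf (no1 y)).
  apply/setP => y; rewrite inE ffunE; case yS : (y \in S); first by rewrite eqxx.
  by rewrite (negPf (no1 y)).
case SV : (S \subset V l0); rewrite ?andbF // andbT col_strict_lab //.
case: (cond l0); rewrite /= ?mul0r ?scale0r //.
case: (valid _ _ _ _); rewrite /= ?mul0r ?mulr0 ?scaler0 //.
rewrite ninv_lab // prod_lab // !mul1r exprD -scalerA; congr (_ *: _).
by rewrite -mul_mpolyC rmorphXn /=; ring.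
Qed.

(** On each fibre only the two-letter sum involves the variables of i0 and i1, so the claim is
    [two_letterC] fibre by fibre. *)
Lemma llt_adjacent : msym (tperm i0 i1) (llt pos C q N) = llt pos C q N.
Proof.
rewrite /llt (partition_big merge (fun l0 => [forall z, l0 z != i1])) /=; last first.
  move=> l _; apply/forallP => z; rewrite ffunE; case: ifP => [_|/negbT //].
  by rewrite neq_i01.
rewrite raddf_sum /=; apply: eq_bigr => l0 /forallP no1.
rewrite llt_fiber // msymZ msymM; congr (_ *: (_ * _)).
  rewrite rmorph_prod /=; apply: eq_bigr => y; rewrite !inE => y0.
  by rewrite msymXi tpermD // eq_sym.
rewrite [RHS]two_letterC // /two_letter rmorph_sum /=; apply: eq_bigr => S _.
rewrite !rmorphM !rmorphXn /= rmorph_nat !msymXi tpermL tpermR.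
by rewrite -[q%:MP]mulr1 mul_mpolyC msymZ rmorph1.
Qed.

End LLTSymmetry.

Lemma llt_symmetric (T : finType) (pos : T -> int) (C : int) (R : comNzRingType)
    (q : R) (N : nat) : injective pos -> 0 < C -> llt pos C q N \is symmetric.
Proof.
move=> pinj C0; apply: symmetric_adjacent => i j ij.
exact: llt_adjacent.
Qed.

(** The two ways to fall into the open window are the two clauses of [attacking]: same diagonal and
    to the right, or one diagonal higher and to the left. The value C itself is one diagonal higher
    in the same column. *)
Lemma mul_window (C d x : int) : - C < x -> x < C ->
  [/\ (0 < d * C + x < C) = ((d == 0) && (0 < x)) || ((d == 1) && (x < 0)),
      (d * C + x == 0) = (d == 0) && (x == 0)
    & (d * C + x == C) = (d == 1) && (x == 0)].
Proof.
move=> x1 x2.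
have [d0|] := eqVneq d 0; first by rewrite d0; split; lia.
have [d1 _|] := eqVneq d 1; first by rewrite d1; split; lia.
move=> d1 d0; have : 2 <= d \/ d <= -1 by lia.
case=> dd; [have dC : 2 * C <= d * C by nia|have dC : d * C <= - C by nia].
  split; lia.
split; lia.
Qed.

Section PathPosition.
Variables (r k m : nat) (X : lattice_path k m).

(* A linear order on the rows, increasing in y - rx and then in x, for which
   the attacking relation is a window of width k+1. *)
Definition box_pos (y : 'I_m) : int :=
  ((y : nat)%:Z - (r * X y)%:Z) * (k.+1)%:Z + (X y : nat)%:Z.

Lemma box_posB (y y' : 'I_m) :
  box_pos y' - box_pos y =
  ((y' : nat)%:Z - (r * X y')%:Z - ((y : nat)%:Z - (r * X y)%:Z)) * (k.+1)%:Z
    + ((X y' : nat)%:Z - (X y : nat)%:Z).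
Proof. rewrite /box_pos; ring. Qed.

Lemma col_bound (y y' : 'I_m) :
  - (k.+1)%:Z < (X y' : nat)%:Z - (X y : nat)%:Z < (k.+1)%:Z.
Proof. by have := ltn_ord (X y); have := ltn_ord (X y'); lia. Qed.

Lemma att_box_pos (y y' : 'I_m) :
  attacks box_pos (k.+1)%:Z y y' = attacking r (fun z => X z) y y'.
Proof.
have /andP[b1 b2] := col_bound y y'.
have [E _ _] := mul_window ((y' : nat)%:Z - (r * X y')%:Z - ((y : nat)%:Z - (r * X y)%:Z)) b1 b2.
rewrite /attacks /attacking.
have -> : (box_pos y < box_pos y') && (box_pos y' < box_pos y + (k.+1)%:Z) =
  (0 < box_pos y' - box_pos y < (k.+1)%:Z) by lia.
rewrite box_posB E /=.
move: (r * X y)%N (r * X y')%N => u u'; clear; lia.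
Qed.

Lemma box_pos_inj : injective box_pos.
Proof.
move=> y y' E; have /andP[b1 b2] := col_bound y y'.
have [_ E' _] := mul_window ((y' : nat)%:Z - (r * X y')%:Z - ((y : nat)%:Z - (r * X y)%:Z)) b1 b2.
move: E'; rewrite -box_posB E subrr eqxx => /esym/andP[d0 x0].
have XE : X y = X y' by apply: val_inj => /=; lia.
by apply: val_inj; move: d0; rewrite XE /=; lia.
Qed.

Lemma box_posS (y y' : 'I_m) :
  (box_pos y' == box_pos y + (k.+1)%:Z) = (X y == X y') && (y' == y.+1 :> nat).
Proof.
have /andP[b1 b2] := col_bound y y'.
have [_ _ E'] := mul_window ((y' : nat)%:Z - (r * X y')%:Z - ((y : nat)%:Z - (r * X y)%:Z)) b1 b2.
have -> : (box_pos y' == box_pos y + (k.+1)%:Z) = (box_pos y' - box_pos y == (k.+1)%:Z).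
  by rewrite subr_eq addrC.
rewrite box_posB E'; apply/andP/andP => [[d1 x0]|[/eqP xE yE]].
  have XE : X y = X y' by apply: val_inj => /=; lia.
  by rewrite XE in d1 *; rewrite eqxx; split => //; lia.
by rewrite xE; split; lia.
Qed.

(** Strictness between consecutive rows suffices, because monotonicity of the path puts all rows
    between two rows of a column into that column. *)
Lemma col_strict_labeling (N : nat) (l : labeling m N) : is_path X ->
  col_strict box_pos (k.+1)%:Z l = is_labeling X l.
Proof.
move=> /forallP pX; apply/forallP/forallP => H y.
  apply/forallP => y'; apply/implyP => /andP[/eqP XE yy'].
  have [d] : exists d, y' = (y + d).+1 :> nat by exists (y' - y.+1)%N; lia.
  elim: d y' XE yy' => [|d IHd] y' XE yy' E.
    apply: (implyP (forallP (H y) y')); rewrite box_posS XE eqxx; lia.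
  have zm : ((y + d).+1 < m)%N by have := ltn_ord y'; lia.
  pose z := Ordinal zm.
  have Xz : X y = X z.
    apply: val_inj; apply/eqP; rewrite eqn_leq.
    rewrite (implyP (forallP (pX y) z)) /=; last by lia.
    by rewrite XE (implyP (forallP (pX z) y')) //=; lia.
  apply: (@ltn_trans (l z)); first by apply: IHd => //=; lia.
  apply: (implyP (forallP (H z) y')); rewrite box_posS -Xz XE eqxx /=; lia.
apply/forallP => y'; apply/implyP; rewrite box_posS => /andP[XE yy'].
apply: (implyP (forallP (H y) y')); rewrite XE /=; lia.
Qed.

Lemma ninv_tdinv (N : nat) (l : labeling m N) :
  ninv box_pos (k.+1)%:Z l = tdinv r (fun y => X y) l.
Proof. by apply: eq_card => p; rewrite !inE att_box_pos. Qed.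

End PathPosition.

(** [pathdinv] and [maxtdinv] depend on the path alone; for a fixed path the labels enter through
    [tdinv], which is the inversion statistic of an LLT polynomial. *)
Lemma wpf_seriesE (F : fieldType) (q t : F) (r k N : nat) : q != 0 ->
  wpf_series q t r k N =
  \sum_(X : lattice_path k (k * r) | is_dyck X)
   (t ^+ wpf_area X * q ^ ((pathdinv X)%:Z - (maxtdinv X)%:Z)) *:
     llt (box_pos r X) (k.+1)%:Z q N.
Proof.
move=> q0; rewrite /wpf_series.
rewrite (eq_bigl (fun p => is_dyck p.1 && is_labeling p.1 p.2)); last first.
  by move=> p; rewrite inE.
rewrite -(pair_big_dep (@is_dyck r k) (fun X (l : labeling (k * r) N) => is_labeling X l)
  (fun X l => (t ^+ wpf_area X * q ^ dinv X l) *: \prod_y 'X_(l y))) /=.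
apply: eq_bigr => X /andP[pX _]; rewrite /llt scaler_sumr.
apply: eq_big => l; first by rewrite col_strict_labeling.
move=> _; rewrite scalerA -mulrA; congr (_ * _ *: _).
by rewrite ninv_tdinv /dinv addrAC; exact: (expfzDr _ _ q0).
Qed.

Lemma mcoeff_llt (T : finType) (pos : T -> int) (C : int) (R : comNzRingType)
    (q : R) (N : nat) (m : 'X_{1..N}) :
  (llt pos C q N)@_m = \sum_(l : {ffun T -> 'I_N} | col_strict pos C l)
    q ^+ ninv pos C l * [forall i, #|[set y | l y == i]| == m i]%:R.
Proof.
rewrite /llt raddf_sum /=; apply: eq_bigr => l _; rewrite mcoeffZ mprodXE mcoeffX.
congr (_ * (nat_of_bool _)%:R); apply/eqP/forallP => [<- i|H].
  rewrite mnm_sumE -sum1_card big_mkcond /=; apply/eqP/eq_bigr => y _.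
  by rewrite inE mnmE; case: eqP.
apply/mnmP => i; rewrite mnm_sumE -(eqP (H i)) -sum1_card [RHS]big_mkcond /=.
by apply/eq_bigr => y _; rewrite inE mnmE; case: eqP.
Qed.

Lemma llt_stable (T : finType) (pos : T -> int) (C : int) (R : comNzRingType)
    (q : R) (N : nat) (m : 'X_{1..N}) :
  (llt pos C q N.+1)@_(mnmwiden m) = (llt pos C q N)@_m.
Proof.
rewrite !mcoeff_llt.
pose w : 'I_N -> 'I_N.+1 := widen_ord (leqnSn N).
pose h (l : {ffun T -> 'I_N}) : {ffun T -> 'I_N.+1} := [ffun y => w (l y)].
have winj : injective w by move=> i j /(congr1 val) /= /val_inj.
have hinj : injective h.
  by move=> l l' /ffunP E; apply/ffunP => y; have := E y; rewrite !ffunE => /winj.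
rewrite (bigID (fun l : {ffun T -> 'I_N.+1} => [forall y, l y != ord_max])) /=.
rewrite [X in _ + X]big1 ?addr0; last first.
  move=> l /andP[_ /forallPn[y]]; rewrite negbK => /eqP ly.
  rewrite (_ : [forall i, _] = false) ?mulr0 //; apply/negP => /forallP/(_ ord_max).
  rewrite mnmwiden_ordmax cards_eq0 => /eqP/setP/(_ y).
  by rewrite !inE ly eqxx.
rewrite (reindex_omap h (fun l' => [pick l | h l == l'])) /=; last first.
  move=> l /andP[_ /forallP av].
  have ex y : exists i, w i == l y.
    have ly : (l y < N)%N.
      have := ltn_ord (l y); rewrite ltnS leq_eqVlt => /orP[/eqP E|//].
      by have := av y; rewrite -val_eqE /= E eqxx.
    by exists (Ordinal ly); rewrite -val_eqE.
  have [g gE] := fin_all_exists ex.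
  case: pickP => [l' /eqP <- //|/(_ (finfun g))/eqP []].
  by apply/ffunP => y; rewrite !ffunE; apply/eqP; rewrite gE.
apply: eq_big => l.
  have -> : [pick l0 | h l0 == h l] == Some l.
    by case: pickP => [l' /eqP/hinj -> //|/(_ l)]; rewrite eqxx.
  rewrite andbT; have -> : [forall y, h l y != ord_max].
    apply/forallP => y; rewrite ffunE -val_eqE /=; have := ltn_ord (l y); lia.
  rewrite andbT /col_strict; apply: eq_forallb => y; apply: eq_forallb => y'.
  by rewrite !ffunE.
move=> _; congr (q ^+ _ * (nat_of_bool _)%:R).
  by apply: eq_card => p; rewrite !inE !ffunE.
apply/forallP/forallP => H i.
  have := H (w i); rewrite /w mnmwiden_widen => /eqP <-; apply/eqP.
  by apply: eq_card => y; rewrite !inE ffunE (inj_eq winj).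
case: (unliftP ord_max i) => [j ->|->].
  have -> : lift ord_max j = w j.
    by apply: val_inj; rewrite /= /bump leqNgt ltn_ord.
  rewrite /w mnmwiden_widen -(eqP (H j)); apply/eqP.
  by apply: eq_card => y; rewrite !inE ffunE (inj_eq winj).
rewrite mnmwiden_ordmax cards_eq0; apply/eqP/setP => y; rewrite !inE ffunE.
rewrite -val_eqE /=; have := ltn_ord (l y); lia.
Qed.

Lemma msize_llt (T : finType) (pos : T -> int) (C : int) (R : comNzRingType)
    (q : R) (N : nat) : (msize (llt pos C q N) <= #|T|.+1)%N.
Proof.
rewrite /llt; apply: leq_trans (msize_sum _ _ _) _; apply/bigmax_leqP => l _.
apply: leq_trans (msizeZ_le _ _) _; rewrite mprodXE msizeX mdeg_sum.
by under eq_bigr do rewrite mdeg1; rewrite sum1_card.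
Qed.

Lemma wpf_symfun (F : fieldType) (q t : F) (r k : nat) : q != 0 ->
  is_symfun (wpf_series q t r k).
Proof.
move=> q0; split.
- move=> N; rewrite wpf_seriesE //; elim/big_ind: _ => [|p1 p2 s1 s2|X _].
  + exact: rpred0.
  + exact: rpredD.
  by apply/rpredZ/llt_symmetric => //; exact: box_pos_inj.
- move=> N m; rewrite !wpf_seriesE // !raddf_sum /=; apply: eq_bigr => X _.
  by rewrite !mcoeffZ llt_stable.
- exists (k * r).+1 => N; rewrite wpf_seriesE //.
  apply: leq_trans (msize_sum _ _ _) _; apply/bigmax_leqP => X _.
  apply: leq_trans (msizeZ_le _ _) _; apply: leq_trans (msize_llt _ _ _ _) _.
  by rewrite card_ord.
Qed.

(** * Hall inner product against complete functions *)

(** Exponents are functions on all of nat so that truncations to different numbers of variables can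
    be compared. *)
Definition coef_at (R : comNzRingType) (G : series R) (N : nat) (a : nat -> nat) : R :=
  (G N)@_[multinom a i | i < N].

Definition coef_of (R : comNzRingType) (G : series R) (al : seq nat) : R :=
  coef_at G (size al) (nth 0%N al).

Definition parts (al : seq nat) : seq nat := sort geq [seq e <- al | e != 0%N].

Section SymmetricSeries.
Variables (R : comNzRingType) (G : series R).
Hypothesis symG : is_symfun G.

Lemma coef_at_widen N N' a : (N <= N')%N -> (forall i, (N <= i)%N -> a i = 0%N) ->
  coef_at G N' a = coef_at G N a.
Proof.
move=> + a0; elim: N' => [|N' IH]; first by rewrite leqn0 => /eqP ->.
rewrite leq_eqVlt => /orP[/eqP -> //|]; rewrite ltnS => le.
rewrite -IH // /coef_at; case: symG => _ st _; rewrite -[RHS]st; congr (_@__).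
apply/mnmP => i; rewrite mnmE; case: (unliftP ord_max i) => [j ->|->].
  have -> : lift ord_max j = widen_ord (leqnSn N') j.
    by apply: val_inj; rewrite /= /bump leqNgt ltn_ord.
  by rewrite mnmwiden_widen mnmE.
by rewrite mnmwiden_ordmax a0.
Qed.

Lemma coef_of_at N al : (size al <= N)%N -> coef_of G al = coef_at G N (nth 0%N al).
Proof.
by move=> le; rewrite (@coef_at_widen (size al)) // => i; exact: nth_default.
Qed.

Lemma coef_of_perm al be : perm_eq al be -> coef_of G al = coef_of G be.
Proof.
move=> pe; rewrite /coef_of /coef_at.
have /tuple_permP[s E] : perm_eq (in_tuple al) (tcast (esym (perm_size pe)) (in_tuple be)).
  by rewrite val_tcast.
have symN : G (size al) \is symmetric by case: symG.
have E' i : nth 0%N al i = if insub i is Some j then nth 0%N be (s j) else 0%N.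
  case: insubP => [j _ <-|]; last by rewrite -leqNgt => /(nth_default _) ->.
  have := congr1 (fun z => nth 0%N z j) E.
  by rewrite -[X in _ = X]tnth_nth tnth_mktuple (tnth_nth 0%N) val_tcast.
have -> : [multinom nth 0%N al i | i < size al] =
  [multinom [multinom nth 0%N be i | i < size al] (s i) | i < size al].
  by apply/mnmP => i; rewrite !mnmE E' valK.
by rewrite msym_coeff // (perm_size pe).
Qed.

Lemma coef_of_filter al : coef_of G [seq e <- al | e != 0%N] = coef_of G al.
Proof.
pose z := nseq (size [seq e <- al | e == 0%N]) 0%N.
have -> : coef_of G [seq e <- al | e != 0%N] = coef_of G ([seq e <- al | e != 0%N] ++ z).
  rewrite [RHS]/coef_of (@coef_of_at (size ([seq e <- al | e != 0%N] ++ z))).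
    rewrite /coef_at; congr (_@__); apply/mnmP => i; rewrite !mnmE nth_cat.
    by case: ltnP => // le; rewrite nth_default // nth_nseq if_same.
  by rewrite size_cat leq_addr.
apply: coef_of_perm; have -> : z = [seq e <- al | e == 0%N].
  by apply/esym/all_pred1P/allP => e; rewrite mem_filter => /andP[].
rewrite perm_sym -(perm_filterC (fun e => e != 0%N)) perm_cat2l.
by rewrite (@eq_filter _ _ (fun e => e == 0%N)) // => e; rewrite /= negbK.
Qed.

Lemma coef_of_parts al : coef_of G (parts al) = coef_of G al.
Proof. by rewrite -[RHS]coef_of_filter; apply: coef_of_perm; rewrite perm_sort. Qed.

Lemma mcoeff_coef_of N (m : 'X_{1..N}) : (G N)@_m = coef_of G m.
Proof.
rewrite (@coef_of_at N) ?size_tuple // /coef_at; congr (_@__).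
by apply/mnmP => i; rewrite mnmE (mnm_nth 0%N).
Qed.

End SymmetricSeries.

Lemma sumn_parts al : sumn (parts al) = sumn al.
Proof.
rewrite /parts (perm_sumn (permEl (perm_sort _ _))).
by elim: al => //= e al <-; case: eqP => // ->.
Qed.

Lemma mdeg_sumn N (m : 'X_{1..N}) : mdeg m = sumn m.
Proof. by rewrite sumnE. Qed.

Lemma parts_is_partition al : is_partition (parts al).
Proof.
rewrite /is_partition /parts sort_sorted; last by move=> x y; exact: leq_total.
by rewrite mem_sort mem_filter.
Qed.

Lemma perm_parts al mu : is_partition mu ->
  perm_eq [seq e <- al | e != 0%N] mu = (parts al == mu).
Proof.
move=> /andP[smu zmu]; apply/idP/eqP => [pe|<-]; last by rewrite perm_sym perm_sort.
apply: (@sorted_eq _ geq) => //.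
- by move=> x y z xy yz; apply: leq_trans yz xy.
- by move=> x y /andP[? ?]; apply/eqP; rewrite eqn_leq; apply/andP.
- by apply: sort_sorted => x y; exact: leq_total.
- by rewrite perm_sort.
Qed.

Lemma mcoeff_msym_fun (R : comNzRingType) mu N (m : 'X_{1..N}) : is_partition mu ->
  (msym_fun R mu N)@_m = (parts m == mu)%:R.
Proof.
move=> pmu; rewrite -perm_parts // /msym_fun raddf_sum /=.
under eq_bigr do rewrite mcoeffX.
case: (boolP (perm_eq _ _)) => [pe|npe].
  have md : (mdeg m < (sumn mu).+1)%N.
    by rewrite ltnS mdeg_sumn -sumn_parts -(perm_sumn pe) (perm_sumn (permEl (perm_sort _ _))).
  rewrite (bigD1 (BMultinom md)) //= eqxx big1 ?addr0 // => m' /andP[_ ne].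
  by rewrite (_ : (_ == _) = false) //; apply: contraNF ne => /eqP E; rewrite bmeqP E.
rewrite big1 // => m' pe; case: eqP => // E; by rewrite -E pe in npe.
Qed.

Lemma hsym_fun_parts (R : comNzRingType) al N :
  hsym_fun R (parts al) N = hsym_fun R al N.
Proof.
rewrite /hsym_fun /parts (perm_big _ (permEl (perm_sort _ _))) /= big_filter.
rewrite [RHS](bigID (fun e => e != 0%N)) /= [X in _ = _ * X]big1 ?mulr1 //.
move=> d; rewrite negbK => /eqP ->; rewrite /complete (bigD1 bm0) /=; last by rewrite mdeg0.
rewrite big1 ?addr0 ?mpolyX0 // => m /andP[m0 ne].
by move: ne; rewrite bmeqP /= -mdeg_eq0 m0.
Qed.

(** Pairing with h_al reads off the coefficient of x^al. The lists in P may be unsorted, contain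
    zeros or repeat; they are regrouped through [parts]. *)
Lemma hall_complete (R : comNzRingType) (E G : series R) (P : seq (R * seq nat)) :
  is_symfun G -> (forall N, E N = \sum_(p <- P) p.1 *: hsym_fun R p.2 N) ->
  hall E G (\sum_(p <- P) p.1 * coef_of G p.2).
Proof.
move=> symG EP; have [_ _ [d Gd]] := symG.
(* [hall] asks for one list of partitions serving both expansions. Partitions of size at most d,
   which have at most d parts, exhaust G; those coming from P are added for E. *)
pose S := undup ([seq parts (bmnm m) | m : 'X_{1..d < d.+1}] ++ [seq parts p.2 | p <- P]).
have partS : all is_partition S.
  apply/allP => mu; rewrite mem_undup mem_cat => /orP[/mapP[m _ ->]|/mapP[p _ ->]];
  exact: parts_is_partition.
have PS p : p \in P -> parts p.2 \in S.
  by move=> pP; rewrite mem_undup mem_cat; apply/orP; right; apply: map_f.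
have regroup (M : lmodType R) (f : seq nat -> M) :
  \sum_(mu <- S) (\sum_(p <- P | parts p.2 == mu) p.1) *: f mu =
  \sum_(p <- P) p.1 *: f (parts p.2).
  under eq_bigr do rewrite scaler_suml.
  rewrite (exchange_big_dep predT) //= big_seq [RHS]big_seq; apply: eq_bigr => p pP.
  rewrite (eq_bigl (pred1 (parts p.2))); last by move=> mu; rewrite /= eq_sym.
  by rewrite -big_filter filter_pred1_uniq ?undup_uniq ?PS // big_seq1.
exists S, (fun mu => \sum_(p <- P | parts p.2 == mu) p.1), (coef_of G); split.
- by rewrite undup_uniq.
- move=> N; rewrite (regroup _ (fun mu => hsym_fun R mu N)) EP.
  by apply: eq_bigr => p _; rewrite hsym_fun_parts.
- move=> N; apply/mpolyP => m; rewrite raddf_sum /=.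
  rewrite (eq_big_seq (fun mu => coef_of G mu * (parts m == mu)%:R)); last first.
    by move=> mu /(allP partS) pmu; rewrite mcoeffZ mcoeff_msym_fun.
  have [mS|mS] := boolP (parts m \in S).
    rewrite (bigD1_seq (parts m)) ?undup_uniq //= eqxx mulr1 coef_of_parts //.
    rewrite big1 ?addr0 -?mcoeff_coef_of // => mu ne.
    by rewrite eq_sym (negPf ne) mulr0.
  rewrite big1_seq; last first.
    move=> mu /andP[_ muS]; case: eqP => [E0|_]; rewrite ?mulr0 //.
    by rewrite E0 muS in mS.
  apply/eqP; rewrite mcoeff_eq0; apply/negP => mG; move/negP: mS; apply.
  have mdd : (mdeg m <= d)%N.
    by apply: leq_trans (Gd N); apply: ltnW; apply: msize_mdeg_lt.
  rewrite mem_undup mem_cat; apply/orP; left.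
  (* The monomial m may involve more than d variables; c carries its nonzero exponents over to d
     variables. *)
  pose c := [multinom nth 0%N (parts m) i | i < d].
  have sz : (size (parts m) <= d)%N.
    apply: leq_trans mdd; rewrite /parts size_sort mdegE.
    rewrite size_filter -sum1_count big_mkcond /=.
    rewrite -[X in (_ <= X)%N](big_tuple _ _ _ predT (fun e => e)) /=.
    by apply: leq_sum => e _; case: e.
  have Ec : [seq e <- c | e != 0%N] = [seq e <- parts m | e != 0%N].
    have -> : c = parts m ++ nseq (d - size (parts m)) 0%N :> seq nat.
      apply: (@eq_from_nth _ 0%N); first by rewrite size_tuple size_cat size_nseq subnKC.
      rewrite size_tuple => i id; rewrite -(mnm_nth 0%N c (Ordinal id)) mnmE /=.
      rewrite nth_cat; case: ltnP => // le; by rewrite nth_nseq if_same nth_default.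
    by rewrite filter_cat [X in _ ++ X](_ : _ = [::]) ?cats0 //; elim: (_ - _)%N.
  have Epp : parts c = parts m.
    rewrite /parts Ec; have -> : [seq e <- parts m | e != 0%N] = parts m.
      by apply/all_filterP/allP => e; rewrite mem_sort mem_filter => /andP[].
    by rewrite [sort _ (parts m)]sorted_sort //; [move=> x y z xy yz; apply: leq_trans yz xy|
      apply: sort_sorted => x y; exact: leq_total].
  have cd : (mdeg c < d.+1)%N.
    by rewrite ltnS mdeg_sumn -sumn_parts Epp sumn_parts -mdeg_sumn.
  by apply/mapP; exists (BMultinom cd); rewrite ?mem_enum.
- have E1 := regroup R^o (coef_of G).
  rewrite [RHS]E1; apply: eq_bigr => p _; by rewrite coef_of_parts.
Qed.

Lemma mcoeff_complete (R : comNzRingType) d N (m : 'X_{1..N}) :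
  (complete R d N)@_m = (mdeg m == d)%:R.
Proof.
rewrite /complete raddf_sum /=; under eq_bigr do rewrite mcoeffX.
case: eqP => [md|md].
  have md' : (mdeg m < d.+1)%N by rewrite md.
  rewrite (bigD1 (BMultinom md')) /= ?md //= eqxx big1 ?addr0 // => m' /andP[_ ne].
  by rewrite (_ : (_ == _) = false) //; apply: contraNF ne => /eqP E; rewrite bmeqP E.
rewrite big1 // => m' /eqP pe; case: eqP => // E; by rewrite -E pe in md.
Qed.

Lemma mcoeffMXE (R : comNzRingType) N (p : {mpoly R[N]}) (u m : 'X_{1..N}) :
  (p * 'X_[u])@_m = if (u <= m)%MM then p@_(m - u)%MM else 0.
Proof.
case: ifP => [um|num]; first by rewrite -{1}(submK um) addmC mcoeffMX.
apply/eqP; rewrite mcoeff_eq0 (perm_mem (msuppMX _ _)).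
by apply: contraFN num => /mapP[m' _ ->]; exact: lem_addr.
Qed.

Lemma complete0 (R : comNzRingType) N : complete R 0 N = 1.
Proof. by apply/mpolyP => m; rewrite mcoeff_complete mcoeff1 mdeg_eq0. Qed.

Lemma complete_symmetric (R : comNzRingType) d N : complete R d N \is symmetric.
Proof.
apply/issymP => s; apply/mpolyP => m.
by rewrite mcoeff_sym !mcoeff_complete mdeg_mperm.
Qed.

Lemma msize_complete (R : comNzRingType) d N : (msize (complete R d N) <= d.+1)%N.
Proof.
rewrite /complete; apply: leq_trans (msize_sum _ _ _) _.
by apply/bigmax_leqP => m /eqP md; rewrite msizeX md.
Qed.

(* Setting the last variable to 0 sends [p] to [p']. *)
Definition restricts (R : comNzRingType) N (p : {mpoly R[N.+1]}) (p' : {mpoly R[N]}) :=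
  exists r, p = mwiden p' + r * 'X_ord_max.

Lemma restricts_mcoeff (R : comNzRingType) N (p : {mpoly R[N.+1]}) p' m :
  restricts p p' -> p@_(mnmwiden m) = p'@_m.
Proof.
case=> r ->; rewrite mcoeffD mwiden_mnmwiden mcoeffMXE; case: ifP; rewrite ?addr0 //.
by move/mnm_lepP/(_ ord_max); rewrite mnmwiden_ordmax mnmE eqxx.
Qed.

Lemma restrictsM (R : comNzRingType) N (p q : {mpoly R[N.+1]}) p' q' :
  restricts p p' -> restricts q q' -> restricts (p * q) (p' * q').
Proof.
case=> r -> [s ->]; exists (r * mwiden q' + mwiden p' * s + r * 'X_ord_max * s).
by rewrite mwidenM; ring.
Qed.

Lemma mdeg_mnmwiden N (m : 'X_{1..N}) : mdeg (mnmwiden m) = mdeg m.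
Proof.
rewrite !mdegE big_ord_recr /= mnmwiden_ordmax addn0.
by apply: eq_bigr => i _; rewrite mnmwiden_widen.
Qed.

Lemma restricts_complete (R : comNzRingType) d N :
  restricts (complete R d N.+1) (complete R d N).
Proof.
exists (if d is d'.+1 then complete R d' N.+1 else 0).
apply/mpolyP => m; rewrite mcoeffD mcoeff_complete mcoeffMXE.
case: ifP => [le|nle].
  have -> : (mwiden (complete R d N))@_m = 0.
    rewrite (mwidenE (k := d.+1)) ?msize_complete // raddf_sum big1 //= => k _.
    rewrite mcoeffZ mcoeffX.
    case: eqP => [E|]; last by rewrite mulr0.
    move/mnm_lepP/(_ ord_max): le.
    by rewrite -E mnmwiden_ordmax mnmE eqxx.
  have md : mdeg m = (mdeg (m - U_(ord_max))%MM).+1.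
    by rewrite -{1}(submK le) mdegD mdeg1 addn1.
  by case: d => [|d]; rewrite add0r ?mcoeff0 ?mcoeff_complete md.
have m0 : m ord_max = 0%N.
  apply/eqP; apply: contraFT nle => mm; apply/mnm_lepP => i; rewrite mnmE.
  by case: eqP => // <-; rewrite lt0n.
have -> : m = mnmwiden [multinom m (widen_ord (leqnSn N) i) | i < N].
  apply/mnmP => i; case: (unliftP ord_max i) => [j ->|->].
    have -> : lift ord_max j = widen_ord (leqnSn N) j.
      by apply: val_inj; rewrite /= /bump leqNgt ltn_ord.
    by rewrite mnmwiden_widen mnmE.
  by rewrite mnmwiden_ordmax.
by rewrite mwiden_mnmwiden mcoeff_complete mdeg_mnmwiden addr0.
Qed.

Lemma restricts_hsym_fun (R : comNzRingType) al N :
  restricts (hsym_fun R al N.+1) (hsym_fun R al N).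
Proof.
rewrite /hsym_fun; elim: al => [|d al IH]; last first.
  by rewrite !big_cons; apply: restrictsM => //; exact: restricts_complete.
by rewrite !big_nil; exists 0; rewrite mul0r addr0 mwiden1.
Qed.

Lemma msize_hsym_fun (R : comNzRingType) al N :
  (msize (hsym_fun R al N) <= (sumn al).+1)%N.
Proof.
have : hsym_fun R al N \is (sumn al).-homog.
  rewrite /hsym_fun; elim: al => [|d al IH]; first by rewrite big_nil dhomog1.
  rewrite big_cons /=; apply: dhomogM => //; rewrite /complete.
  by apply: rpred_sum => m /eqP md; rewrite dhomogX; apply/eqP.
move/dhomogP => H; rewrite msizeE; apply/bigmax_leqP_seq => m mp _.
by rewrite H.
Qed.

Definition hcomb (R : comNzRingType) (P : seq (R * seq nat)) : series R :=
  fun N => \sum_(p <- P) p.1 *: hsym_fun R p.2 N.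

Lemma hcomb_symfun (R : comNzRingType) (P : seq (R * seq nat)) : is_symfun (hcomb P).
Proof.
split.
- move=> N; rewrite /hcomb; elim/big_ind: _ => [|p1 p2 s1 s2|p _].
  + exact: rpred0.
  + exact: rpredD.
  apply: rpredZ; rewrite /hsym_fun; elim/big_ind: _ => [|p1 p2 s1 s2|d _].
  + exact: rpred1.
  + exact: rpredM.
  exact: complete_symmetric.
- move=> N m; rewrite /hcomb !raddf_sum /=; apply: eq_bigr => p _.
  by rewrite !mcoeffZ (restricts_mcoeff _ (restricts_hsym_fun _ _ _)).
- exists (\max_(p <- P) (sumn p.2).+1) => N.
  apply: leq_trans (msize_sum _ _ _) _.
  apply: (big_rec2 (fun x y => x <= y)%N) => // p y x _ le.
  rewrite geq_max !leq_max; apply/andP; split; last by rewrite le orbT.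
  by rewrite (leq_trans (msizeZ_le _ _)) ?msize_hsym_fun.
Qed.

(** A monomial of degree below d has fewer than d nonzero exponents when d is positive, so symmetry
    moves it into the first d variables, where A and B agree. *)
Lemma symfun_eq (R : comNzRingType) (A B : series R) d :
  is_symfun A -> is_symfun B ->
  (forall N, msize (A N) <= d)%N -> (forall N, msize (B N) <= d)%N ->
  A d = B d -> forall N, A N = B N.
Proof.
move=> sA sB dA dB E N; apply/mpolyP => m.
have [md|md] := leqP d (mdeg m).
  have zero (C : series R) : (msize (C N) <= d)%N -> (C N)@_m = 0.
    move=> dC; apply/eqP; rewrite mcoeff_eq0; apply: msize_mdeg_ge.
    exact: leq_trans md.
  by rewrite !zero.
have sz : (size (parts m) <= d)%N.
  apply: leq_trans (ltnW md); rewrite mdeg_sumn -sumn_parts.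
  have : 0%N \notin parts m by rewrite mem_sort mem_filter.
  elim: (parts m) => //= e s IH; rewrite inE negb_or => /andP[e0 /IH]; lia.
rewrite !mcoeff_coef_of // -[LHS]coef_of_parts // -[RHS]coef_of_parts //.
by rewrite !(@coef_of_at _ _ _ d) // /coef_at E.
Qed.

(** The degree bound w is carried along because [symfun_eq] needs it to pass from one truncation to
    all of them. *)
Definition is_hcomb (R : comNzRingType) N w (p : {mpoly R[N]}) :=
  exists2 P : seq (R * seq nat), all (fun c => sumn c.2 <= w)%N P & p = hcomb P N.

Lemma is_hcomb0 (R : comNzRingType) N w : is_hcomb w (0 : {mpoly R[N]}).
Proof. by exists [::]; rewrite // /hcomb big_nil. Qed.

Lemma is_hcombD (R : comNzRingType) N w (p q : {mpoly R[N]}) :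
  is_hcomb w p -> is_hcomb w q -> is_hcomb w (p + q).
Proof.
case=> P aP -> [Q aQ ->]; exists (P ++ Q); first by rewrite all_cat aP.
by rewrite /hcomb big_cat.
Qed.

Lemma is_hcombM (R : comNzRingType) N w1 w2 (p q : {mpoly R[N]}) :
  is_hcomb w1 p -> is_hcomb w2 q -> is_hcomb (w1 + w2) (p * q).
Proof.
case=> P aP -> [Q aQ ->].
exists [seq (c.1 * d.1, c.2 ++ d.2) | c <- P, d <- Q].
  apply/allP => x /allpairsP[[c d] /= [cP dQ ->]] /=.
  by rewrite sumn_cat leq_add // ?(allP aP) ?(allP aQ).
rewrite /hcomb big_allpairs_dep /= mulr_suml; apply: eq_bigr => c _.
rewrite mulr_sumr; apply: eq_bigr => d _.
by rewrite /hsym_fun big_cat /= -scalerAl -scalerAr scalerA.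
Qed.

Lemma is_hcombW (R : comNzRingType) N w1 w2 (p : {mpoly R[N]}) :
  (w1 <= w2)%N -> is_hcomb w1 p -> is_hcomb w2 p.
Proof.
move=> le [P aP ->]; exists P => //.
by apply: sub_all aP => c cw; exact: leq_trans le.
Qed.

Lemma is_hcombZ (R : comNzRingType) N w c (p : {mpoly R[N]}) :
  is_hcomb w p -> is_hcomb w (c *: p).
Proof.
case=> P aP ->; exists [seq (c * d.1, d.2) | d <- P]; first by rewrite all_map.
rewrite /hcomb big_map /= scaler_sumr; apply: eq_bigr => d _.
by rewrite scalerA.
Qed.

Lemma is_hcomb_complete (R : comNzRingType) N d : is_hcomb d (complete R d N).
Proof.
exists [:: (1, [:: d])]; first by rewrite /= addn0 leqnn.
by rewrite /hcomb /hsym_fun !big_seq1 /= scale1r.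
Qed.

Lemma is_hcomb1 (R : comNzRingType) N w : is_hcomb w (1 : {mpoly R[N]}).
Proof.
apply: (@is_hcombW _ _ 0) => //; rewrite -(complete0 R N); exact: is_hcomb_complete.
Qed.

Lemma is_hcombX (R : comNzRingType) N w e (p : {mpoly R[N]}) :
  is_hcomb w p -> is_hcomb (e * w) (p ^+ e).
Proof.
move=> hp; elim: e => [|e IH]; first by rewrite expr0; exact: is_hcomb1.
by rewrite exprS mulSn; exact: is_hcombM.
Qed.

Lemma alternating_subsets (R : pzRingType) (T : finType) (A : {set T}) : A != set0 ->
  \sum_(S : {set T} | S \subset A) (-1) ^+ #|S| = 0 :> R.
Proof.
case/set0Pn => v vA; rewrite (big_powersetD1 _ vA) big1 // => S.
by rewrite subsetD1 => /andP[_ vS]; rewrite cardsU1 vS exprS mulN1r subrr.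
Qed.

(** At a monomial m of degree d, a set S contributes to e_|S| h_(d-|S|) exactly when it lies in the
    support of m. The coefficient is therefore an alternating sum over the subsets of a nonempty
    set. *)
Lemma mesym_complete (R : comNzRingType) N d : (0 < d)%N ->
  \sum_(i < d.+1) (-1) ^+ i *: (mesym N R i * complete R (d - i) N) = 0.
Proof.
move=> d0; apply/mpolyP => m; rewrite mcoeff0 raddf_sum /=.
pose A := [set i | m i != 0%N].
have sub (S : {set 'I_N}) : (mesym1 S <= m)%MM = (S \subset A).
  apply/mnm_lepP/subsetP => H i.
    by move=> iS; have := H i; rewrite mnmE iS inE lt0n.
  by rewrite mnmE; case iS : (i \in S) => //; rewrite lt0n; have := H i iS; rewrite inE.
under eq_bigr => i _.
  rewrite mesymE mulr_suml mcoeffZ raddf_sum mulr_sumr /=.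
  under eq_bigr => S _ do rewrite ['X_[_] * _]mulrC mcoeffMXE mcoeff_complete.
  over.
have [md|md] := eqVneq (mdeg m) d; last first.
  rewrite big1 // => i _; rewrite big1 // => S /eqP Si; case: ifP; rewrite ?mul0r ?mulr0 //.
  move=> le; have := mdegD (m - mesym1 S)%MM (mesym1 S); rewrite submK // mdeg_mesym1 Si.
  have := ltn_ord i; case: eqP => [-> ? E|_ _ _]; last by rewrite mulr0.
  by move: md; rewrite E; lia.
have A0 : A != set0.
  apply/eqP => E; move: d0; rewrite -md lt0n mdeg_eq0 => /eqP; apply; apply/mnmP => i.
  by rewrite mnm0E; have /setP/(_ i) := E; rewrite !inE => /negbFE/eqP.
rewrite -[RHS](@alternating_subsets R _ A A0) [RHS]big_mkcond /=.
rewrite [RHS](partition_big (fun S : {set 'I_N} => inord #|S| : 'I_d.+1) predT) //=.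
apply: eq_bigr => i _; rewrite [LHS]big_mkcond [RHS]big_mkcond; apply: eq_bigr => S _ /=.
rewrite sub; case SA : (S \subset A); last by rewrite mulr0 !if_same.
have le : (mesym1 S <= m)%MM by rewrite sub.
have := mdegD (m - mesym1 S)%MM (mesym1 S); rewrite submK // mdeg_mesym1 md => E.
have Sd : (#|S| < d.+1)%N by lia.
rewrite -val_eqE /= inordK //; case: eqP => // Si.
rewrite -Si (_ : (mdeg (m - mesym1 S)%MM == d - #|S|)%N = true) ?mulr1 //.
by apply/eqP; rewrite E addnK.
Qed.

Lemma is_hcomb_mesym (R : comNzRingType) N d : is_hcomb d (mesym N R d).
Proof.
have [n] := ubnP d; elim: n d => // n IHn [|d]; first by rewrite mesym0E => _; exact: is_hcomb1.
rewrite ltnS => dn; have := @mesym_complete R N d.+1 isT.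
rewrite big_ord_recr /= subnn complete0 mulr1 => /eqP; rewrite addrC addr_eq0 => /eqP E.
have -> : mesym N R d.+1 = (-1) ^+ d.+1 *: - \sum_(i < d.+1)
   (-1) ^+ i *: (mesym N R i * complete R (d.+1 - i) N).
  by rewrite -E scalerA -expr2 sqrr_sign scale1r.
apply: is_hcombZ; rewrite -scaleN1r; apply: is_hcombZ.
elim/big_ind: _ => [|p1 p2 s1 s2|i _].
- exact: is_hcomb0.
- exact: is_hcombD.
apply: is_hcombZ; apply: (@is_hcombW _ _ (i + (d.+1 - i))).
  by have := ltn_ord i; lia.
apply: is_hcombM; last exact: is_hcomb_complete.
by apply: IHn; have := ltn_ord i; lia.
Qed.

(** The fundamental theorem writes one truncation, with enough variables for the degree, as a
    polynomial in the elementary functions, hence in the complete ones. The weight bound lets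
    [symfun_eq] extend the identity to every N. *)
Lemma symfun_hcomb (R : comNzRingType) (H : series R) : is_symfun H ->
  exists P : seq (R * seq nat), forall N, H N = hcomb P N.
Proof.
move=> sH; have [symH _ [d dH]] := sH.
have [t [tS wt]] := sym_fundamental (symH d).
case: d => [|d] in dH t tS wt *.
  exists [::] => N; rewrite /hcomb big_nil; apply/eqP.
  by rewrite -msize_poly_eq0 -leqn0.
have [P aP EP] : is_hcomb d (H d.+1).
  rewrite -tS comp_mpolyEX big_seq; elim/big_ind: _ => [|p1 p2 s1 s2|m mt].
  - exact: is_hcomb0.
  - exact: is_hcombD.
  apply: is_hcombZ; apply: (@is_hcombW _ _ (mnmwgt m)).
    have wm : (mnmwgt m < mweight t)%N := mmeasure_mnm_lt _ mt.
    by rewrite -ltnS; apply: leq_trans wm _; apply: leq_trans wt (dH _).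
  rewrite comp_mpolyX /mnmwgt; elim/big_rec2: _ => [|i p w _ hp]; first exact: is_hcomb1.
  apply: is_hcombM => //; apply: is_hcombX; rewrite tnth_mktuple; exact: is_hcomb_mesym.
exists P; apply: (@symfun_eq _ _ _ d.+1) => //; first exact: hcomb_symfun.
move=> N; apply: leq_trans (msize_sum _ _ _) _.
elim: P aP {EP} => [|p P IH] /=; first by rewrite big_nil.
move=> /andP[pd aP]; rewrite big_cons geq_max IH // andbT.
apply: leq_trans (msizeZ_le _ _) _; apply: leq_trans (msize_hsym_fun _ _ _) _.
by rewrite ltnS.
Qed.

(** * The Jacobi-Trudi formula *)

(** The complete function in the first n of B variables. The ring stays fixed while n varies, so the
    induction on n involves no change of ring. *)
Definition complete_upto (R : comNzRingType) (B n d : nat) : {mpoly R[B]} :=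
  \sum_(m : 'X_{1..B < d.+1} |
     (mdeg m == d) && [forall i : 'I_B, (n <= i)%N ==> (m i == 0%N)]) 'X_[m].

Definition complete_int (R : comNzRingType) (B n : nat) (a : int) : {mpoly R[B]} :=
  if a is Posz d then complete_upto R B n d else 0.

Lemma mcoeff_complete_upto (R : comNzRingType) (B n d : nat) (m : 'X_{1..B}) :
  (complete_upto R B n d)@_m =
  ((mdeg m == d) && [forall i : 'I_B, (n <= i)%N ==> (m i == 0%N)])%:R.
Proof.
rewrite /complete_upto raddf_sum /=; under eq_bigr do rewrite mcoeffX.
have [/andP[/eqP md z]|ncond] := boolP (_ && _).
  have md' : (mdeg m < d.+1)%N by rewrite md.
  rewrite (bigD1 (BMultinom md')) /=; last by rewrite md eqxx.
  rewrite eqxx big1 ?addr0 // => m' /andP[_ ne].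
  by rewrite (_ : (_ == _) = false) //; apply: contraNF ne => /eqP E; rewrite bmeqP E.
rewrite big1 // => m' pe; case: eqP => // E; by rewrite -E pe in ncond.
Qed.

Lemma complete_upto_full (R : comNzRingType) (B d : nat) :
  complete_upto R B B d = complete R d B.
Proof.
apply/mpolyP => m; rewrite mcoeff_complete_upto mcoeff_complete.
rewrite (_ : [forall i, _] = true) ?andbT //; apply/forallP => i.
by apply/implyP; rewrite leqNgt ltn_ord.
Qed.

Lemma complete_upto0 (R : comNzRingType) (B n : nat) : complete_upto R B n 0 = 1.
Proof.
apply/mpolyP => m; rewrite mcoeff_complete_upto mcoeff1 mdeg_eq0.
case: eqP => //= ->; rewrite (_ : [forall i, _] = true) //; apply/forallP => i.
by rewrite mnm0E eqxx implybT.
Qed.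

Lemma complete_int0 (R : comNzRingType) (B : nat) (a : int) :
  complete_int R B 0 a = (a == 0)%:R.
Proof.
case: a => [[|d]|d] //=; first exact: complete_upto0.
apply/mpolyP => m; rewrite mcoeff_complete_upto mcoeff0.
case: eqP => //= md; case: forallP => // H.
have m0 : m = 0%MM by apply/mnmP => i; rewrite mnm0E; apply/eqP; exact: (H i).
by move: md; rewrite m0 mdeg0.
Qed.

Lemma complete_int_rec (R : comNzRingType) (B n : nat) (nB : (n < B)%N) (a : int) :
  complete_int R B n.+1 a =
  complete_int R B n a + 'X_(Ordinal nB) * complete_int R B n.+1 (a - 1).
Proof.
case: a => [[|d]|d]; last by rewrite /= mulr0 addr0.
  by rewrite /= !complete_upto0 mulr0 addr0.
rewrite (_ : Posz d.+1 - 1 = Posz d) /=; last by lia.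
apply/mpolyP => m; rewrite mcoeffD mulrC mcoeffMXE !mcoeff_complete_upto.
have [le|nle] := boolP (U_(Ordinal nB) <= m)%MM.
  have md : mdeg m = (mdeg (m - U_(Ordinal nB))%MM).+1.
    by rewrite -{1}(submK le) mdegD mdeg1 addn1.
  have mn : m (Ordinal nB) != 0%N.
    by have /mnm_lepP/(_ (Ordinal nB)) := le; rewrite mnmE eqxx lt0n.
  rewrite [X in (_ && X)%:R + _](_ : _ = false) ?andbF ?add0r; last first.
    apply/negP => /forallP/(_ (Ordinal nB)); by rewrite /= leqnn (negPf mn).
  rewrite md eqSS; congr ((_ && _)%:R).
  apply: eq_forallb => i; rewrite mnmBE mnmE.
  by case: (ltnP n i) => //= ni; rewrite -val_eqE /= (_ : (n == i) = false) ?subn0 //; lia.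
have mn : m (Ordinal nB) = 0%N.
  apply/eqP; apply: contraNT nle => mm; apply/mnm_lepP => i; rewrite mnmE.
  by case: eqP => // <-; rewrite lt0n.
rewrite addr0; congr ((_ && _)%:R); apply: eq_forallb => i.
have [ni|//|E] := ltngtP n i; first by [].
by rewrite (_ : i = Ordinal nB) ?mn //; apply: val_inj.
Qed.

Lemma complete_int_iter (R : comNzRingType) (B n : nat) (nB : (n < B)%N) (a : int) t :
  complete_int R B n.+1 a =
  \sum_(s < t) 'X_(Ordinal nB) ^+ s * complete_int R B n (a - s%:Z)
  + 'X_(Ordinal nB) ^+ t * complete_int R B n.+1 (a - t%:Z).
Proof.
elim: t => [|t IH]; first by rewrite big_ord0 add0r expr0 mul1r subr0.
rewrite IH big_ord_recr /= -addrA; congr (_ + _).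
rewrite (complete_int_rec _ nB (a - t%:Z)) mulrDr exprSr -mulrA; congr (_ + _ * (_ * _)).
by congr complete_int; lia.
Qed.

Definition jt_det (R : comNzRingType) (B n m : nat) (f : 'I_m -> nat) : {mpoly R[B]} :=
  \det (\matrix_(i < m, j < m) complete_int R B n ((f i)%:Z + (j : nat)%:Z - (i : nat)%:Z)).

Definition next_row (m : nat) (f : 'I_m -> nat) (i : 'I_m) : nat :=
  if insub i.+1 is Some j then f j else 0%N.

(** Interlacing, that is, f/mu is a horizontal strip; the row after the last one counts as empty. L
    only makes the type of mu finite. *)
Definition strip (m L : nat) (f : 'I_m -> nat) (mu : {ffun 'I_m -> 'I_L}) : bool :=
  [forall i, (next_row f i <= mu i <= f i)%N].

Lemma sum_range (V : nmodType) (g : nat -> V) (L a b : nat) : (a <= b)%N -> (b < L)%N ->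
  \sum_(p < L | (a <= p <= b)%N) g p = \sum_(s < (b - a).+1) g (b - s)%N.
Proof.
move=> ab bL; rewrite -(big_mkord (fun p => a <= p <= b)%N).
transitivity (\sum_(a <= p < b.+1) g p).
  rewrite [RHS](big_nat_widen _ _ L) // [RHS](big_nat_widenl _ 0) //.
  by apply: eq_bigl => p; rewrite ltnS /= andbC.
rewrite big_nat_rev -{1}[a]add0n big_addn subSn // big_mkord.
apply: eq_bigr => s _; congr g; have := ltn_ord s; lia.
Qed.

(** Subtracting x^(f_i - f_(i+1) + 1) times row i + 1 from row i leaves the sum over f_(i+1) <= p <=
    f_i of x^(f_i - p) times the row of a part p with one variable less. Multilinearity then gives
    the sum over interlacing mu. *)
Lemma jt_det_rec (R : comNzRingType) (B n m L : nat) (nB : (n < B)%N) (f : 'I_m -> nat) :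
  (forall i, f i < L)%N -> (forall i j : 'I_m, i <= j -> f j <= f i)%N ->
  jt_det R B n.+1 f = \sum_(mu : {ffun 'I_m -> 'I_L} | strip f mu)
    (\prod_i 'X_(Ordinal nB) ^+ (f i - mu i)) * jt_det R B n (fun i => mu i).
Proof.
move=> fL fdec; set x := 'X_(Ordinal nB).
have next_le i : (next_row f i <= f i)%N.
  by rewrite /next_row; case: insubP => //= j _ jE; apply: fdec; rewrite jE.
pose A := \matrix_(i < m, j < m) complete_int R B n.+1 ((f i)%:Z + (j : nat)%:Z - (i : nat)%:Z).
pose U : 'M[{mpoly R[B]}]_m := \matrix_(i < m, j < m)
  ((i == j)%:R - (j == i.+1 :> nat)%:R * x ^+ (f i - next_row f i).+1).
have detU : \det U = 1.
  rewrite -det_tr det_trig.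
    rewrite big1 // => i _; rewrite !mxE eqxx (_ : (_ == _) = false) ?mul0r ?subr0 //.
    by apply/negP => /eqP; lia.
  apply/is_trig_mxP => i j ij; rewrite [U^T _ _]mxE [U _ _]mxE.
  have -> : (j == i) = false by apply/negP => /eqP E; move: ij; rewrite E ltnn.
  have -> : (i == j.+1 :> nat) = false by apply/negP => /eqP E; move: ij; rewrite E; lia.
  by rewrite mul0r subr0.
have UA : U *m A = \matrix_(i, j) \sum_(p < L | (next_row f i <= p <= f i)%N)
    x ^+ (f i - p) * complete_int R B n ((p : nat)%:Z + (j : nat)%:Z - (i : nat)%:Z).
  apply/matrixP => i j; rewrite !mxE.
  under eq_bigr do rewrite !mxE mulrBl.
  rewrite sumrB (bigD1 i) //= eqxx mul1r big1 ?addr0; last first.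
    by move=> h /negPf hi; rewrite eq_sym hi mul0r.
  have -> : \sum_(h < m) (h == i.+1 :> nat)%:R * x ^+ (f i - next_row f i).+1
      * complete_int R B n.+1 ((f h)%:Z + (j : nat)%:Z - (h : nat)%:Z) =
    x ^+ (f i - next_row f i).+1 * complete_int R B n.+1
      ((f i)%:Z + (j : nat)%:Z - (i : nat)%:Z - (f i - next_row f i).+1%:Z).
    have := next_le i; rewrite /next_row; case: insubP => [h hm hE|hm].
      move=> le; rewrite (bigD1 h) //= hE eqxx mul1r big1 ?addr0.
        by congr (_ * complete_int _ _ _ _); lia.
      move=> h' /negPf ne; rewrite (_ : (_ == _) = false) ?mul0r //.
      by rewrite -hE; exact: ne.
    (* From the last row nothing is subtracted, but the tail vanishes by itself: its index j - i - 1
       is negative since j <= i. *)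
    move=> _; rewrite big1 => [|h _].
      rewrite (_ : complete_int _ _ _ _ = 0) ?mulr0 //.
      have : ((f i)%:Z + (j : nat)%:Z - (i : nat)%:Z - (f i - 0).+1%:Z < 0).
        have := ltn_ord j; lia.
      by case: (_ - _ - _).
    rewrite (_ : (_ == _) = false) ?mul0r //; apply: contraNF hm => /eqP <-.
    exact: ltn_ord.
  rewrite {1}(complete_int_iter R nB _ (f i - next_row f i).+1) addrK.
  rewrite (sum_range (fun p => x ^+ (f i - p) * complete_int R B n
      ((p : nat)%:Z + (j : nat)%:Z - (i : nat)%:Z))) ?next_le //.
  apply: eq_bigr => s _; have si : (s <= f i)%N by have := ltn_ord s; have := next_le i; lia.
  by rewrite subKn //; congr (_ * complete_int _ _ _ _); lia.
have EA : \det A = \det (U *m A) by rewrite det_mulmx detU mul1r.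
rewrite /jt_det -/A EA UA /determinant.
under eq_bigr => s _.
  rewrite (eq_bigr (fun i : 'I_m => \sum_(p < L | (next_row f i <= p <= f i)%N)
    x ^+ (f i - p) * complete_int R B n ((p : nat)%:Z + (s i : nat)%:Z - (i : nat)%:Z))); last first.
    by move=> i _; rewrite mxE.
  rewrite bigA_distr_big_dep mulr_sumr.
  over.
rewrite exchange_big /=; apply: eq_big => mu.
  by apply/familyP/forallP => H i; have := H i; rewrite unfold_in.
move=> _; rewrite mulr_sumr; apply: eq_bigr => s _.
rewrite big_split /= mulrCA; congr (_ * (_ * _)).
by apply: eq_bigr => i _; rewrite !mxE.
Qed.

(* [cell la] is convertible to [shape (fun i : 'I_(size la) => nth 0 la i)]. *)
Definition shape (m : nat) (f : 'I_m -> nat) : finType := {i : 'I_m & 'I_(f i)}.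

Definition box (m : nat) (f : 'I_m -> nat) (i : 'I_m) (c : 'I_(f i)) : shape f :=
  Tagged (fun i => 'I_(f i)) c.

Definition ssyt_upto (m B n : nat) (f : 'I_m -> nat) (T : {ffun shape f -> 'I_B}) : bool :=
  [forall c : shape f, forall d : shape f,
    ((tag c == tag d :> nat) && (tagged c < tagged d)%N ==> (T c <= T d)%N) &&
    ((tagged c == tagged d :> nat) && (tag c < tag d)%N ==> (T c < T d)%N)]
  && [forall c : shape f, (T c < n)%N].

Definition schur_upto (R : comNzRingType) (m B n : nat) (f : 'I_m -> nat) : {mpoly R[B]} :=
  \sum_(T : {ffun shape f -> 'I_B} | ssyt_upto n T) \prod_c 'X_(T c).

Lemma ssyt_uptoP (m B n : nat) (f : 'I_m -> nat) (T : {ffun shape f -> 'I_B}) :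
  reflect [/\ forall (i : 'I_m) (c d : 'I_(f i)), (c < d)%N ->
                (T (box (f := f) c) <= T (box (f := f) d))%N,
              forall (i j : 'I_m) (c : 'I_(f i)) (d : 'I_(f j)), c = d :> nat -> (i < j)%N ->
                (T (box (f := f) c) < T (box (f := f) d))%N
            & forall c, (T c < n)%N]
    (ssyt_upto n T).
Proof.
apply: (iffP andP) => [[/forallP H /forallP Hn]|[H1 H2 Hn]].
  split=> // [i c d cd|i j c d cd ij].
    have /forallP/(_ (box (f := f) d))/andP[/implyP H' _] := H (box (f := f) c).
    by apply: H'; rewrite /= eqxx cd.
  have /forallP/(_ (box (f := f) d))/andP[_ /implyP H'] := H (box (f := f) c).
  by apply: H'; rewrite /= cd eqxx.
split; last by apply/forallP.
apply/forallP => -[i c]; apply/forallP => -[j d] /=; apply/andP; split; apply/implyP.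
  case/andP => /eqP/val_inj ij; case: j / ij d => d cd; exact: H1.
case/andP => /eqP cd ij; exact: (H2 _ _ c d).
Qed.

Section Branching.
Variables (R : comNzRingType) (m B n L : nat) (nB : (n < B)%N) (f : 'I_m -> nat).
Hypotheses (fL : forall i, (f i < L)%N)
  (fdec : forall i j : 'I_m, (i <= j)%N -> (f j <= f i)%N).

Let small (T : {ffun shape f -> 'I_B}) (i : 'I_m) : nat :=
  #|[set c : 'I_(f i) | (T (box (f := f) c) < n)%N]|.

Let small_lt T i : (small T i < L)%N.
Proof.
by apply: leq_ltn_trans (fL i); rewrite -[X in (_ <= X)%N]card_ord max_card.
Qed.

Let inner (T : {ffun shape f -> 'I_B}) : {ffun 'I_m -> 'I_L} :=
  [ffun i => Ordinal (small_lt T i)].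

(** Used here for the small entries of a tableau row, and later for the rows lying left of a given
    column in paths and stacks. *)
Lemma initial_segment (p : nat) (P : pred 'I_p) :
  (forall c d : 'I_p, (c < d)%N -> P d -> P c) ->
  forall c : 'I_p, P c = (c < #|[set d | P d]|)%N.
Proof.
move=> dn c.
have card_lt (j : nat) : (j <= p)%N -> #|[set d : 'I_p | (d < j)%N]| = j.
  move=> jp; rewrite -sum1_card (eq_bigl (fun d : 'I_p => (d < j)%N)); last first.
    by move=> d; rewrite inE.
  by rewrite (big_ord_narrow jp) sum1_card card_ord.
case Pc : (P c).
  apply/esym; have <- : #|[set d : 'I_p | (d < c.+1)%N]| = c.+1 by rewrite card_lt.
  apply: subset_leq_card; apply/subsetP => d; rewrite !inE ltnS leq_eqVlt.
  by case/orP => [/eqP/val_inj -> //|dc]; apply: dn Pc.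
apply/esym/negbTE; rewrite -leqNgt -[X in (_ <= X)%N](card_lt c (ltnW (ltn_ord c))).
apply: subset_leq_card; apply/subsetP => d; rewrite !inE ltnNge => Pd.
apply/negP; rewrite leq_eqVlt => /orP[/eqP/val_inj E|cd]; first by rewrite E Pd in Pc.
by rewrite (dn _ _ cd Pd) in Pc.
Qed.

Let innerE T (i : 'I_m) (c : 'I_(f i)) : ssyt_upto n.+1 T ->
  (T (box (f := f) c) < n)%N = (c < inner T i)%N.
Proof.
case/ssyt_uptoP => H1 _ _; rewrite ffunE /= /small.
rewrite -(initial_segment (P := fun c => (T (box (f := f) c) < n)%N)) // => c1 c2 lt.
exact: leq_ltn_trans (H1 _ _ _ lt).
Qed.

(** Row i + 1 has entries at most n, so by column strictness the boxes over it in row i have entries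
    below n. *)
Let inner_strip T : ssyt_upto n.+1 T -> strip f (inner T).
Proof.
move=> sT; have /ssyt_uptoP[_ H2 H3] := sT; apply/forallP => i; apply/andP; split; last first.
  by rewrite ffunE /= /small -[X in (_ <= X)%N]card_ord max_card.
rewrite /next_row; case: insubP => // j _ jE.
case fj : (f j) => [//|c].
have cj : (c < f j)%N by rewrite fj.
have ij : (i < j)%N by rewrite jE.
have ci : (c < f i)%N by apply: leq_trans cj (fdec (ltnW ij)).
have le := H3 (box (f := f) (Ordinal cj)); rewrite ltnS in le.
have := leq_trans (H2 _ _ (Ordinal ci) (Ordinal cj) erefl ij) le.
by rewrite innerE.
Qed.

Variable mu : {ffun 'I_m -> 'I_L}.
Hypothesis stmu : strip f mu.

Let mu_le i : (mu i <= f i)%N.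
Proof. by have /forallP/(_ i)/andP[] := stmu. Qed.

Let mu_next (i j : 'I_m) : (i < j)%N -> (f j <= mu i)%N.
Proof.
move=> ij; have /forallP/(_ i)/andP[+ _] := stmu; rewrite /next_row.
have im : (i.+1 < m)%N by apply: leq_ltn_trans (ltn_ord j).
by rewrite insubT; apply: leq_trans; apply: fdec.
Qed.

Let muf (i : 'I_m) : nat := mu i.
Let mushape := shape muf.

Let emb (c : mushape) : shape f := box (widen_ord (mu_le (tag c)) (tagged c)).

Let res (T : {ffun shape f -> 'I_B}) : {ffun mushape -> 'I_B} := [ffun c => T (emb c)].

Let ext_at (T : {ffun mushape -> 'I_B}) (i : 'I_m) (c : nat) : 'I_B :=
  if (insub c : option 'I_(muf i)) is Some d then T (box d) else Ordinal nB.

Let ext (T : {ffun mushape -> 'I_B}) : {ffun shape f -> 'I_B} :=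
  [ffun c : shape f => ext_at T (tag c) (tagged c : 'I_(f (tag c)))].

Let ext_ge T i c : (mu i <= c)%N -> ext_at T i c = Ordinal nB.
Proof. by move=> le; rewrite /ext_at insubF // ltnNge le. Qed.

Let ext_lt T i (c : 'I_(muf i)) : ext_at T i c = T (box (f := muf) c).
Proof. by rewrite /ext_at valK. Qed.

Let resK T : res (ext T) = T.
Proof.
by apply/ffunP => -[i c]; rewrite !ffunE /= -ext_lt.
Qed.

Let extK T : ssyt_upto n.+1 T -> inner T = mu -> ext (res T) = T.
Proof.
move=> sT iT; apply/ffunP => -[i c]; rewrite ffunE /=.
have := innerE c sT; rewrite iT; case: (ltnP c (mu i)) => [lt|ge] E.
  rewrite (ext_lt _ (Ordinal lt)) ffunE; congr (T (box _)); exact: val_inj.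
rewrite ext_ge //; apply: val_inj => /=; have /ssyt_uptoP[_ _ H3] := sT.
apply/eqP; rewrite eqn_leq leqNgt; apply/andP; split; last exact: H3.
by apply: negbT; rewrite -E.
Qed.

Let ext_ssyt T : (ssyt_upto n.+1 (ext T) && (inner (ext T) == mu)) = ssyt_upto n T.
Proof.
apply/andP/idP => [[sT /eqP iT]|sT].
  have /ssyt_uptoP[H1 H2 H3] := sT; rewrite -(resK T).
  have rE c : res (ext T) c = ext T (emb c) by rewrite /res ffunE.
  apply/ssyt_uptoP; split.
  - by move=> i c d cd; rewrite !rE; apply: H1.
  - by move=> i j c d cd ij; rewrite !rE; apply: H2.
  - by move=> [i c]; rewrite rE /emb innerE // iT /=; exact: ltn_ord.
have /ssyt_uptoP[H1 H2 H3] := sT.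
have sT' : ssyt_upto n.+1 (ext T).
  apply/ssyt_uptoP; split.
  - move=> i c d cd; rewrite !ffunE /=.
    case: (ltnP d (mu i)) => [dl|dg]; last first.
      rewrite (ext_ge _ dg); case: (ltnP c (mu i)) => [cl|cg]; last by rewrite ext_ge.
      by rewrite (ext_lt _ (Ordinal cl)) /= ltnW.
    have cl := ltn_trans cd dl.
    by rewrite (ext_lt _ (Ordinal cl)) (ext_lt _ (Ordinal dl)) H1.
  - move=> i j c d cd ij; rewrite !ffunE /=.
    have cl : (c < mu i)%N by rewrite cd; apply: leq_trans (ltn_ord d) (mu_next ij).
    rewrite (ext_lt _ (Ordinal cl)).
    case: (ltnP d (mu j)) => [dl|dg]; last by rewrite ext_ge.
    by rewrite (ext_lt _ (Ordinal dl)) H2.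
  - move=> [i c]; rewrite ffunE /=.
    case: (ltnP c (mu i)) => [cl|cg]; last by rewrite ext_ge.
    by rewrite (ext_lt _ (Ordinal cl)) ltnW // ltnS H3.
split=> //; apply/eqP/ffunP => i; apply/val_inj/eqP; rewrite eqn_leq.
apply/andP; split; rewrite leqNgt; apply/negP => lt.
  have lt' : (mu i < f i)%N.
    by apply: leq_trans lt _; have /forallP/(_ i)/andP[] := inner_strip sT'.
  by have := innerE (Ordinal lt') sT'; rewrite lt ffunE ext_ge //= ltnn.
have lt' : (inner (ext T) i < f i)%N by apply: leq_trans lt (mu_le i).
have := innerE (Ordinal lt') sT'; rewrite ffunE /= ltnn.
by rewrite (ext_lt _ (Ordinal lt)) H3.
Qed.

Let ext_prod T : \prod_c 'X_(ext T c) =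
  \prod_i 'X_(Ordinal nB) ^+ (f i - mu i) * \prod_c 'X_(T c) :> {mpoly R[B]}.
Proof.
have split_rows (h : 'I_m -> nat) (F : forall i, 'I_(h i) -> {mpoly R[B]}) :
    \prod_(c : shape h) F (tag c) (tagged c) = \prod_i \prod_(c < h i) F i c.
  by rewrite (sig_big_dep predT (fun _ _ => true) F).
transitivity (\prod_i \prod_(c < f i) ('X_(ext_at T i c) : {mpoly R[B]})).
  rewrite -(split_rows f (fun i c => 'X_(ext_at T i c))).
  by apply: eq_bigr => c _; rewrite ffunE.
transitivity (\prod_i ('X_(Ordinal nB) ^+ (f i - mu i) *
    \prod_(c < mu i) ('X_(T (box (f := muf) c)) : {mpoly R[B]}))); last first.
  rewrite big_split /=; congr (_ * _).
  rewrite -(split_rows muf (fun i c => 'X_(T (box c)))).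
  by apply: eq_bigr => -[i c].
apply: eq_bigr => i _; rewrite -(big_mkord predT (fun c => 'X_(ext_at T i c) : {mpoly R[B]})).
rewrite (big_cat_nat (n := mu i)) //= mulrC; congr (_ * _); last first.
  by rewrite big_mkord; apply: eq_bigr => c _; rewrite ext_lt.
rewrite (eq_big_nat _ _ (F2 := fun=> 'X_(Ordinal nB))); last first.
  by move=> c /andP[ge _]; rewrite ext_ge.
by rewrite prodr_const_nat.
Qed.

Lemma schur_upto_fiber :
  \sum_(T : {ffun shape f -> 'I_B} | ssyt_upto n.+1 T && (inner T == mu)) \prod_c 'X_(T c) =
  \prod_i 'X_(Ordinal nB) ^+ (f i - mu i) * schur_upto R B n (fun i => mu i).
Proof.
rewrite /schur_upto mulr_sumr (reindex_onto ext res) /=; last first.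
  by move=> T /andP[sT /eqP iT]; rewrite extK.
apply: eq_big => T; first by rewrite ext_ssyt resK eqxx andbT.
by move=> _; rewrite ext_prod.
Qed.

End Branching.

(** The boxes with the largest letter n form a horizontal strip, and erasing them leaves a tableau
    in the smaller letters. The recursion matches [jt_det_rec] term by term. *)
Lemma schur_upto_rec (R : comNzRingType) (m B n L : nat) (nB : (n < B)%N) (f : 'I_m -> nat) :
  (forall i, f i < L)%N -> (forall i j : 'I_m, i <= j -> f j <= f i)%N ->
  schur_upto R B n.+1 f = \sum_(mu : {ffun 'I_m -> 'I_L} | strip f mu)
    (\prod_i 'X_(Ordinal nB) ^+ (f i - mu i)) * schur_upto R B n (fun i => mu i).
Proof.
move=> fL fdec; rewrite {1}/schur_upto.
pose inner (T : {ffun shape f -> 'I_B}) : {ffun 'I_m -> 'I_L} := [ffun i => Ordinal (small_lt_subproof n fL T i)].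
rewrite (partition_big inner (strip f)) /=; last by move=> T; exact: inner_strip_subproof.
by apply: eq_bigr => mu st; rewrite -(schur_upto_fiber R nB fL fdec st).
Qed.

Lemma schur_upto_det (R : comNzRingType) (m B n : nat) (f : 'I_m -> nat) :
  (n <= B)%N -> (forall i j : 'I_m, i <= j -> f j <= f i)%N ->
  schur_upto R B n f = jt_det R B n f.
Proof.
elim: n f => [|n IHn] f nB fdec; last first.
  pose L := (\max_i f i).+1.
  have fL i : (f i < L)%N by rewrite ltnS leq_bigmax.
  rewrite (schur_upto_rec R nB fL fdec) (jt_det_rec R nB fL fdec).
  apply: eq_bigr => mu /forallP st; rewrite IHn ?(ltnW nB) // => i j.
  rewrite leq_eqVlt => /orP[/eqP/val_inj -> //|ij].
  have /andP[_ le] := st j; apply: leq_trans le _.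
  have /andP[+ _] := st i; rewrite /next_row.
  have im : (i.+1 < m)%N by apply: leq_ltn_trans (ltn_ord j).
  by rewrite insubT; apply: leq_trans; apply: fdec.
have entry i j : (\matrix_(i < m, j < m) complete_int R B 0
    ((f i)%:Z + (j : nat)%:Z - (i : nat)%:Z)) i j = ((f i + j)%N == i)%:R.
  rewrite mxE complete_int0; congr (_%:R); lia.
have [/forallP f0|/forallPn[i0 fi0]] := boolP [forall i, f i == 0%N].
  have -> : jt_det R B 0 f = 1.
    rewrite /jt_det -[RHS](@det1 _ m); congr (\det _).
    by apply/matrixP => i j; rewrite entry mxE (eqP (f0 i)) add0n eq_sym.
  have noc (c : shape f) : False by case: c => i c; have := leq_ltn_trans (leq0n c) (ltn_ord c); rewrite (eqP (f0 i)).
  have uniqT (T T' : {ffun shape f -> 'I_B}) : T = T' by apply/ffunP => c; case: (noc c).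
  pose T0 : {ffun shape f -> 'I_B} := [ffun c => False_rect _ (noc c)].
  rewrite /schur_upto (bigD1 T0) /=; last first.
    by apply/andP; split; apply/forallP => c; case: (noc c).
  rewrite [X in _ + X]big1 ?addr0; last by move=> T /andP[_ /eqP[]]; exact: uniqT.
  by rewrite big1 // => c; case: (noc c).
have m0 : (0 < m)%N by apply: leq_ltn_trans (ltn_ord i0).
have f0 : (0 < f (Ordinal m0))%N.
  by apply: leq_trans (fdec (Ordinal m0) i0 isT); rewrite lt0n.
(* A nonempty first part makes the first row of the matrix vanish, since f 0 + j is never 0; on the
   other side no tableau can be filled without letters. *)
rewrite /jt_det (expand_det_row _ (Ordinal m0)) big1; last first.
  move=> j _; rewrite entry (_ : (_ == _) = false) ?mul0r //=; lia.
rewrite /schur_upto big1 // => T /ssyt_uptoP[_ _ H3].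
by have := H3 (box (f := f) (Ordinal f0)).
Qed.

Lemma jacobi_trudi (R : comNzRingType) (la : seq nat) (N : nat) : sorted geq la ->
  schur R la N = jt_det R N N (fun i : 'I_(size la) => nth 0%N la i).
Proof.
move=> sla; rewrite -schur_upto_det //; last first.
  move=> i j ij; have tr : transitive geq by move=> x y z xy yz; apply: leq_trans yz xy.
  apply: (sorted_leq_nth tr _ 0%N sla) => //; rewrite ?inE //.
  by move=> x; exact: leqnn.
rewrite /schur_upto /schur; apply: eq_bigl => T; rewrite /ssyt_upto.
rewrite [X in _ = _ && X](_ : _ = true) ?andbT //.
by apply/forallP => c; exact: ltn_ord.
Qed.

(* The exponents la_i + s(i) - i of the Jacobi-Trudi expansion; they are all
   nonnegative iff [jt_ok]. *)
Definition jt_ok (la : seq nat) (s : 'S_(size la)) : bool :=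
  [forall i : 'I_(size la), (i <= nth 0%N la i + s i)%N].
Definition jt_exps (la : seq nat) (s : 'S_(size la)) : seq nat :=
  [seq (nth 0%N la i + s i - i)%N | i : 'I_(size la)].

Lemma jacobi_trudi_sum (R : comNzRingType) (la : seq nat) (N : nat) : sorted geq la ->
  schur R la N = \sum_(s : 'S_(size la))
    ((-1) ^+ s * (jt_ok s)%:R) *: hsym_fun R (jt_exps s) N.
Proof.
move=> sla; rewrite jacobi_trudi // /jt_det /determinant.
apply: eq_bigr => s _; under eq_bigr do rewrite mxE.
case: (boolP (jt_ok s)) => [/forallP ok|/forallPn[i ni]]; last first.
  rewrite mulr0 scale0r (bigD1 i) //= (_ : complete_int _ _ _ _ = 0) ?mul0r ?mulr0 //.
  have : ((nth 0%N la i)%:Z + (s i : nat)%:Z - (i : nat)%:Z < 0) by move: ni; lia.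
  by case: (_ - _).
rewrite mulr1 mulr_sign scaler_sign.
suff -> : \prod_(i < size la) complete_int R N N ((nth 0%N la i)%:Z + (s i : nat)%:Z - (i : nat)%:Z) =
    hsym_fun R (jt_exps s) N by [].
rewrite /hsym_fun /jt_exps big_map big_enum; apply: eq_bigr => i _.
rewrite (_ : _ - _ = ((nth 0%N la i + s i - i)%N)%:Z) /=; last by have := ok i; lia.
by rewrite complete_upto_full.
Qed.

Definition jt_sum (R : comNzRingType) (la : seq nat) (F : series R) (al : seq nat) : R :=
  \sum_(s : 'S_(size la)) (-1) ^+ s * (jt_ok s)%:R * coef_of F (al ++ jt_exps s).

Lemma jt_sum_perm (R : comNzRingType) (la : seq nat) (F : series R) al be :
  is_symfun F -> perm_eq [seq e <- al | e != 0%N] [seq e <- be | e != 0%N] ->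
  jt_sum la F al = jt_sum la F be.
Proof.
move=> sF pe; apply: eq_bigr => s _; congr (_ * _).
rewrite -[LHS]coef_of_filter // -[RHS]coef_of_filter //; apply: coef_of_perm => //.
by rewrite !filter_cat perm_cat2r.
Qed.

(** Testing on H = h_p, both pairings read coefficients by [hall_complete]: that of G at p, and
    those of F at the lists p ++ [jt_exps s]. G inherits its symmetry from F through [jt_sum_perm].
    The partition is only required to be sorted, as its parts are zero when k = 1 < n. *)
Lemma schur_perp_intro (R : comNzRingType) (la : seq nat) (F G : series R) :
  sorted geq la -> is_symfun F -> (exists d, forall N, msize (G N) <= d)%N ->
  (forall N (m : 'X_{1..N}), (G N)@_m = jt_sum la F m) ->
  schur_perp la F G.
Proof.
move=> sla sF dG GE.
have sG : is_symfun G.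
  split=> // [N|N m].
    apply/issymP => s; apply/mpolyP => m; rewrite mcoeff_sym !GE.
    apply: jt_sum_perm => //; apply: perm_filter; apply/tuple_permP; exists s.
    by congr val; apply/val_inj/eq_from_tnth => i; rewrite !tnth_mktuple.
  rewrite !GE; apply: jt_sum_perm => //.
  by rewrite /= -cats1 filter_cat /= cats0.
split=> // H sH; have [P HP] := symfun_hcomb sH.
exists (\sum_(p <- P) p.1 * coef_of G p.2); split; first exact: hall_complete.
pose Q := [seq (p.1 * ((-1) ^+ s * (jt_ok s)%:R), p.2 ++ jt_exps s) |
   p : R * seq nat <- P, s : {perm 'I_(size la)} <- index_enum _].
have -> : \sum_(p <- P) p.1 * coef_of G p.2 = \sum_(q <- Q) q.1 * coef_of F q.2.
  rewrite /Q big_allpairs_dep /=; apply: eq_bigr => p _.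
  under eq_bigr do rewrite -mulrA; rewrite -mulr_sumr; congr (_ * _).
  rewrite /coef_of /coef_at GE; transitivity (jt_sum la F p.2); last by [].
  congr jt_sum; apply: (@eq_from_nth _ 0%N); first by rewrite size_tuple.
  move=> i; rewrite size_tuple => ip.
  by rewrite -(mnm_nth 0%N _ (Ordinal ip)) mnmE.
apply: hall_complete => // N; rewrite HP /hcomb jacobi_trudi_sum // mulrC.
rewrite /Q big_allpairs_dep /= mulr_suml; apply: eq_bigr => p _.
rewrite mulr_sumr; apply: eq_bigr => s _.
by rewrite /hsym_fun big_cat /= -scalerAl -scalerAr scalerA.
Qed.

(** * Words as sets of labels in columns *)

Section Encoding.
Variables (k L : nat).
Implicit Types (A : {set 'I_k * 'I_L}) (p : 'I_k * 'I_L).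

(** Going up a path visits its labeled boxes in this order, so the row of a box is its rank in the
    encoding set. *)
Definition lexlt p p' : bool := (p.1 < p'.1)%N || ((p.1 == p'.1) && (p.2 < p'.2)%N).

Definition height A (j : nat) : nat := #|[set p in A | (p.1 < j)%N]|.

Definition colset A (j : 'I_k) : {set 'I_L} := [set v | (j, v) \in A].

Definition col_rank A (j : 'I_k) (v : nat) : nat := #|[set u in colset A j | (u < v)%N]|.

Lemma lexlt_trans p p' p'' : lexlt p p' -> lexlt p' p'' -> lexlt p p''.
Proof.
rewrite /lexlt; case: p p' p'' => [a b] [c d] [e f] /=.
case/orP => [ac|/andP[/eqP -> bd]]; case/orP => [ce|/andP[/eqP <- df]];
  rewrite ?ac ?ce ?eqxx //=; first by rewrite (ltn_trans ac ce).
by rewrite (ltn_trans bd df) orbT.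
Qed.

Lemma lexlt_irr p : lexlt p p = false.
Proof. by rewrite /lexlt !ltnn andbF. Qed.

Lemma lexlt_total p p' : p != p' -> lexlt p p' || lexlt p' p.
Proof.
rewrite /lexlt; case: p p' => [a b] [c d] /=; rewrite -pair_eqE /= [c == a]eq_sym.
have [ac|ca|/val_inj ->] := ltngtP a c; rewrite ?orbT //= eqxx /=.
by rewrite -val_eqE /= neq_ltn.
Qed.

Lemma lex_rank A p :
  #|[set p' in A | lexlt p' p]| = (height A p.1 + col_rank A p.1 p.2)%N.
Proof.
rewrite /height /col_rank.
have -> : #|[set u in colset A p.1 | (u < p.2)%N]| =
    #|[set p' in A | (p'.1 == p.1) && (p'.2 < p.2)%N]|.
  rewrite -(card_imset _ (_ : injective (fun u : 'I_L => (p.1, u)))); last by move=> u v [].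
  apply: eq_card => -[j u]; rewrite !inE /=; apply/imsetP/and3P => [[v]|[jA /eqP E lt]].
    by rewrite !inE => /andP[vA lt] [-> ->]; split.
  by exists u; rewrite ?inE -?E ?jA ?lt //= E.
rewrite -cardsUI [X in (_ = _ + X)%N](_ : _ = 0%N) ?addn0; last first.
  apply/eqP; rewrite cards_eq0; apply/eqP/setP => p'; rewrite !inE.
  by have [->|] := eqVneq p'.1 p.1; rewrite ?ltnn ?andbF.
by apply: eq_card => p'; rewrite !inE -andb_orr.
Qed.

Variable m : nat.
Implicit Types (X : lattice_path k m) (l : labeling m L).

Definition encode X l : {set 'I_k * 'I_L} :=
  [set p : 'I_k * 'I_L | [exists y, (X y == p.1 :> nat) && (l y == p.2)]].

(** A [lattice_path] may have vertical steps on the line x = k, where there is no column of boxes;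
    words exclude them. *)
Definition short X : bool := [forall y, (X y < k)%N].

Definition is_word (Xl : lattice_path k m * labeling m L) : bool :=
  [&& is_path Xl.1, is_labeling Xl.1 Xl.2 & short Xl.1].

Lemma encode_rows X l : is_word (X, l) ->
  exists rho : 'I_m -> 'I_k * 'I_L,
  [/\ forall y, (rho y).1 = X y :> nat, forall y, (rho y).2 = l y,
      injective rho, encode X l = [set rho y | y in 'I_m]
    & forall y : 'I_m, y = (height (encode X l) (rho y).1
                     + col_rank (encode X l) (rho y).1 (rho y).2)%N :> nat].
Proof.
case/and3P => /= /forallP pX /forallP lX /forallP sX.
pose rho y : 'I_k * 'I_L := (Ordinal (sX y), l y).
have rho_lt (y y' : 'I_m) : (y < y')%N -> lexlt (rho y) (rho y').
  move=> yy; rewrite /lexlt -val_eqE /=.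
  have := implyP (forallP (pX y) y') (ltnW yy); rewrite leq_eqVlt => /orP[|-> //].
  move=> E; rewrite E (_ : (l y < l y')%N) ?orbT //.
  by apply: (implyP (forallP (lX y) y')); rewrite yy andbT; exact: E.
have rho_lt' (y y' : 'I_m) : lexlt (rho y) (rho y') = (y < y')%N.
  apply/idP/idP => [lt|]; last exact: rho_lt.
  rewrite ltnNge leq_eqVlt; apply/negP => /orP[/eqP/val_inj E|/rho_lt lt'].
    by rewrite E lexlt_irr in lt.
  by have := lexlt_trans lt lt'; rewrite lexlt_irr.
have rho_inj : injective rho.
  move=> y y' E; apply: val_inj; case: (ltngtP y y') => // /rho_lt; rewrite E lexlt_irr //.
have encE : encode X l = [set rho y | y in 'I_m].
  apply/setP => -[j v]; rewrite inE /=; apply/existsP/imsetP => [[y]|[y _ [-> ->]]].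
    by case/andP => /eqP E /eqP <-; exists y => //; congr (_, _); apply: val_inj.
  by exists y; rewrite /= !eqxx.
exists rho; split=> // y; rewrite -lex_rank encE.
have -> : [set p' in [set rho y0 | y0 in 'I_m] | lexlt p' (rho y)] =
    [set rho y0 | y0 in [set y0 : 'I_m | (y0 < y)%N]].
  apply/setP => p; rewrite !inE; apply/andP/imsetP => [[/imsetP[y' _ ->] lt]|[y' + ->]].
    by exists y' => //; rewrite inE -rho_lt'.
  by rewrite inE => lt; split; [exact: imset_f | rewrite rho_lt'].
rewrite card_imset // -sum1_card (eq_bigl (fun y0 : 'I_m => (y0 < y)%N)); last first.
  by move=> z; rewrite inE.
by rewrite (big_ord_narrow (ltnW (ltn_ord y))) sum1_card card_ord.
Qed.

Lemma encode_inj : {in [set Xl | is_word Xl] &, injective (fun Xl => encode Xl.1 Xl.2)}.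
Proof.
move=> [X l] [X' l']; rewrite !inE => w w' /= E.
have [rho [r1 r2 rinj rE rk]] := encode_rows w.
have [rho' [r1' r2' rinj' rE' rk']] := encode_rows w'.
have rr y : rho y = rho' y.
  have : rho y \in encode X' l' by rewrite -E rE imset_f.
  rewrite rE' => /imsetP[y' _ Ey]; rewrite Ey; congr rho'.
  by apply: val_inj => /=; rewrite rk' -Ey -E -rk.
congr (_, _); apply/ffunP => y; last by rewrite -r2 -r2' rr.
by apply: val_inj => /=; rewrite -r1 -r1' rr.
Qed.

Lemma encode_card X l : is_word (X, l) -> #|encode X l| = m.
Proof.
by case/encode_rows => rho [_ _ rinj -> _]; rewrite card_imset // card_ord.
Qed.

Lemma encode_onto A : #|A| = m -> exists2 Xl, is_word Xl & A = encode Xl.1 Xl.2.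
Proof.
move=> cA.
pose rk p := #|[set p' in A | lexlt p' p]|.
have rk_lt p p' : p \in A -> lexlt p p' -> (rk p < rk p')%N.
  move=> pA lt; apply: proper_card; apply/properP; split.
    by apply/subsetP => z; rewrite !inE => /andP[-> zp]; exact: lexlt_trans lt.
  by exists p; rewrite !inE ?pA ?lexlt_irr.
have rk_m p : p \in A -> (rk p < m)%N.
  move=> pA; rewrite -cA; apply: proper_card; apply/properP; split.
    by apply/subsetP => z; rewrite inE => /andP[].
  by exists p; rewrite // !inE lexlt_irr andbF.
have rk_lt' p p' : p \in A -> p' \in A -> (rk p < rk p')%N = lexlt p p'.
  move=> pA pA'; apply/idP/idP => [lt|]; last exact: rk_lt.
  have [E|/lexlt_total/orP[//|/rk_lt]] := eqVneq p p'; first by rewrite E ltnn in lt.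
  by move=> /(_ pA'); rewrite ltnNge (ltnW lt).
have ex (y : 'I_m) : exists p, (p \in A) && (rk p == y :> nat).
  have : y \in [set insubd y (rk p) | p in A].
    suff -> : [set insubd y (rk p) | p in A] = setT by rewrite inE.
    apply/eqP; rewrite eqEcard subsetT cardsT card_ord -{1}cA card_in_imset ?leqnn // => p p' pA pA'.
    move=> /(congr1 val); rewrite !val_insubd !rk_m //= => E.
    by apply/eqP; apply: contraT => /lexlt_total; rewrite -!rk_lt' // E ltnn.
  case/imsetP => p pA /(congr1 val); rewrite val_insubd rk_m //= => E.
  by exists p; rewrite pA E eqxx.
have [rho rhoP] := fin_all_exists ex.
have rA y : rho y \in A by have /andP[] := rhoP y.
have rkE y : rk (rho y) = y by have /andP[_ /eqP] := rhoP y.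
have rlt (y y' : 'I_m) : (y < y')%N -> lexlt (rho y) (rho y').
  by move=> yy; rewrite -rk_lt' // !rkE.
exists ([ffun y => widen_ord (leqnSn k) (rho y).1], [ffun y => (rho y).2]).
  apply/and3P; split => /=.
  - apply/forallP => y; apply/forallP => y'; apply/implyP; rewrite !ffunE /=.
    rewrite leq_eqVlt => /orP[/eqP/val_inj -> //|/rlt].
    by rewrite /lexlt => /orP[/ltnW //|/andP[/eqP ->]].
  - apply/forallP => y; apply/forallP => y'; apply/implyP; rewrite !ffunE /=.
    case/andP => /eqP/(congr1 val) /= E /rlt.
    by rewrite /lexlt E ltnn /= => /andP[].
  - by apply/forallP => y; rewrite ffunE /=.
apply/esym/eqP; rewrite eqEcard cA; apply/andP; split.
  apply/subsetP => -[j v]; rewrite inE /= => /existsP[y]; rewrite !ffunE /=.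
  case/andP => /eqP E1 /eqP E2; have := rA y.
  by rewrite (surjective_pairing (rho y)) E2 (val_inj E1 : (rho y).1 = j).
rewrite -[X in (X <= _)%N]card_ord -cardsT.
have <- : #|[set rho y | y in 'I_m]| = #|[set: 'I_m]|.
  rewrite card_imset ?cardsT // => y y' E; apply: val_inj.
  by rewrite -[LHS]rkE -[RHS]rkE E.
apply: subset_leq_card; apply/subsetP => p /imsetP[y _ ->]; rewrite inE.
by apply/existsP; exists y; rewrite !ffunE /= !eqxx.
Qed.

Lemma sum_encode (V : nmodType) (P : pred (lattice_path k m * labeling m L))
    (f : lattice_path k m * labeling m L -> V) (Q : pred {set 'I_k * 'I_L})
    (g : {set 'I_k * 'I_L} -> V) :
  (forall Xl, P Xl -> is_word Xl) ->
  (forall Xl, is_word Xl -> P Xl = Q (encode Xl.1 Xl.2)) ->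
  (forall Xl, P Xl -> f Xl = g (encode Xl.1 Xl.2)) ->
  \sum_(Xl | P Xl) f Xl = \sum_(A : {set 'I_k * 'I_L} | (#|A| == m) && Q A) g A.
Proof.
move=> Pw PQ fg.
rewrite (eq_bigl (fun A => (A \in (fun Xl => encode Xl.1 Xl.2) @: [set Xl | is_word Xl])
    && Q A)); last first.
  move=> A; congr (_ && _); apply/eqP/imsetP => [/encode_onto[Xl w ->]|[[X l]]].
    by exists Xl; rewrite ?inE.
  by rewrite inE => w ->; exact: encode_card.
rewrite big_mkcondr big_imset /=; last exact: encode_inj.
rewrite -big_mkcondr; apply: eq_big => Xl.
  rewrite inE; apply/idP/andP => [p|[w]]; last by rewrite PQ.
  by have w := Pw _ p; rewrite w -PQ.
exact: fg.
Qed.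

End Encoding.

(** * Attack statistics computed column by column *)

Definition rk (L : nat) (Z : {set 'I_L}) (v : nat) : nat := #|[set u in Z | (u < v)%N]|.

Lemma sum_rk (L : nat) (Z : {set 'I_L}) (V : Type) (idx : V) (op : Monoid.com_law idx)
    (phi : nat -> V) :
  \big[op/idx]_(u in Z) phi (rk Z u) = \big[op/idx]_(s < #|Z|) phi s.
Proof.
rewrite -(@sum_rank_in _ (fun u : 'I_L => (u : nat)%:Z)) //; last by move=> u v _ _ [/val_inj].
Qed.

Lemma rk_mono (L : nat) (Z : {set 'I_L}) (v w : nat) : (v <= w)%N -> (rk Z v <= rk Z w)%N.
Proof.
move=> vw; apply: subset_leq_card; apply/subsetP => u; rewrite !inE => /andP[-> /=].
by move/leq_trans; apply.
Qed.

Lemma rk_le (L : nat) (Z : {set 'I_L}) (v : nat) : (rk Z v <= #|Z|)%N.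
Proof. by apply: subset_leq_card; apply/subsetP => u; rewrite inE => /andP[]. Qed.

Lemma rk_lt (L : nat) (Z : {set 'I_L}) (u : 'I_L) (v : nat) : u \in Z ->
  (rk Z u < rk Z v)%N = (u < v)%N.
Proof.
move=> uZ; apply/idP/idP => [|uv]; first by apply: contraTT; rewrite -!leqNgt; exact: rk_mono.
apply: proper_card; apply/properP; split.
  by apply/subsetP => z; rewrite !inE => /andP[-> zu]; exact: ltn_trans uv.
by exists u; rewrite !inE uZ ?ltnn.
Qed.

Lemma sum_indicator (n : nat) (s : int) (P : nat -> bool) :
  (\sum_(x < n) (((x : nat)%:Z == s) && P x))%N = (0 <= s < n%:Z) && P `|s|%N :> nat.
Proof.
case: s => [s|s]; last by rewrite big1.
have [sn|ns] := ltnP s n.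
  rewrite (bigD1 (Ordinal sn)) //= eqxx big1 ?addn0 ?ltz_nat ?sn // => x /negPf ne.
  by rewrite (_ : (_ == _) = false) //; apply/negP => /eqP [E]; rewrite -val_eqE /= E eqxx in ne.
rewrite big1 => [|x _]; last first.
  by rewrite (_ : (_ == _) = false) //; apply/negP => /eqP [E]; have := ltn_ord x; lia.
by rewrite ltz_nat ltnNge ns.
Qed.

(** At most one u in Z has rank s, and it is below v exactly when s is below the rank of v; the
    count is therefore a boolean. *)
Lemma sum_below (L : nat) (Z : {set 'I_L}) (v : nat) (s : int) :
  (\sum_(u in Z) (((rk Z u)%:Z == s) && (u < v)))%N = (0 <= s < (rk Z v)%:Z) :> nat.
Proof.
rewrite (eq_bigr (fun u : 'I_L => (((rk Z u)%:Z == s) && (rk Z u < rk Z v)%N : nat))); last first.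
  by move=> u uZ; rewrite rk_lt.
rewrite (sum_rk Z _ (fun x => ((x%:Z == s) && (x < rk Z v)%N : nat))).
rewrite (sum_indicator _ _ (fun x => x < rk Z v)%N).
by have := rk_le Z v; case: s => s /=; lia.
Qed.

Lemma sum_above (L : nat) (Z : {set 'I_L}) (v : nat) (s : int) :
  (\sum_(u in Z) (((rk Z u)%:Z == s) && ~~ (u < v)))%N = ((rk Z v)%:Z <= s < #|Z|%:Z) :> nat.
Proof.
rewrite (eq_bigr (fun u : 'I_L => (((rk Z u)%:Z == s) && ~~ (rk Z u < rk Z v)%N : nat))); last first.
  by move=> u uZ; rewrite rk_lt.
rewrite (sum_rk Z _ (fun x => ((x%:Z == s) && ~~ (x < rk Z v)%N : nat))).
rewrite (sum_indicator _ _ (fun x => ~~ (x < rk Z v)%N)).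
by have := rk_le Z v; case: s => s /=; lia.
Qed.

(* Reading order of a box at level a of column i and a box at level b of
   column j <> i. *)
Definition before (i : nat) (a : int) (j : nat) (b : int) : bool :=
  if (i < j)%N then a <= b else a < b.

Section ColumnStatistics.
Variables (k L : nat) (Z : 'I_k -> {set 'I_L}) (S : nat -> int).

(** [S j] is the diagonal of the bottom box of column j. For a label v absent from the column this
    is the level at which v would be inserted. *)
Definition level (j : 'I_k) (v : nat) : int := S j + (rk (Z j) v)%:Z.
Definition top (j : 'I_k) : int := S j + #|Z j|%:Z.

Definition att_boxes (a b : 'I_k * 'I_L) : bool :=
  ((level a.1 a.2 == level b.1 b.2) && (a.1 < b.1)%N) ||
  ((level a.1 a.2 == level b.1 b.2 - 1) && (b.1 < a.1)%N).

(** At most one box of column i attacks the box v of column j. Its label is below v when it lies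
    between [S i] and the insertion level of v in column i, and not below v when it lies from there
    up to [top i]. So [tdinv_cols] and [coinv_cols] are interval counts. *)
Definition tdinv_cols : nat :=
  (\sum_(j < k) \sum_(v in Z j) \sum_(i < k | i != j)
    (before i (S i) j (level j v) && before j (level j v) i (level i v)))%N.

Definition coinv_cols : nat :=
  (\sum_(j < k) \sum_(v in Z j) \sum_(i < k | i != j)
    (before i (level i v) j (level j v) && before j (level j v) i (top i)))%N.

Lemma att_boxes_neq (i j : 'I_k) (u v : 'I_L) : i != j ->
  att_boxes (i, u) (j, v) = ((rk (Z i) u)%:Z == level j v - (j < i)%N%:Z - S i).
Proof.
move=> ij; rewrite /att_boxes /= /level.
have [lt|lt|E] := ltngtP i j; last by rewrite (val_inj E) eqxx in ij.
  by rewrite andbT andbF orbF; lia.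
by rewrite andbT andbF /=; lia.
Qed.

Lemma att_boxes_eq (j : 'I_k) (u v : 'I_L) : att_boxes (j, u) (j, v) = false.
Proof. by rewrite /att_boxes /= ltnn !andbF. Qed.

Lemma tdinv_cols_boxes :
  tdinv_cols = (\sum_(j < k) \sum_(v in Z j) \sum_(i < k) \sum_(u in Z i)
    (att_boxes (i, u) (j, v) && (u < v)))%N.
Proof.
apply: eq_bigr => j _; apply: eq_bigr => v _; rewrite big_mkcond /=; apply: eq_bigr => i _.
have [->|ij] := eqVneq i j; first by rewrite big1 // => u _; rewrite att_boxes_eq.
under [RHS]eq_bigr do rewrite att_boxes_neq //.
rewrite sum_below /before /level; have [lt|lt|E] := ltngtP i j;
  [congr nat_of_bool; lia|congr nat_of_bool; lia|].
by rewrite (val_inj E) eqxx in ij.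
Qed.

Lemma coinv_cols_boxes :
  coinv_cols = (\sum_(j < k) \sum_(v in Z j) \sum_(i < k) \sum_(u in Z i)
    (att_boxes (i, u) (j, v) && ~~ (u < v)))%N.
Proof.
apply: eq_bigr => j _; apply: eq_bigr => v _; rewrite big_mkcond /=; apply: eq_bigr => i _.
have [->|ij] := eqVneq i j; first by rewrite big1 // => u _; rewrite att_boxes_eq.
under [RHS]eq_bigr do rewrite att_boxes_neq //.
rewrite sum_above /before /level /top; have [lt|lt|E] := ltngtP i j;
  [congr nat_of_bool; lia|congr nat_of_bool; lia|].
by rewrite (val_inj E) eqxx in ij.
Qed.

End ColumnStatistics.

Section WordStatistics.
Variables (k L m : nat) (X : lattice_path k m) (l : labeling m L).
Hypothesis word : is_word (X, l).

Let A := encode X l.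

Lemma sum_rows (V : Type) (idx : V) (op : Monoid.com_law idx) (rho : 'I_m -> 'I_k * 'I_L) (g : 'I_k * 'I_L -> V) :
  injective rho -> A = [set rho y | y in 'I_m] ->
  \big[op/idx]_y g (rho y) = \big[op/idx]_(j < k) \big[op/idx]_(v in colset A j) g (j, v).
Proof.
move=> rinj rE; rewrite pair_big_dep /=.
transitivity (\big[op/idx]_(p in A) g p).
  by rewrite rE big_imset //= => y y' _ _; exact: rinj.
by apply: eq_big => [[j v]|[j v]] //=; rewrite !inE.
Qed.

Lemma height_encode (j : nat) : height A j = #|[set y | (X y < j)%N]|.
Proof.
have [rho [r1 r2 rinj rE _]] := encode_rows word.
rewrite /height -(card_imset _ rinj); apply: eq_card => p; rewrite [LHS]in_set /A rE.
apply/andP/imsetP => [[/imsetP[y _ ->] lt]|[y + ->]]; first by exists y => //; rewrite inE -r1.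
by rewrite inE -r1 => lt; split => //; exact: imset_f.
Qed.

Lemma lt_height (j : nat) (y : 'I_m) : (X y < j)%N = (y < height A j)%N.
Proof.
rewrite height_encode; apply: (initial_segment (P := fun y => (X y < j)%N)) => y1 y2 lt.
apply: leq_ltn_trans; have /and3P[/forallP pX _ _] := word.
exact: (implyP (forallP (pX y1) y2) (ltnW lt)).
Qed.

Lemma height_le (j : nat) : (height A j <= m)%N.
Proof. by rewrite height_encode -[X in (_ <= X)%N]card_ord max_card. Qed.

(** The diagonal offset of each column: r j for Dyck paths, the stretched abscissa for stacks. One
    computation thus serves both dinv and hdinv. *)
Variable c : nat -> nat.
Let S (j : nat) : int := (height A j)%:Z - (c j)%:Z.
Let delta (y : 'I_m) : int := (y : nat)%:Z - (c (X y))%:Z.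

Let att_rows (attacks : rel 'I_m) : Prop := forall y y',
  attacks y y' = ((delta y == delta y') && (X y < X y')%N) ||
             ((delta y == delta y' - 1) && (X y' < X y)%N).

Lemma card_att_rows (attacks : rel 'I_m) (h : rel 'I_L) : att_rows attacks ->
  #|[set p : 'I_m * 'I_m | attacks p.1 p.2 && h (l p.1) (l p.2)]| =
  (\sum_(j < k) \sum_(v in colset A j) \sum_(i < k) \sum_(u in colset A i)
    (att_boxes (colset A) S (i, u) (j, v) && h u v))%N.
Proof.
move=> attE; have [rho [r1 r2 rinj rE rr]] := encode_rows word.
rewrite -(sum_rows _ (fun q : 'I_k * 'I_L => \sum_(i < k) \sum_(u in colset A i)
    (att_boxes (colset A) S (i, u) q && h u q.2 : nat))%N rinj rE).
under [RHS]eq_bigr do rewrite -(sum_rows _ (fun p : 'I_k * 'I_L =>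
    (att_boxes (colset A) S p _ && h p.2 _ : nat))%N rinj rE).
rewrite exchange_big pair_big -sum1_card big_mkcond /=; apply: eq_bigr => -[y y'] _.
rewrite inE /= !r2 attE /att_boxes !r1 /level.
have dE z : delta z = S (rho z).1 + (rk (colset A (rho z).1) (rho z).2)%:Z.
  rewrite /delta /S -r1 {1}(rr z) -/A /col_rank /rk; lia.
by rewrite -!r1 -!dE; case: (_ && _).
Qed.

Lemma tdinv_encode (r : nat) (x : 'I_m -> nat) : att_rows (attacking r x) ->
  tdinv r x l = tdinv_cols (colset A) S.
Proof. by move=> attE; rewrite tdinv_cols_boxes -(card_att_rows (fun u v => u < v)%N attE). Qed.

Lemma coinv_encode (r : nat) (x : 'I_m -> nat) : att_rows (attacking r x) ->
  #|[set p : 'I_m * 'I_m | attacking r x p.1 p.2 && ~~ (l p.1 < l p.2)%N]| =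
  coinv_cols (colset A) S.
Proof. by move=> attE; rewrite coinv_cols_boxes -(card_att_rows (fun u v => ~~ (u < v))%N attE). Qed.

End WordStatistics.

Lemma card_ord_range (n a b : nat) : (b <= n)%N -> #|[set i : 'I_n | (a <= i < b)%N]| = (b - a)%N.
Proof.
move=> bn; rewrite -sum1_card (eq_bigl (fun i : 'I_n => (a <= i < b)%N)); last first.
  by move=> i; rewrite inE.
rewrite -(big_mkord (fun i => a <= i < b)%N (fun=> 1%N)).
transitivity (\sum_(a <= i < b) 1)%N; last by rewrite sum_nat_const_nat muln1.
rewrite [RHS](big_nat_widen _ _ n) // [RHS](big_nat_widenl _ 0) //.
by apply: eq_bigl => i; rewrite /= andbC.
Qed.

Lemma card_set_pair (T1 T2 : finType) (P : T1 -> T2 -> bool) :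
  #|[set c : T1 * T2 | P c.1 c.2]| = (\sum_x \sum_y P x y)%N.
Proof.
rewrite pair_bigA /= -sum1_card big_mkcond; apply: eq_bigr => c _.
by rewrite inE; case: (P _ _).
Qed.

Lemma rank_in_lt (T : finType) (pos : T -> int) (x y : T) : pos x < pos y ->
  (rank_in pos setT x < rank_in pos setT y)%N.
Proof.
move=> xy; apply: proper_card; apply/properP; split.
  by apply/subsetP => z; rewrite !inE /= => zx; exact: lt_trans xy.
by exists x; rewrite !inE /= ?xy ?ltxx.
Qed.

(** Labeling rows by their rank for [box_pos] makes every attacking pair count, and it is admissible
    because positions increase by k + 1 up a column. *)
Lemma maxtdinvE (r k : nat) (X : lattice_path k (k * r)) : is_path X ->
  maxtdinv X = #|[set p : 'I_(k * r) * 'I_(k * r) | attacking r (fun y => X y) p.1 p.2]|.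
Proof.
move=> pX; apply/eqP; rewrite eqn_leq /maxtdinv; apply/andP; split.
  apply/bigmax_leqP => l _; apply: subset_leq_card; apply/subsetP => p.
  by rewrite !inE => /andP[].
have rkP y : (rank_in (box_pos r X) setT y < k * r)%N.
  rewrite -[X in (_ < X)%N]card_ord -cardsT; apply: proper_card; apply/properP; split.
    by apply/subsetP => z; rewrite inE.
  by exists y; rewrite ?inE //= ltxx.
pose l : labeling (k * r) (k * r) := [ffun y => Ordinal (rkP y)].
have lP : is_labeling X l.
  rewrite -(col_strict_labeling r _ pX); apply/forallP => y; apply/forallP => y'.
  apply/implyP => /eqP E; rewrite !ffunE /=; apply: rank_in_lt; rewrite E; lia.
apply: leq_trans (leq_bigmax_cond _ lP); apply: subset_leq_card; apply/subsetP => p.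
rewrite !inE => at_p; rewrite at_p !ffunE /=; apply: rank_in_lt.
by move: at_p; rewrite -att_box_pos => /andP[].
Qed.

Section WordDyck.
Variables (r k L : nat) (X : lattice_path k (k * r)) (l : labeling (k * r) L).
Hypothesis word : is_word (X, l).

Let A := encode X l.
Let S (j : nat) : int := (height A j)%:Z - (r * j)%:Z.

(** As the maximum counts all attacking pairs, [tdinv] minus [maxtdinv] is minus the number of
    attacking pairs whose labels do not increase. *)
Lemma dinv_encode : dinv X l = (pathdinv X)%:Z - (coinv_cols (colset A) S)%:Z.
Proof.
have /and3P[/= pX _ _] := word.
have attE : forall y y', attacking r (fun y => X y) y y' =
  (((y : nat)%:Z - (r * X y)%:Z == (y' : nat)%:Z - (r * X y')%:Z) && (X y < X y')%N) ||
  (((y : nat)%:Z - (r * X y)%:Z == (y' : nat)%:Z - (r * X y')%:Z - 1) && (X y' < X y)%N) by [].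
rewrite /dinv maxtdinvE //.
rewrite -(@coinv_encode _ _ _ _ _ word (fun j => r * j)%N r (fun y => X y) attE).
set a := #|_|; set b := #|_|.
suff -> : a = (tdinv r (fun y => X y) l + b)%N by lia.
rewrite /a /b /tdinv -[in LHS](cardsID [set p : 'I_(k * r) * 'I_(k * r) | (l p.1 < l p.2)%N]).
by congr (_ + _)%N; apply: eq_card => p; rewrite !inE // andbC.
Qed.

Lemma is_dyck_encode : is_dyck X = [forall j : 'I_k.+1, (r * j <= height A j)%N].
Proof.
have /and3P[/= pX _ _] := word.
rewrite /is_dyck pX /=; apply/forallP/forallP => H j.
  rewrite leqNgt; apply/negP => lt.
  have hm : (height A j < k * r)%N.
    by apply: leq_trans lt _; rewrite mulnC leq_mul2r -ltnS ltn_ord orbT.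
  have := H (Ordinal hm); rewrite leqNgt => /negP; apply => /=.
  apply: leq_trans lt _; rewrite leq_mul2l; apply/orP; right.
  by rewrite leqNgt (lt_height word) /= ltnn.
have hj := H (X j); apply: leq_trans hj _.
by rewrite leqNgt -(lt_height word) ltnn.
Qed.

Lemma wpf_area_encode : wpf_area X = (\sum_(x < k) (height A x.+1 - r * x.+1))%N.
Proof.
rewrite /wpf_area (card_set_pair (fun (x : 'I_k) (y : 'I_(k * r)) =>
   (X y <= x) && (r * x.+1 <= y))%N).
apply: eq_bigr => x _.
rewrite -(card_ord_range (r * x.+1) (height_le word x.+1)) -sum1_card [RHS]big_mkcond /=.
apply: eq_bigr => y _; rewrite !inE /= andbC -(lt_height word) ltnS.
by case: (_ && _).
Qed.

(** For the box of column i in the row of v, leg - r arm equals the level of v minus S (i+1); the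
    two slope conditions say that it lies between -1 and r - 1. *)
Lemma pathdinv_encode : (0 < k)%N -> pathdinv X =
  (\sum_(j < k) \sum_(v in colset A j) \sum_(i < k | i < j)
     ((S i.+1 - 1 <= level (colset A) S j v) &&
      (level (colset A) S j v <= S i.+1 + r%:Z - 1))%R)%N.
Proof.
move=> k0; have [rho [r1 r2 rinj rE rr]] := encode_rows word.
rewrite -(sum_rows _ (fun q : 'I_k * 'I_L => \sum_(i < k | i < q.1)
     ((S i.+1 - 1 <= level (colset A) S q.1 q.2) &&
      (level (colset A) S q.1 q.2 <= S i.+1 + r%:Z - 1))%R)%N rinj rE).
rewrite /pathdinv (card_set_pair (fun (x : 'I_k) (y : 'I_(k * r)) =>
  [&& (x < X y)%N, (arm X x y * (k * r) <= k * (leg X x y).+1)%N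
        & (k * leg X x y < (arm X x y).+1 * (k * r))%N])).
rewrite exchange_big; apply: eq_bigr => y _; rewrite [RHS]big_mkcond /=.
apply: eq_bigr => x _; rewrite r1; case: ltnP => //= lt.
have levE : level (colset A) S (rho y).1 (rho y).2 = (y : nat)%:Z - (r * X y)%:Z.
  have E : y = (height A (rho y).1 + rk (colset A (rho y).1) (rho y).2)%N :> nat := rr y.
  by rewrite /level /S -r1; lia.
have Hy : (height A x.+1 <= y)%N by rewrite leqNgt -(lt_height word) ltnS -ltnNge.
have armE : arm X x y = (X y - x.+1)%N.
  by rewrite /arm -(card_ord_range x.+1 (_ : X y <= k)%N) // -ltnS ltn_ord.
have legE : leg X x y = (y - height A x.+1)%N.
  rewrite -(card_ord_range _ (ltnW (ltn_ord y))); apply: eq_card => z.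
  by rewrite !inE andbC ltnNge -ltnS (lt_height word) -leqNgt.
rewrite levE armE legE mulnCA leq_pmul2l // mulnCA ltn_pmul2l // mulSn mulnBl.
have le1 : (r * x.+1 <= r * X y)%N by rewrite leq_mul2l lt orbT.
rewrite /S [(X y * r)%N]mulnC [(x.+1 * r)%N]mulnC; congr nat_of_bool.
move: (r * x.+1)%N (r * X y)%N (height A x.+1) le1 Hy => u w h le1 Hy.
by clear -le1 Hy; lia.
Qed.

End WordDyck.

(** * Collapse of the sum over missing columns *)

(* The determinant of the 0-1 Hessenberg matrix [bs_u + v == u + 1], with the
   first column shifted by z so that expansion along the first row is recursive. *)
Fixpoint hess_sign (A : pzRingType) (z : nat) (bs : seq nat) : A :=
  if bs is b :: bs' then
    (b == z.+1)%:R * hess_sign A 0 bs' - (b == 0%N)%:R * hess_sign A z.+1 bs'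
  else (z == 0%N)%:R.

Section Particles.
Variable k : nat.
Implicit Types (f : 'I_k -> int) (e : 'I_k -> nat) (B : {set 'I_k}).

(** Columns are particles at heights f, ordered by [before]. A move lowers the particles of a set by
    one, each at a cost equal to the number of particles after it. *)
Definition n_above f (j : 'I_k) : nat := #|[set i : 'I_k | before j (f j) i (f i)]|.

Definition drop_set f B : 'I_k -> int := fun j => f j - (j \in B)%:Z.

Fixpoint drop_stat f (Bs : seq {set 'I_k}) : nat :=
  if Bs is B :: Bs' then (\sum_(j in B) n_above f j + drop_stat (drop_set f B) Bs')%N else 0%N.

(** The same cost when the particles compared with already sit at their final heights f - e. The
    moves of j are numbered backwards: s = 0 is its last one, s = e j - 1 its first. *)
Definition final_cost f e (j : 'I_k) (s : nat) : nat :=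
  #|[set i : 'I_k | before j (f j - (e j)%:Z + s.+1%:Z) i (f i - (e i)%:Z)]|.

Definition final_stat f e : nat := (\sum_(j < k) \sum_(s < e j) final_cost f e j s)%N.

Definition lower e B : 'I_k -> nat := fun j => (e j - (j \in B))%N.

Definition supp e : {set 'I_k} := [set j | e j != 0%N].

(** The move leaves the final heights f - e unchanged, so each j in B merely loses the cost of its
    first move, s = e j - 1. *)
Lemma final_stat_drop f e B : B \subset supp e ->
  final_stat f e =
  (final_stat (drop_set f B) (lower e B) + \sum_(j in B) final_cost f e j (e j).-1)%N.
Proof.
move=> /subsetP Bs; rewrite [in RHS](big_mkcond (fun j => j \in B)) -big_split /=.
apply: eq_bigr => j _.
have fin i : drop_set f B i - (lower e B i)%:Z = f i - (e i)%:Z.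
  rewrite /drop_set /lower; case iB : (i \in B); last by rewrite subn0 subr0.
  by have := Bs i iB; rewrite inE; lia.
have costE s : final_cost (drop_set f B) (lower e B) j s = final_cost f e j s.
  by apply: eq_card => i; rewrite !inE !fin.
under [X in _ = (X + _)%N]eq_bigr do rewrite costE.
rewrite /lower; case jB : (j \in B); last by rewrite subn0 addn0.
by have := Bs j jB; rewrite inE; case: (e j) => // d _; rewrite subn1 big_ord_recr.
Qed.

Lemma top_exists f (D : {set 'I_k}) : D != set0 ->
  exists2 c, c \in D & forall i, i \in D -> ~~ before c (f c) i (f i).
Proof.
case/set0Pn => j0 j0D.
(* Linearises [before]: height first, then column index, which stays below k. *)
pose g (j : 'I_k) : int := f j * k%:Z + (j : nat)%:Z.
case: (@Order.TotalTheory.arg_maxP _ _ _ j0 (mem D) g j0D) => c cD cmax.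
exists c => // i iD; have : g i <= g c := cmax i iD.
rewrite /g /before => le; apply/negP; have := ltn_ord c; have := ltn_ord i.
case: (ltnP c i) => [ci ik ck fci|ic ik ck fci].
  have : f c * k%:Z <= f i * k%:Z by apply: ler_wpM2r => //; lia.
  by move: le; lia.
have : (f c + 1) * k%:Z <= f i * k%:Z by apply: ler_wpM2r => //; lia.
by rewrite mulrDl mul1r; move: le; lia.
Qed.

Lemma before_le (i j : nat) (a b b' : int) : b <= b' -> before i a j b -> before i a j b'.
Proof. by rewrite /before; case: ifP => _; lia. Qed.

(** Only particles that no longer move can come after c, and their heights are already final. *)
Lemma top_cost f e c : c \in supp e ->
  (forall i, i \in supp e -> ~~ before c (f c) i (f i)) ->
  final_cost f e c (e c).-1 = n_above f c.
Proof.
move=> cs ctop; apply: eq_card => i; rewrite !inE.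
have -> : f c - (e c)%:Z + ((e c).-1.+1)%:Z = f c by move: cs; rewrite inE; lia.
apply/idP/idP; first by apply: before_le; lia.
move=> bi; have : i \notin supp e by apply: contraL bi => /ctop.
by rewrite inE negbK => /eqP ->; rewrite subr0.
Qed.

Variables (A : comNzRingType) (Q : A).

Definition drop_term f e B : A :=
  (-1) ^+ #|B| * Q ^+ (\sum_(j in B) n_above f j
     + final_stat (drop_set f B) (lower e B)).

(* Toggling a topmost column of the support preserves the exponent of Q. *)
Lemma sum_drop_term f e : supp e != set0 ->
  \sum_(B : {set 'I_k} | B \subset supp e) drop_term f e B = 0.
Proof.
move=> e0; have [c cs ctop] := top_exists f e0.
rewrite (big_powersetD1 _ cs) big1 // => B Bs.
have cB : c \notin B by move: Bs; rewrite subsetD1 => /andP[].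
have Bs' : B \subset supp e by apply: subset_trans Bs (subsetDl _ _).
have cBs : c |: B \subset supp e by rewrite subUset sub1set cs.
have := final_stat_drop f Bs'; rewrite (final_stat_drop f cBs) !big_setU1 //= top_cost // => E.
rewrite /drop_term cardsU1 cB big_setU1 //= exprS mulN1r mulNr.
rewrite (_ : (n_above f c + _ + _ = \sum_(j in B) n_above f j
     + final_stat (drop_set f B) (lower e B))%N) ?subrr //.
move/eqP: E; rewrite addnA eqn_add2r => /eqP <-.
by rewrite (addnC (n_above f c)) -addnA (addnC (n_above f c)).
Qed.

Definition drop_sum (m z : nat) f e : A :=
  \sum_(Bs : m.-tuple {set 'I_k} | [forall j, count (fun B => j \in B) Bs == e j])
    hess_sign A z [seq #|B| | B : {set 'I_k} <- Bs] * Q ^+ drop_stat f Bs.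

Lemma sum_tuple_cons (T : finType) (V : nmodType) (m : nat) (P : pred (seq T)) (G : seq T -> V) :
  \sum_(t : m.+1.-tuple T | P t) G t =
  \sum_(x : T) \sum_(t : m.-tuple T | P (x :: t)) G (x :: t).
Proof.
rewrite pair_big_dep /=.
rewrite (reindex_onto (fun xt : T * m.-tuple T => [tuple of xt.1 :: xt.2])
   (fun t => (thead t, [tuple of behead t]))) /=; last first.
  by move=> t _; rewrite [RHS]tuple_eta.
apply: eq_bigl => -[x t] /=; rewrite (_ : (_ == _) = true) ?andbT //.
by rewrite -pair_eqE /= theadE eqxx /=; apply/eqP/val_inj.
Qed.

(** [hess_sign] keeps two kinds of first set: one with z + 1 elements, which resets z to 0, or the
    empty one, which moves nothing and raises z by one. *)
Lemma drop_sum_rec (m z : nat) f e :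
  drop_sum m.+1 z f e =
  \sum_(B : {set 'I_k} | (B \subset supp e) && (#|B| == z.+1))
     Q ^+ (\sum_(j in B) n_above f j) * drop_sum m 0 (drop_set f B) (lower e B)
  - drop_sum m z.+1 f e.
Proof.
have empty f' : drop_set f' set0 =1 f' by move=> j; rewrite /drop_set inE subr0.
have stat_ext f1 f2 (Bs : seq {set 'I_k}) : f1 =1 f2 -> drop_stat f1 Bs = drop_stat f2 Bs.
  elim: Bs f1 f2 => //= B Bs IH f1 f2 E; congr (_ + _)%N.
    by apply: eq_bigr => j _; apply: eq_card => i; rewrite !inE !E.
  by apply: IH => j; rewrite /drop_set E.
rewrite /drop_sum (sum_tuple_cons _ (fun Bs => [forall j, count (fun B => j \in B) Bs == e j])
  (fun Bs => hess_sign A z [seq #|B| | B : {set 'I_k} <- Bs] * Q ^+ drop_stat f Bs)) /=.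
under eq_bigr => B _ do under eq_bigr => t _ do rewrite mulrBl exprD.
under eq_bigr => B _ do rewrite sumrB.
rewrite sumrB; congr (_ - _).
  rewrite [RHS]big_mkcond; apply: eq_bigr => B _.
  case: ifP => [/andP[Bs /eqP cB]|ncond].
    rewrite mulr_sumr; apply: eq_big => t.
      apply: eq_forallb => j; rewrite /lower.
      have : j \in B -> e j != 0%N by move/(subsetP Bs); rewrite inE.
      by case: (j \in B) => [/(_ isT)|_]; case: (e j) => [|d] //= _; lia.
    by move=> _; rewrite cB eqxx mul1r mulrCA.
  apply: big1 => t /forallP H; case: eqP => [cB|_]; last by rewrite !mul0r.
  move: ncond; rewrite cB eqxx andbT => /negP[]; apply/subsetP => j jB.
  by rewrite inE -(eqP (H j)) /= jB.
rewrite (bigD1 set0) //= [X in _ + X]big1 ?addr0; last first.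
  by move=> B B0; apply: big1 => t _; rewrite cards_eq0 (negPf B0) !mul0r.
apply: eq_big => t; first by apply: eq_forallb => j; rewrite inE.
by move=> _; rewrite cards0 eqxx mul1r big_set0 expr0 mul1r (stat_ext _ f).
Qed.

(* At z = 0 the first formula sums over all nonempty B, hence by [sum_drop_term]
   equals the term of the empty set, which is the second formula. *)
Lemma drop_sumE (m z : nat) f e : (\sum_j e j = m + z)%N ->
  ((0 < m + z)%N -> drop_sum m z f e = (-1) ^+ z.+1 *
     \sum_(B : {set 'I_k} | (B \subset supp e) && (z < #|B|)%N) drop_term f e B) /\
  (z = 0%N -> drop_sum m z f e = Q ^+ final_stat f e).
Proof.
elim: m z f e => [|m IHm] z f e se.
  split=> [z0|z0].
    rewrite [X in _ * X]big1 ?mulr0; last first.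
      move=> B /andP[Bs]; suff : (#|B| <= z)%N by rewrite ltnNge => ->.
      rewrite add0n in se; apply: leq_trans (subset_leq_card Bs) _.
      rewrite -se -sum1_card big_mkcond /=; apply: leq_sum => j _.
      by rewrite inE; case: (e j).
    rewrite /drop_sum big1 // => t _; rewrite tuple0 /=.
    by case: (z) z0 => //= d _; rewrite mul0r.
  have e0 j : e j = 0%N.
    by apply/eqP; have /eqP := se; rewrite z0 sum_nat_eq0 => /forallP/(_ j).
  rewrite /drop_sum (bigD1 [tuple]) /=; last by apply/forallP => j; rewrite e0.
  rewrite z0 expr0 mulr1 [X in _ + X]big1 ?addr0; last first.
    by move=> t /andP[_ /eqP[]]; exact: tuple0.
  by rewrite /final_stat big1 ?expr0 // => j _; rewrite e0 big_ord0.
have main : drop_sum m.+1 z f e = (-1) ^+ z.+1 *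
     \sum_(B : {set 'I_k} | (B \subset supp e) && (z < #|B|)%N) drop_term f e B.
  rewrite drop_sum_rec.
  have se' : (\sum_j e j = m + z.+1)%N by rewrite se addSnnS.
  have [H1 _] := IHm z.+1 f e se'; rewrite H1 ?addn_gt0 ?orbT // {H1}.
  (* Sets with exactly z + 1 elements match the first term of the recursion; the larger ones come
     from the induction hypothesis at z + 1. *)
  rewrite [X in _ = _ * X](bigID (fun B : {set 'I_k} => #|B| == z.+1)) /= mulrDr; congr (_ + _); last first.
    rewrite [X in - (X * _)]exprS mulN1r mulNr opprK; congr (_ * _).
    by apply: eq_bigl => B; rewrite -andbA; congr (_ && _); lia.
  rewrite mulr_sumr; apply: eq_big => B.
    by rewrite -andbA; congr (_ && _); apply/eqP/andP => [->|[_ /eqP]].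
  move=> /andP[Bs /eqP cB]; rewrite /drop_term cB mulrA -expr2 sqrr_sign mul1r exprD.
  suff : (\sum_j lower e B j = m + 0)%N by move=> E; have [_ ->] := IHm 0%N (drop_set f B) (lower e B) E.
  have : (\sum_j e j = \sum_j lower e B j + #|B|)%N.
    rewrite -sum1_card [X in (_ + X)%N]big_mkcond -big_split; apply: eq_bigr => j _ /=.
    rewrite /lower; have : j \in B -> e j != 0%N by move/(subsetP Bs); rewrite inE.
    by case: (j \in B) => [/(_ isT)|_]; lia.
  by rewrite cB se; lia.
split=> // z0; rewrite main z0 expr1 mulN1r.
have e0 : supp e != set0.
  apply/set0Pn; have : (\sum_j e j != 0)%N by rewrite se.
  rewrite sum_nat_eq0 => /forallPn[j]; rewrite implyTb => ej.
  by exists j; rewrite inE.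
have := sum_drop_term f e0; rewrite (bigD1 set0) ?sub0set //= => /eqP.
rewrite addr_eq0 => /eqP E.
rewrite (eq_bigl (fun B : {set 'I_k} => (B \subset supp e) && (B != set0))); last first.
  by move=> B; rewrite card_gt0.
rewrite -E /drop_term cards0 big_set0 expr0 mul1r add0n; congr (_ ^+ _).
by rewrite [RHS](final_stat_drop f (sub0set (supp e))) big_set0 addn0.
Qed.

End Particles.

Definition hess_entry (bs : seq nat) (z u v : nat) : bool :=
  (nth 0 bs u + v == u.+1 + (v == 0) * z)%N.

(** The first row can be nonzero only in columns 0 and 1. Deleting column 0 leaves the unshifted
    matrix of the tail; deleting column 1 keeps column 0, now one row further up, so that its shift
    becomes z + 1. *)
Lemma det_hess (A : comNzRingType) (m z : nat) (bs : seq nat) : size bs = m ->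
  (0 < m)%N || (z == 0%N) ->
  \det (\matrix_(u < m, v < m) (hess_entry bs z u v)%:R) = hess_sign A z bs.
Proof.
elim: m z bs => [|m IHm] z [|b bs] //=; first by rewrite det_mx00 => _ ->.
case=> sz _; rewrite (expand_det_row _ ord0).
case: m IHm sz => [|m] IHm sz.
  rewrite big_ord1 mxE (size0nil sz) /= mulr0 subr0 /cofactor det_mx00 expr0 mul1r.
  by rewrite /hess_entry /= addn0 mul1n add1n.
rewrite 2!big_ord_recl /= big1 ?addr0; last first.
  move=> v _; rewrite mxE /hess_entry /= (_ : (_ == _) = false) ?mul0r //.
  by rewrite /bump; lia.
have -> : cofactor (\matrix_(u < m.+2, v < m.+2) (hess_entry (b :: bs) z u v)%:R) ord0 ord0 =
    hess_sign A 0 bs.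
  rewrite /cofactor expr0 mul1r -(IHm 0%N bs sz) //; congr (\det _).
  apply/matrixP => u v; rewrite !mxE /hess_entry !lift0 muln0 addn0.
  by rewrite (_ : (v.+1 == 0)%N = false) // mul0n addn0 addnS eqSS.
have -> : cofactor (\matrix_(u < m.+2, v < m.+2) (hess_entry (b :: bs) z u v)%:R) ord0
    (lift ord0 ord0) = - hess_sign A z.+1 bs.
  rewrite /cofactor expr1 mulN1r -(IHm z.+1 bs sz) //; congr (- \det _).
  apply/matrixP => u v; rewrite !mxE /hess_entry !lift0 /=; congr ((nat_of_bool _)%:R).
  by case: (v : nat) => [|d]; rewrite /bump /=; lia.
rewrite !mxE /hess_entry /= /bump /= mulrN.
by congr ((nat_of_bool _)%:R * _ - (nat_of_bool _)%:R * _); lia.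
Qed.

Lemma sum_perm_hess (A : comNzRingType) (m : nat) (bs : seq nat) : size bs = m ->
  \sum_(s : 'S_m) (-1) ^+ s * ([forall u : 'I_m, (nth 0 bs u + s u == u.+1)%N])%:R =
  hess_sign A 0 bs.
Proof.
move=> sz; rewrite -(@det_hess A m 0 bs) ?orbT // /determinant.
apply: eq_bigr => s _; congr (_ * _).
under [RHS]eq_bigr do rewrite mxE /hess_entry muln0 addn0.
case: (boolP [forall u, _]) => [/forallP H|/forallPn[u /negPf H]].
  by rewrite big1 // => u _; rewrite H.
by rewrite (bigD1 u) //= H mul0r.
Qed.

(** * Comparison of the statistics *)

Definition indic (b : bool) : int := (b : nat)%:Z.
Definition pos_part (z : int) : int := Num.max z 0.

Lemma sum_ind_ge (a b : int) (c : nat) :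
  \sum_(s < c) indic (a <= b + (s : nat)%:Z) = pos_part (b + c%:Z - a) - pos_part (b - a).
Proof.
rewrite /indic /pos_part; elim: c => [|c IH]; first by rewrite big_ord0; lia.
by rewrite big_ord_recr /= IH; lia.
Qed.

Lemma sum_ord_lt (k : nat) (j : 'I_k) (G : nat -> int) :
  \sum_(i < k | (i < j)%N) G i = \sum_(i < j) G i.
Proof. by rewrite (big_ord_narrow (ltnW (ltn_ord j))). Qed.

Lemma sum_neq_pairs (k : nat) (F : nat -> nat -> int) :
  \sum_(j < k) \sum_(i < k | i != j) F i j = \sum_(b < k) \sum_(a < b) (F a b + F b a).
Proof.
transitivity (\sum_(j < k) (\sum_(i < k | (i < j)%N) F i j + \sum_(i < k | (j < i)%N) F i j)).
  apply: eq_bigr => j _; rewrite (bigID (fun i : 'I_k => (i < j)%N)) /=; congr (_ + _).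
    by apply: eq_bigl => i; rewrite -val_eqE /=; lia.
  by apply: eq_bigl => i; rewrite -val_eqE /=; lia.
rewrite big_split /= [X in _ + X](exchange_big_dep predT) //= -big_split /=.
apply: eq_bigr => b _; rewrite big_split /=.
by rewrite (sum_ord_lt b (fun i => F i b)) (sum_ord_lt b (fun i => F b i)).
Qed.

Lemma sum_neq_const (k : nat) (j : 'I_k) (v : int) :
  \sum_(i < k | i != j) v = v * (k%:Z - 1).
Proof.
have : \sum_(i < k) v = v * k%:Z by rewrite sumr_const card_ord -mulr_natr natz.
by rewrite (bigD1 j) //= mulrBr mulr1 => <-; rewrite addrAC subrr add0r.
Qed.

Section Telescoping.
Variables (k M : nat) (S : nat -> int) (x e : nat -> nat).
Hypotheses (S0 : S 0%N = 0) (Sk : S k = 0)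
  (Spos : forall j, (j <= k)%N -> 0 <= S j)
  (Srec : forall j, (j < k)%N -> S j.+1 = S j + (x j)%:Z - (e j)%:Z - 1)
  (eM : forall j, (j < k)%N -> (e j <= M)%N).

Let P (j : nat) : int := S j + (x j)%:Z.

(** Think of S j as the starting level of column j, x j as its number of small letters and e j as
    the number of large letters it lacks. W and H are the defects with which [column_identity] holds
    for each pair (i, j) separately; their total sums telescope. *)
Let W (i j : nat) : int :=
  if (i < j)%N then pos_part (P j - S i) - pos_part (P j - S i.+1)
  else pos_part (P j - S i - 1) - pos_part (P j - S i.+1 - 1).

Let H (i j : nat) : int :=
  if (i < j)%N then pos_part (S j.+1 + M%:Z + 2 - S i.+1) - pos_part (S j - S i.+1 + 1)
    + pos_part (S j - S i) - pos_part (S j.+1 + 1 - S i.+1)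
  else pos_part (S j.+1 - S i.+1 - 1) - pos_part (S j - S i.+1 - M%:Z - 2)
    + pos_part (S j - S i - 1) - pos_part (S j.+1 - S i.+1).

(** For fixed j the sum over i telescopes on either side of j. By S 0 = S k = 0 and nonnegativity
    the result is S j - S (j+1), which telescopes once more. *)
Lemma sum_W : \sum_(j < k) \sum_(i < k | i != j) W i j = 0.
Proof.
have E (j : 'I_k) : \sum_(i < k | i != j) W i j = S j - S j.+1.
  have jk := ltn_ord j.
  transitivity (\sum_(i < j) (pos_part (P j - S i) - pos_part (P j - S i.+1)) +
     \sum_(j.+1 <= i < k) (pos_part (P j - S i - 1) - pos_part (P j - S i.+1 - 1))).
    rewrite (bigID (fun i : 'I_k => (i < j)%N)) /=; congr (_ + _).
      rewrite -(sum_ord_lt j (fun i => pos_part (P j - S i) - pos_part (P j - S i.+1))).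
      apply: eq_big => i; first by rewrite -val_eqE /=; lia.
      by case/andP => _ ij; rewrite /W ij.
    rewrite (big_nat_widenl _ 0%N) // big_mkord.
    apply: eq_big => i; first by rewrite -val_eqE /=; lia.
    by case/andP => _ /negPf ij; rewrite /W ij.
  rewrite -(big_mkord predT (fun i => pos_part (P j - S i) - pos_part (P j - S i.+1))).
  rewrite (@telescope_sumr_eq _ _ _ (fun i => - pos_part (P j - S i))) //; last by move=> i _; lia.
  rewrite (@telescope_sumr_eq _ _ _ (fun i => - pos_part (P j - S i - 1))) //; last by move=> i _; lia.
  rewrite S0 Sk; have := Srec jk; have := Spos (ltnW jk); have := Spos jk.
  by rewrite /pos_part /P; lia.
rewrite (eq_bigr _ (fun j _ => E j)) -(big_mkord predT (fun j => S j - S j.+1)).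
rewrite (@telescope_sumr_eq _ _ _ (fun j => - S j)) //; last by move=> i _; lia.
by rewrite S0 Sk; lia.
Qed.

(** For a < b the terms of (a, b) and (b, a) add up to M, differences in a of U, Y and S, and V a b
    - V (a+1) (b+1). The U and Y parts telescope to zero; the V part leaves minus the sum of all S
    b, which cancels what the S part contributes. *)
Lemma sum_H : \sum_(j < k) \sum_(i < k | i != j) H i j = \sum_(j < k) (j * M)%N%:Z.
Proof.
pose U (a b : nat) := pos_part (S a - S b - M%:Z - 2).
pose Y (a b : nat) := pos_part (S a - S b - 1).
pose V (a b : nat) := pos_part (S a - S b).
pose PV (b : nat) := \sum_(0 <= a < b) V a b.
rewrite sum_neq_pairs.
have E (b : 'I_k) : \sum_(a < b) (H a b + H b a) = (b * M)%N%:Z + S b + (PV b - PV b.+1).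
  have bk := ltn_ord b.
  transitivity (\sum_(0 <= a < b) (M%:Z + (U a.+1 b.+1 - U a b.+1) + (- Y a.+1 b - (- Y a b))
     + (S a.+1 - S a) + (V a b - V a.+1 b.+1))).
    rewrite big_mkord; apply: eq_bigr => a _; rewrite /H (ltn_ord a) ltnNge (ltnW (ltn_ord a)) /=.
    by rewrite /U /Y /V /pos_part; lia.
  rewrite !big_split /= !sumrN.
  have -> : \sum_(0 <= a < b) M%:Z = (b * M)%N%:Z.
    by rewrite big_mkord sumr_const card_ord -mulr_natr natz; lia.
  have -> : \sum_(0 <= a < b) U a.+1 b.+1 = \sum_(0 <= a < b) U a b.+1.
    apply/eqP; rewrite -subr_eq0 -sumrB (telescope_sumr (fun a => U a b.+1)) //.
    have := Srec bk; have := Spos bk; have := eM bk; rewrite /U /pos_part S0; lia.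
  have -> : \sum_(0 <= a < b) Y a.+1 b = \sum_(0 <= a < b) Y a b.
    apply/eqP; rewrite -subr_eq0 -sumrB (telescope_sumr (fun a => Y a b)) //.
    have := Spos (ltnW bk); rewrite /Y /pos_part S0; lia.
  have -> : \sum_(0 <= a < b) S a.+1 = \sum_(0 <= a < b) S a + S b.
    apply/eqP; rewrite addrC -subr_eq -sumrB (telescope_sumr S) // S0; lia.
  have -> : PV b.+1 = \sum_(0 <= a < b) V a.+1 b.+1.
    rewrite /PV big_nat_recl // (_ : V 0%N b.+1 = 0) ?add0r //.
    by have := Spos bk; rewrite /V /pos_part S0; lia.
  by rewrite -/(PV b); ring.
rewrite (eq_bigr _ (fun b _ => E b)) big_split /= [X in X + _ = _]big_split /=.
rewrite -(big_mkord predT (fun b => PV b + - PV b.+1)).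
rewrite (@telescope_sumr_eq _ _ _ (fun b => - PV b)) //; last by move=> i _; rewrite addrC opprK.
have -> : PV k = \sum_(b < k) S b.
  rewrite /PV big_mkord; apply: eq_bigr => a _.
  by have := Spos (ltnW (ltn_ord a)); rewrite /V /pos_part Sk; lia.
have -> : PV 0%N = 0 by rewrite /PV big_geq.
by ring.
Qed.

(** Each inner sum counts the members of a run of consecutive levels beyond a threshold, hence is a
    difference of positive parts or the complement of one. Once W and H are inserted, every pair (i,
    j) balances by itself. *)
Lemma column_identity (c : nat -> nat) :
  (forall j, c j = x j + M - e j)%N -> (\sum_(j < k) e j = M)%N ->
  \sum_(j < k) \sum_(i < k | i != j) \sum_(s < c j)
     indic (if (i < j)%N then S i.+1 - 1 <= S j + (s : nat)%:Z
          else S i.+1 + M%:Z + 1 < S j + (s : nat)%:Z) =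
  \sum_(j < k) \sum_(i < k | i != j) \sum_(s < x j) indic (before i (S i) j (S j + (s : nat)%:Z))
  + \sum_(j < k) (j * M)%N%:Z - M%:Z * (k%:Z - 1)
  + \sum_(j < k) \sum_(i < k | i != j) \sum_(s < e j)
      indic (before j (S j.+1 + (s : nat)%:Z + 1) i (S i.+1)).
Proof.
move=> cE sume; rewrite -sum_H.
have -> : M%:Z * (k%:Z - 1) = \sum_(j < k) \sum_(i < k | i != j) (e j)%:Z.
  under eq_bigr do rewrite sum_neq_const.
  by rewrite -mulr_suml -sume -[in LHS]natz natr_sum; under eq_bigr do rewrite natz.
pose L (i j : nat) : int := \sum_(s < c j)
     indic (if (i < j)%N then S i.+1 - 1 <= S j + (s : nat)%:Z
          else S i.+1 + M%:Z + 1 < S j + (s : nat)%:Z).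
pose R (i j : nat) : int := \sum_(s < x j) indic (before i (S i) j (S j + (s : nat)%:Z)).
pose N (i j : nat) : int := \sum_(s < e j)
      indic (before j (S j.+1 + (s : nat)%:Z + 1) i (S i.+1)).
suff E : \sum_(j < k) \sum_(i < k | i != j)
    (L i j - R i j - H i j + (e j)%:Z - N i j + W i j) = 0.
  apply/eqP; rewrite -subr_eq0 -[X in _ == X]E; apply/eqP.
  under [RHS]eq_bigr do rewrite !big_split /= !sumrN.
  by rewrite !big_split /= !sumrN sum_W /L /R /N; ring.
apply: big1 => j _; apply: big1 => i ij; rewrite /L /R /N {L R N}.
have jk := ltn_ord j; have ik := ltn_ord i; have Ej := Srec jk; have ej := eM jk.
have EN (b : bool) : indic b = 1 - indic (~~ b) by rewrite /indic; case: b.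
rewrite [\sum_(s < e j) _](eq_bigr (fun s : 'I_(e j) =>
    1 - indic (~~ before j (S j.+1 + (s : nat)%:Z + 1) i (S i.+1)))); last first.
  by move=> s _; exact: EN.
rewrite sumrB sumr_const card_ord natz /before /H /W.
have [lt|lt|E] := ltngtP i j; last by rewrite (val_inj E) eqxx in ij.
  rewrite [\sum_(s < e j) _](eq_bigr (fun s : 'I_(e j) =>
    indic (S i.+1 <= S j.+1 + 1 + (s : nat)%:Z))); last by move=> s _; congr indic; lia.
  by rewrite !sum_ind_ge cE /pos_part /P; lia.
rewrite [\sum_(s < c j) _](eq_bigr (fun s : 'I_(c j) =>
    indic (S i.+1 + M%:Z + 2 <= S j + (s : nat)%:Z))); last by move=> s _; congr indic; lia.
rewrite [\sum_(s < x j) _](eq_bigr (fun s : 'I_(x j) =>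
    indic (S i + 1 <= S j + (s : nat)%:Z))); last by move=> s _; congr indic; lia.
rewrite [\sum_(s < e j) _](eq_bigr (fun s : 'I_(e j) =>
    indic (S i.+1 + 1 <= S j.+1 + 1 + (s : nat)%:Z))); last by move=> s _; congr indic; lia.
by rewrite !sum_ind_ge cE /pos_part /P; lia.
Qed.

End Telescoping.

(** * Stacks and their column excess *)

Section Stacks.
Variables (k M : nat).
Let n := (k + M)%N.
Implicit Types (s : stack n k) (e : {ffun 'I_k -> 'I_M.+1}).

Definition fibre s (j : 'I_k) : nat := #|[set y | s y == j]|.

(** The bound M gives a finite type; since every column has a box and the total is k + M, [inord]
    truncates nothing on a stack. *)
Definition excess s : {ffun 'I_k -> 'I_M.+1} := [ffun j => inord (fibre s j).-1].

(** The row of the lowest stack box in column x, and also the column to which x moves in P'. *)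
Definition wsum e (x : nat) : nat := (\sum_(j < k | (j < x)%N) (e j).+1)%N.

Lemma stretch_card s (x : nat) : stretch s x = #|[set y | (s y < x)%N]|.
Proof.
rewrite -sum1_card (partition_big s (fun j => (j < x)%N)) /=; last by move=> y; rewrite inE.
apply: eq_bigr => j jx; rewrite -sum1_card; apply: eq_bigl => y.
by rewrite !inE; case: eqP => [->|]; rewrite ?jx ?andbF.
Qed.

Lemma sum_fibre s : (\sum_(j < k) fibre s j = n)%N.
Proof.
rewrite -[RHS]card_ord -sum1_card (partition_big s predT) //=.
by apply: eq_bigr => j _; rewrite /fibre -sum1_card; apply: eq_bigl => y; rewrite !inE.
Qed.

Lemma fibre_gt0 s (j : 'I_k) : is_stack s -> (0 < fibre s j)%N.
Proof.
case/andP => _ /forallP/(_ j)/existsP[y sy]; rewrite card_gt0; apply/set0Pn.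
by exists y; rewrite inE.
Qed.

Lemma excessE s (j : 'I_k) : is_stack s -> (excess s j).+1 = fibre s j.
Proof.
move=> st; have f0 := fibre_gt0 _ st.
rewrite ffunE inordK ?prednK //; have := sum_fibre s; rewrite (bigD1 j) //=.
have : (\sum_(i < k | i != j) 1 <= \sum_(i < k | i != j) fibre s i)%N.
  by apply: leq_sum => i _; exact: f0.
rewrite sum1_card; have := cardC1 j; rewrite card_ord => ->.
move: (\sum_(i < k | i != j) fibre s i)%N (f0 j) (ltn_ord j) => w; rewrite /n; lia.
Qed.

Lemma stretch_wsum s (x : nat) : is_stack s -> stretch s x = wsum (excess s) x.
Proof. by move=> st; apply: eq_bigr => j _; rewrite excessE. Qed.

Lemma sum_excess s : is_stack s -> (\sum_j excess s j = M)%N.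
Proof.
move=> st; have := sum_fibre s.
rewrite (eq_bigr (fun j : 'I_k => 1 + excess s j)%N); last by move=> j _; rewrite -excessE.
by rewrite big_split /= sum1_card card_ord /n => /addnI.
Qed.

Lemma stack_lt s (y : 'I_n) (x : nat) : is_stack s -> (s y < x)%N = (y < stretch s x)%N.
Proof.
case/andP => /forallP mono _; rewrite stretch_card.
apply: (initial_segment (P := fun y => (s y < x)%N)) => y1 y2 lt.
by apply: leq_ltn_trans; exact: (implyP (forallP (mono y1) y2) (ltnW lt)).
Qed.

Lemma excess_inj : {in [set s | is_stack s] &, injective excess}.
Proof.
move=> s s'; rewrite !inE => st st' E; apply/ffunP => y; apply: val_inj => /=.
have lt x : (s y < x)%N = (s' y < x)%N by rewrite !stack_lt // !stretch_wsum // E.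
apply/eqP; rewrite eqn_leq.
by have := lt (s y).+1; have := lt (s' y).+1; rewrite !ltnS !leqnn => -> <-.
Qed.

Lemma wsum_rec e (j : 'I_k) : wsum e j.+1 = (wsum e j + (e j).+1)%N.
Proof.
rewrite /wsum (bigD1 j) //= addnC; congr (_ + _)%N; apply: eq_bigl => i.
by rewrite -val_eqE /= ltnS; case: ltngtP.
Qed.

Lemma wsum_mono e (x y : nat) : (x <= y)%N -> (wsum e x <= wsum e y)%N.
Proof.
move=> xy; rewrite /wsum [X in (_ <= X)%N](bigID (fun j : 'I_k => (j < x)%N)) /=.
apply: leq_trans (leq_addr _ _); apply/eq_leq/eq_bigl => j.
by case: (ltnP j x) => // jx; rewrite ?andbF ?andbT // (leq_trans jx xy).
Qed.

Lemma wsum_full e : (\sum_j e j = M)%N -> wsum e k = n.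
Proof.
move=> sume; rewrite /wsum (eq_bigl predT) => [|j]; last by rewrite ltn_ord.
by under eq_bigr do rewrite -add1n; rewrite big_split /= sum1_card card_ord sume.
Qed.

Lemma excess_onto e : (\sum_j e j = M)%N -> exists2 s, is_stack s & e = excess s.
Proof.
move=> sume.
(* The stack box of row y goes to the column whose index is the number of columns whose stack boxes
   all lie below row y. *)
pose c (y : nat) : nat := #|[set j : 'I_k | (wsum e j.+1 <= y)%N]|.
have cE (y : nat) (j : 'I_k) : (j < c y)%N = (wsum e j.+1 <= y)%N.
  apply/esym; apply: (initial_segment (P := fun j : 'I_k => (wsum e j.+1 <= y)%N)) => i1 i2 lt.
  by apply: leq_trans; apply: wsum_mono; rewrite ltnS ltnW.
have ck (y : 'I_n) : (c y < k)%N.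
  have k0 : (0 < k)%N.
    have : (y < wsum e k)%N by rewrite wsum_full.
    case: (posnP k) => // k0; rewrite /wsum big1 // => j _.
    by have := ltn_ord j; rewrite [X in (_ < X)%N]k0.
  have kk : (k.-1 < k)%N by rewrite prednK.
  have E := cE y (Ordinal kk); rewrite /= prednK // wsum_full // in E.
  by rewrite ltnNge E -ltnNge.
pose s : stack n k := [ffun y => Ordinal (ck y)].
have sE (y : 'I_n) (x : nat) : (x <= k)%N -> (s y < x)%N = (y < wsum e x)%N.
  case: x => [|j jk]; first by rewrite /wsum big_pred0.
  by rewrite ffunE /= ltnS leqNgt (cE y (Ordinal jk)) -ltnNge.
have wle x : (x <= k)%N -> (wsum e x <= n)%N.
  by move=> xk; rewrite -(wsum_full sume); exact: wsum_mono.
have fibE j : fibre s j = (e j).+1.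
  rewrite /fibre -[RHS](addKn (wsum e j)) -wsum_rec -(card_ord_range _ (wle _ (ltn_ord j))).
  apply: eq_card => y; rewrite !inE -sE // leqNgt -sE ?(ltnW (ltn_ord j)) //.
  by rewrite -val_eqE /= -leqNgt ltnS; case: ltngtP.
have st : is_stack s.
  apply/andP; split.
    apply/forallP => y; apply/forallP => y'; apply/implyP => yy'.
    rewrite !ffunE /=; apply: subset_leq_card; apply/subsetP => j; rewrite !inE => le.
    exact: leq_trans le yy'.
  apply/forallP => j; apply/existsP.
  have : (0 < fibre s j)%N by rewrite fibE.
  by rewrite card_gt0 => /set0Pn[y]; rewrite inE => sy; exists y.
exists s => //; apply/ffunP => j; apply: val_inj => /=.
by apply: succn_inj; rewrite excessE // fibE.
Qed.

Lemma sum_stacks (V : nmodType) (G : {ffun 'I_k -> 'I_M.+1} -> V) :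
  \sum_(s : stack n k | is_stack s) G (excess s) =
  \sum_(e : {ffun 'I_k -> 'I_M.+1} | (\sum_j e j == M)%N) G e.
Proof.
rewrite [RHS](eq_bigl (fun e => e \in excess @: [set s | is_stack s])); last first.
  move=> e; apply/eqP/imsetP => [/excess_onto[s st ->]|[s]].
    by exists s; rewrite ?inE.
  by rewrite inE => st ->; exact: sum_excess.
rewrite big_imset /=; last exact: excess_inj.
by apply: eq_bigl => s; rewrite inE.
Qed.

End Stacks.

(** * Coefficients of both series as sums over sets of labeled boxes *)

Definition content (k L : nat) (A : {set 'I_k * 'I_L}) (a : nat -> nat) : bool :=
  [forall v : 'I_L, #|[set j | (j, v) \in A]| == a v].

Lemma content_encode (k L m : nat) (X : lattice_path k m) (l : labeling m L) (a : nat -> nat) :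
  is_word (X, l) ->
  content (encode X l) a = [forall v : 'I_L, #|[set y | l y == v]| == a v].
Proof.
move=> word; have [rho [r1 r2 rinj rE _]] := encode_rows word.
apply: eq_forallb => v; congr (_ == _).
rewrite -!sum1_card [LHS]big_mkcond [RHS]big_mkcond /=.
transitivity (\sum_y ((rho y).2 == v : nat))%N; last first.
  by apply: eq_bigr => y _; rewrite inE r2; case: (_ == _).
rewrite (sum_rows _ (fun p : 'I_k * 'I_L => (p.2 == v : nat)) rinj rE) /=.
apply: eq_bigr => j _; rewrite inE; case: ifP => [jv|njv].
  rewrite (bigD1 v) /=; last by rewrite inE.
  by rewrite eqxx big1 // => u /andP[_ /negPf ->].
by rewrite big1 // => u; rewrite inE; case: eqP => // ->; rewrite njv.
Qed.

Lemma mprodX_coef (R : comNzRingType) (m L : nat) (l : labeling m L) (mm : 'X_{1..L}) :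
  (\prod_y 'X_(l y) : {mpoly R[L]})@_mm = [forall v, #|[set y | l y == v]| == mm v]%:R.
Proof.
rewrite mprodXE mcoeffX; congr ((nat_of_bool _)%:R).
apply/eqP/forallP => [<- i|H].
  rewrite mnm_sumE -sum1_card big_mkcond /=; apply/eqP/eq_bigr => y _.
  by rewrite inE mnmE; case: eqP.
apply/mnmP => i; rewrite mnm_sumE -(eqP (H i)) -sum1_card [RHS]big_mkcond /=.
by apply/eq_bigr => y _; rewrite inE mnmE; case: eqP.
Qed.

Section StackedCoefficient.
Variables (k M N : nat).
Let n := (k + M)%N.
Variables (s : stack n k) (X : lattice_path k n) (l : labeling n N).
Hypotheses (st : is_stack s) (word : is_word (X, l)).
Let A := encode X l.
Let e := excess s.

Lemma wsum_stack (j : nat) (y : 'I_n) : (s y < j)%N = (y < wsum e j)%N.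
Proof. by rewrite stack_lt // stretch_wsum. Qed.

Lemma under_encode :
  [forall y, (X y <= s y)%N] = [forall j : 'I_k.+1, (wsum e j <= height A j)%N].
Proof.
apply/forallP/forallP => H.
  move=> j; rewrite leqNgt; apply/negP => lt.
  have jk : (j <= k)%N by rewrite -ltnS.
  have hn : (height A j < n)%N.
    apply: leq_trans lt _; rewrite /n -(wsum_full (sum_excess st)); exact: wsum_mono.
  (* Row number [height A j] is the first whose vertical step is not left of column j, while its
     stack box would lie left of column j. *)
  have := H (Ordinal hn); rewrite leqNgt => /negP; apply.
  have : (s (Ordinal hn) < j)%N by rewrite wsum_stack.
  move/leq_trans; apply; rewrite leqNgt; apply/negP.
  by rewrite (lt_height word) /= ltnn.
move=> y; rewrite -ltnS (lt_height word).
have sk : ((s y).+1 < k.+1)%N by rewrite ltnS ltn_ord.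
by apply: leq_trans (H (Ordinal sk)); rewrite -wsum_stack.
Qed.

Lemma stack_area_encode :
  stack_area s X = (\sum_(x < k) (height A x.+1 - wsum e x.+1))%N.
Proof.
rewrite /stack_area (card_set_pair (fun (x : 'I_k) (y : 'I_n) =>
  (X y <= x)%N && [forall y' : 'I_n, (s y' == x) ==> (y' < y)%N])).
apply: eq_bigr => x _.
rewrite -(card_ord_range (wsum e x.+1) (height_le word x.+1)) -sum1_card [RHS]big_mkcond /=.
apply: eq_bigr => y _; rewrite inE -(lt_height word) ltnS andbC.
suff -> : [forall y' : 'I_n, (s y' == x) ==> (y' < y)%N] = (wsum e x.+1 <= y)%N.
  by case: (_ && _).
apply/forallP/idP => [H|le y'].
  (* The row of the topmost stack box of column x. *)
  pose w := (wsum e x + e x)%N.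
  have wE : wsum e x.+1 = w.+1 by rewrite wsum_rec addnS.
  have wn : (w < n)%N by rewrite -wE /n -(wsum_full (sum_excess st)) wsum_mono.
  have := implyP (H (Ordinal wn)); rewrite wE /=; apply.
  rewrite -val_eqE /= eqn_leq -ltnS wsum_stack wE leqnn /=.
  by rewrite leqNgt wsum_stack /= -leqNgt leq_addr.
apply/implyP => /eqP sy; apply: leq_trans le.
by rewrite -wsum_stack sy.
Qed.

(** Every stack column is nonempty, so stretching keeps the order of the columns and attacks in P'
    can be read in the original columns with offsets [wsum]. *)
Lemma hdinv_encode :
  hdinv s X l = tdinv_cols (colset A) (fun j => (height A j)%:Z - (wsum e j)%:Z).
Proof.
apply: (tdinv_encode word) => y y'; rewrite /attacking !stretch_wsum // !mul1n.
have /and3P[_ _ /forallP sX] := word.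
have mono (a b : 'I_n) : (wsum e (X a) < wsum e (X b))%N = (X a < X b)%N.
  apply/idP/idP => [|lt]; first by apply: contraTT; rewrite -!leqNgt => /wsum_mono; exact.
  apply: leq_trans (wsum_mono e lt); have /= := wsum_rec e (Ordinal (sX a)).
  by move=> ->; rewrite addnS ltnS leq_addr.
by rewrite !mono.
Qed.

End StackedCoefficient.

Lemma wld_coef (F : fieldType) (q t : F) (k M N : nat) (m : 'X_{1..N}) (a : nat -> nat) :
  (forall v : 'I_N, m v = a v) ->
  (wld_series q t (k + M) k N)@_m =
  \sum_(e : {ffun 'I_k -> 'I_M.+1} | (\sum_j e j == M)%N)
   \sum_(A : {set 'I_k * 'I_N} | (#|A| == k + M)%N &&
      (content A a && [forall j : 'I_k.+1, (wsum e j <= height A j)%N]))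
     t ^+ (\sum_(x < k) (height A x.+1 - wsum e x.+1))%N *
     q ^+ tdinv_cols (colset A) (fun j => (height A j)%:Z - (wsum e j)%:Z).
Proof.
move=> ma.
rewrite -(sum_stacks (fun e => \sum_(A : {set 'I_k * 'I_N} | (#|A| == k + M)%N &&
      (content A a && [forall j : 'I_k.+1, (wsum e j <= height A j)%N]))
     t ^+ (\sum_(x < k) (height A x.+1 - wsum e x.+1))%N *
     q ^+ tdinv_cols (colset A) (fun j => (height A j)%:Z - (wsum e j)%:Z))).
rewrite /wld_series raddf_sum /=.
rewrite (eq_bigl (fun p : stack (k + M) k * (lattice_path k (k + M) * labeling (k + M) N) =>
   is_stack p.1 && [&& is_path p.2.1, [forall y, (p.2.1 y <= p.1 y)%N] & is_labeling p.2.1 p.2.2]));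
  last by move=> p; rewrite inE.
rewrite -(pair_big_dep (@is_stack (k + M) k)
  (fun s (Xl : lattice_path k (k + M) * labeling (k + M) N) =>
     [&& is_path Xl.1, [forall y, (Xl.1 y <= s y)%N] & is_labeling Xl.1 Xl.2])
  (fun s Xl => ((t ^+ stack_area s Xl.1 * q ^+ hdinv s Xl.1 Xl.2) *:
     \prod_y 'X_(Xl.2 y) : {mpoly F[N]})@_m)) /=.
apply: eq_bigr => s st.
have short_under (X : lattice_path k (k + M)) : [forall y, (X y <= s y)%N] -> short X.
  by move=> /forallP H; apply/forallP => y; apply: leq_ltn_trans (H y) (ltn_ord _).
pose P (Xl : lattice_path k (k + M) * labeling (k + M) N) :=
  [&& is_path Xl.1, [forall y, (Xl.1 y <= s y)%N] & is_labeling Xl.1 Xl.2] &&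
  [forall v : 'I_N, #|[set y | Xl.2 y == v]| == a v].
have Pw Xl : P Xl -> is_word Xl.
  by case/andP => /and3P[p u lb] _; apply/and3P; split=> //; exact: short_under.
rewrite -(@sum_encode k N (k + M) _ P
   (fun Xl => t ^+ stack_area s Xl.1 * q ^+ hdinv s Xl.1 Xl.2)) //.
- rewrite /P [RHS]big_mkcondr /=; apply: eq_bigr => -[X l] _ /=.
  rewrite mcoeffZ mprodX_coef (eq_forallb (fun v => congr1 _ (ma v))).
  by case: ifP => _; rewrite ?mulr1 ?mulr0.
- move=> [X l] word; rewrite /P /= content_encode // -(under_encode st word) andbC.
  by have /and3P[/= -> -> _] := word; rewrite andbT.
- move=> [X l] /Pw word /=.
  by rewrite (stack_area_encode st word) (hdinv_encode st word).
Qed.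

Definition pathdinv_cols (r k L : nat) (Z : 'I_k -> {set 'I_L}) (S : nat -> int) : nat :=
  (\sum_(j < k) \sum_(v in Z j) \sum_(i < k | i < j)
     ((S i.+1 - 1 <= level Z S j v) && (level Z S j v <= S i.+1 + r%:Z - 1))%R)%N.

Definition dyck_level (r k L : nat) (A : {set 'I_k * 'I_L}) (j : nat) : int :=
  (height A j)%:Z - (r * j)%N%:Z.

Lemma wpf_coef (F : fieldType) (q t : F) (r k L : nat) (m : 'X_{1..L}) (a : nat -> nat) :
  (0 < k)%N -> (forall v : 'I_L, m v = a v) ->
  (wpf_series q t r k L)@_m =
   \sum_(A : {set 'I_k * 'I_L} | (#|A| == k * r)%N &&
      (content A a && [forall j : 'I_k.+1, (r * j <= height A j)%N]))
     t ^+ (\sum_(x < k) (height A x.+1 - r * x.+1))%N *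
     q ^ ((pathdinv_cols r (colset A) (dyck_level r A))%:Z
           - (coinv_cols (colset A) (dyck_level r A))%:Z).
Proof.
move=> k0 ma; rewrite /wpf_series raddf_sum /=.
pose P (Xl : lattice_path k (k * r) * labeling (k * r) L) :=
  (is_dyck Xl.1 && is_labeling Xl.1 Xl.2) &&
  [forall v : 'I_L, #|[set y | Xl.2 y == v]| == a v].
have Pw Xl : P Xl -> is_word Xl.
  case/andP => /andP[/andP[p /forallP d] lb] _; apply/and3P; split=> //.
  apply/forallP => y; have r0 : (0 < r)%N.
    by have := leq_ltn_trans (leq0n y) (ltn_ord y); rewrite muln_gt0 => /andP[].
  rewrite -(ltn_pmul2l r0) [(r * k)%N]mulnC.
  exact: leq_ltn_trans (d y) (ltn_ord y).
rewrite -(@sum_encode k L (k * r) _ P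
   (fun Xl => t ^+ wpf_area Xl.1 * q ^ dinv Xl.1 Xl.2)) //.
- rewrite /P [RHS]big_mkcondr /=; apply: eq_big => -[X l]; first by rewrite inE.
  move=> _ /=; rewrite mcoeffZ mprodX_coef (eq_forallb (fun v => congr1 _ (ma v))).
  by case: ifP => _; rewrite ?mulr1 ?mulr0.
- move=> [X l] word; rewrite /P /= content_encode // (is_dyck_encode word) andbC.
  by have /and3P[/= _ -> _] := word; rewrite andbT.
- move=> [X l] /Pw word /=.
  by rewrite (wpf_area_encode word) (dinv_encode word) (pathdinv_encode word k0).
Qed.

(** * Splitting off the large letters *)

Section Glue.
Variables (k N M : nat).
Implicit Types (A : {set 'I_k * 'I_N}) (t : M.-tuple {set 'I_k}).

(* The N small letters label the boxes of A, and the large letter u labels one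
   box in each column outside of the u-th set of t. *)
Definition glue A t : {set 'I_k * 'I_(N + M)} :=
  [set p : 'I_k * 'I_(N + M) |
     match split p.2 with inl x => (p.1, x) \in A | inr u => p.1 \notin tnth t u end].

Lemma glue_lshift A t j x : ((j, lshift M x) \in glue A t) = ((j, x) \in A).
Proof. by rewrite inE /= -[lshift M x]/(unsplit (inl x)) unsplitK. Qed.

Lemma glue_rshift A t j u : ((j, rshift N u) \in glue A t) = (j \notin tnth t u).
Proof. by rewrite inE /= -[rshift N u]/(unsplit (inr u)) unsplitK. Qed.

Lemma sum_glue (V : nmodType) (g : {set 'I_k * 'I_(N + M)} -> V) :
  \sum_C g C = \sum_(A : {set 'I_k * 'I_N}) \sum_(t : M.-tuple {set 'I_k}) g (glue A t).
Proof.
rewrite pair_big /=.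
rewrite (reindex_onto (fun At : {set 'I_k * 'I_N} * M.-tuple {set 'I_k} => glue At.1 At.2)
  (fun C => ([set p | (p.1, lshift M p.2) \in C],
             [tuple [set j | (j, rshift N u) \notin C] | u < M]))) /=; last first.
  move=> C _; apply/setP => -[j v]; rewrite -(splitK v); case: (split v) => [x|u] /=.
    by rewrite glue_lshift inE.
  by rewrite glue_rshift tnth_mktuple inE negbK.
apply: eq_bigl => -[A t] /=; apply/eqP; congr (_, _).
  by apply/setP => -[j x]; rewrite inE glue_lshift.
apply: eq_from_tnth => u; rewrite tnth_mktuple; apply/setP => j.
by rewrite inE glue_rshift negbK.
Qed.

Lemma sum_colset_glue (V : Type) (idx : V) (op : Monoid.com_law idx) A t (j : 'I_k)
    (F : 'I_(N + M) -> V) :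
  \big[op/idx]_(v in colset (glue A t) j) F v =
  op (\big[op/idx]_(x in colset A j) F (lshift M x))
     (\big[op/idx]_(u < M | j \notin tnth t u) F (rshift N u)).
Proof.
rewrite big_mkcond big_split_ord /= -!big_mkcond /=; congr (op _ _).
  by rewrite [LHS]big_mkcond [RHS]big_mkcond; apply: eq_bigr => x _; rewrite ![_ \in colset _ _]inE glue_lshift.
by rewrite [LHS]big_mkcond [RHS]big_mkcond; apply: eq_bigr => u _; rewrite [_ \in colset _ _]inE glue_rshift.
Qed.

Lemma count_tnth (t : M.-tuple {set 'I_k}) (j : 'I_k) :
  (\sum_(u < M | j \notin tnth t u) 1 + count (fun B : {set 'I_k} => j \in B) t = M)%N.
Proof.
rewrite -sum1_count -[RHS]card_ord -[RHS]sum1_card [RHS](bigID (fun u => j \notin tnth t u)) /=.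
congr (_ + _)%N; rewrite big_tuple /=; by apply: eq_bigl => u; rewrite negbK.
Qed.

Lemma card_colset_glue A t j :
  #|colset (glue A t) j| = (#|colset A j| + (M - count (fun B : {set 'I_k} => j \in B) t))%N.
Proof.
rewrite -sum1_card sum_colset_glue sum1_card; congr (_ + _)%N.
by rewrite -[X in (_ = X - _)%N](count_tnth t j) addnK.
Qed.

Lemma content_glue A t (a : nat -> nat) :
  content (glue A t) a =
  content A a && [forall u : 'I_M, (k - #|tnth t u| == a (N + u))%N].
Proof.
have cr (u : 'I_M) : #|[set j | (j, rshift N u) \in glue A t]| = (k - #|tnth t u|)%N.
  have -> : [set j | (j, rshift N u) \in glue A t] = ~: tnth t u.
    by apply/setP => j; rewrite inE glue_rshift in_setC.
  by rewrite cardsCs setCK card_ord.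
have cl (x : 'I_N) : #|[set j | (j, lshift M x) \in glue A t]| = #|[set j | (j, x) \in A]|.
  by apply: eq_card => j; rewrite inE glue_lshift inE.
apply/forallP/andP => [H|[/forallP H1 /forallP H2] v].
  split; apply/forallP => x; first by have := H (lshift M x); rewrite cl.
  by have := H (rshift N x); rewrite cr.
rewrite -(splitK v); case: (split v) => [x|u] /=; first by rewrite cl H1.
by rewrite cr H2.
Qed.

End Glue.

Lemma height_sum (k L : nat) (A : {set 'I_k * 'I_L}) (x : nat) :
  height A x = (\sum_(j < k | (j < x)%N) #|colset A j|)%N.
Proof.
rewrite /height -sum1_card (partition_big (fun p => p.1) (fun j : 'I_k => (j < x)%N)) /=; last first.
  by move=> p; rewrite inE => /andP[].
apply: eq_bigr => j jx; rewrite -sum1_card.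
rewrite (reindex_onto (fun v => (j, v)) (fun p => p.2)) /=; last first.
  by move=> [j' v] /andP[_ /eqP /= ->].
by apply: eq_bigl => v; rewrite !inE /= jx !eqxx !andbT.
Qed.

Lemma height_rec (k L : nat) (A : {set 'I_k * 'I_L}) (j : 'I_k) :
  height A j.+1 = (height A j + #|colset A j|)%N.
Proof.
rewrite !height_sum (bigD1 j) //= addnC; congr (_ + _)%N; apply: eq_bigl => i.
by rewrite -val_eqE /= ltnS; case: ltngtP.
Qed.

Lemma height_card (k L : nat) (A : {set 'I_k * 'I_L}) : height A k = #|A|.
Proof. by apply: eq_card => p; rewrite inE ltn_ord andbT. Qed.

Lemma Posz_sum (I : Type) (r : seq I) (P : pred I) (F : I -> nat) :
  ((\sum_(i <- r | P i) F i)%N)%:Z = \sum_(i <- r | P i) (F i)%:Z.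
Proof. exact: (big_morph Posz PoszD erefl). Qed.

Lemma count_take_sum (T : Type) (p : pred T) (x0 : T) (s : seq T) (u : nat) :
  (u <= size s)%N -> count p (take u s) = (\sum_(i < u) p (nth x0 s i))%N.
Proof.
elim: u => [|u IH] us; first by rewrite take0 big_ord0.
by rewrite (take_nth x0) // -cats1 count_cat /= addn0 IH ?(ltnW us) // big_ord_recr.
Qed.

Lemma n_above_ext (k : nat) (f1 f2 : 'I_k -> int) (j : 'I_k) :
  f1 =1 f2 -> n_above f1 j = n_above f2 j.
Proof. by move=> E; apply: eq_card => i; rewrite !inE !E. Qed.

Lemma drop_statE (k : nat) (f : 'I_k -> int) (Bs : seq {set 'I_k}) :
  drop_stat f Bs = (\sum_(u < size Bs) \sum_(j in nth set0 Bs u)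
    n_above (fun i => (f i - (count (fun B : {set 'I_k} => i \in B) (take u Bs))%:Z)%R) j)%N.
Proof.
elim: Bs f => [|B Bs IH] f /=; first by rewrite big_ord0.
rewrite big_ord_recl IH; congr (_ + _)%N.
  by apply: eq_bigr => j _; apply: n_above_ext => i; rewrite /= subr0.
apply: eq_bigr => u _; rewrite lift0 /=; apply: eq_bigr => j _; apply: n_above_ext => i.
by rewrite /drop_set PoszD opprD addrA.
Qed.

(** Of the two comparisons between a pair of columns exactly one holds, so the sum is k(k-1)/2
    whatever f is. *)
Lemma sum_before (k : nat) (f : 'I_k -> int) :
  \sum_(j < k) \sum_(i < k | i != j) indic (before i (f i) j (f j)) = \sum_(j < k) (j : nat)%:Z.
Proof.
transitivity (\sum_(j < k) (\sum_(i < k | (i < j)%N) indic (before i (f i) j (f j)) +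
     \sum_(i < k | (j < i)%N) indic (before i (f i) j (f j)))).
  apply: eq_bigr => j _; rewrite (bigID (fun i : 'I_k => (i < j)%N)) /=.
  by congr (_ + _); apply: eq_bigl => i; rewrite -val_eqE /=; lia.
rewrite big_split /= [X in _ + X](exchange_big_dep predT) //= -big_split /=.
apply: eq_bigr => b _; rewrite -big_split /=.
rewrite (eq_bigr (fun _ => 1)); last first.
  by move=> a ab; rewrite /indic /before ab ltnNge (ltnW ab) /=; lia.
by rewrite (sum_ord_lt b (fun _ => 1)) sumr_const card_ord natz.
Qed.

Lemma sum_before_above (k : nat) (f : 'I_k -> int) (j : 'I_k) :
  \sum_(i < k | i != j) indic (before i (f i) j (f j)) = k%:Z - 1 - (n_above f j)%:Z.
Proof.
rewrite -[k%:Z - 1]mul1r -(sum_neq_const j) /n_above -sum1_card Posz_sum.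
rewrite [X in _ = _ - X](eq_bigl (fun i => (i != j) && before j (f j) i (f i))); last first.
  by move=> i; rewrite inE; case: eqP => // ->; rewrite /before ltnn ltxx.
rewrite big_mkcondr /= -sumrB; apply: eq_bigr => i ij.
rewrite /indic /before; have [lt|lt|E] := ltngtP i j; last by rewrite (val_inj E) eqxx in ij.
  by case: ltP; case: leP; lia.
by case: ltP; case: leP; lia.
Qed.

Lemma rk_sum (L : nat) (Z : {set 'I_L}) (v : nat) : rk Z v = (\sum_(u in Z) (u < v))%N.
Proof.
rewrite /rk -sum1_card big_mkcond [RHS]big_mkcond; apply: eq_bigr => u _ /=.
by rewrite inE; case: (u \in Z); case: ltnP.
Qed.

Section DinvGlue.
Variables (k N M : nat) (A : {set 'I_k * 'I_N}) (t : M.-tuple {set 'I_k}).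

Let Z := colset (glue A t).
Let S := dyck_level M.+1 (glue A t).
Let cnt (j : 'I_k) : nat := count (fun B : {set 'I_k} => j \in B) t.
(** The level where the large letters of column j start. It is the initial height of particle j, and
    [fu u] gives the heights after the moves t_0, ..., t_(u-1). *)
Let f (j : 'I_k) : int := S j + #|colset A j|%:Z.
Let fu (u : nat) (j : 'I_k) : int :=
  f j - (count (fun B : {set 'I_k} => j \in B) (take u t))%:Z.

Hypothesis cardA : #|glue A t| = (k * M.+1)%N.
Hypothesis dyckA : forall j, (j <= k)%N -> (M.+1 * j <= height (glue A t) j)%N.
Hypothesis sumt : (\sum_(u < M) #|tnth t u| = M)%N.

Lemma dyck_level_rec (j : 'I_k) : S j.+1 = S j + #|colset A j|%:Z - (cnt j)%:Z - 1.
Proof.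
rewrite /S /dyck_level height_rec card_colset_glue -/(cnt j) mulnS.
have : (cnt j <= M)%N by rewrite -[X in (_ <= X)%N](size_tuple t) count_size.
move: (M.+1 * j)%N => w; lia.
Qed.

Lemma level_small (j : 'I_k) (x : 'I_N) : level Z S j (lshift M x) = level (colset A) S j x.
Proof.
rewrite /level !rk_sum sum_colset_glue /= [X in (_ + X)%N]big1 ?addn0 // => u _.
by rewrite ltnNge (leq_trans (ltnW (ltn_ord x))) ?leq_addr.
Qed.

(** Of the u large letters preceding u, column j lacks one for each earlier set containing j. The
    leftover shift u is common to all columns and disappears from comparisons. *)
Lemma level_big (j : 'I_k) (u : 'I_M) : level Z S j (rshift N u) = fu u j + (u : nat)%:Z.
Proof.
rewrite /level rk_sum sum_colset_glue /= (eq_bigr (fun=> 1%N)); last first.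
  by move=> x _; rewrite (leq_trans (ltn_ord x)) ?leq_addr.
rewrite sum1_card /fu /f.
have us : (u <= size t)%N by rewrite size_tuple ltnW.
rewrite (count_take_sum _ set0 us).
have : (\sum_(i < M | j \notin tnth t i) (N + i < N + u) +
    \sum_(i < u) (j \in nth set0 t i) = u)%N.
  rewrite -(big_ord_narrow (ltnW (ltn_ord u)) (F := fun i : 'I_M => nat_of_bool (j \in nth set0 t i))).
  rewrite big_mkcond [X in (_ + X)%N]big_mkcond -big_split /=.
  rewrite -[RHS]card_ord -sum1_card -(big_ord_narrow (ltnW (ltn_ord u)) (F := fun=> 1%N)).
  rewrite [RHS]big_mkcond; apply: eq_bigr => i _ /=; rewrite ltn_add2l -tnth_nth.
  by case: (j \in _); case: (i < u)%N.
set a := (\sum_(i < M | _) _)%N; set b := (\sum_(i < u) _)%N; move: a b => a b ab.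
by rewrite -ab !PoszD; ring.
Qed.

Lemma topE (i : 'I_k) : top Z S i = S i.+1 + M%:Z + 1.
Proof.
rewrite /top dyck_level_rec /Z card_colset_glue -/(cnt i).
have : (cnt i <= M)%N by rewrite -[X in (_ <= X)%N](size_tuple t) count_size.
lia.
Qed.

Let E (i : 'I_k) : int := top Z S i.

(** Lying in an interval is a difference of two comparisons. The comparisons with the column tops
    are kept as they are, because the same sum occurs in [pathdinv_glue]. *)
Lemma coinv_glue : (coinv_cols Z S)%:Z =
  \sum_(j < k) \sum_(x in colset A j) \sum_(i < k | i != j)
     indic (before i (level (colset A) S i x) j (level (colset A) S j x))
  + \sum_(j < k) \sum_(u < M | j \notin tnth t u) \sum_(i < k | i != j)
     indic (before i (fu u i) j (fu u j))
  - \sum_(j < k) \sum_(v in Z j) \sum_(i < k | i != j) indic (before i (E i) j (level Z S j v)).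
Proof.
rewrite -big_split /= -sumrB Posz_sum; apply: eq_bigr => j _.
have -> : \sum_(x in colset A j) \sum_(i < k | i != j)
     indic (before i (level (colset A) S i x) j (level (colset A) S j x)) +
   \sum_(u < M | j \notin tnth t u) \sum_(i < k | i != j) indic (before i (fu u i) j (fu u j)) =
   \sum_(v in Z j) \sum_(i < k | i != j) indic (before i (level Z S i v) j (level Z S j v)).
  rewrite sum_colset_glue /=; congr (_ + _); apply: eq_bigr => w _; apply: eq_bigr => i _.
    by rewrite !level_small.
  by rewrite !level_big /before; congr indic; case: ifP; lia.
rewrite -sumrB Posz_sum; apply: eq_bigr => v _; rewrite -sumrB Posz_sum.
apply: eq_bigr => i ij; have := rk_le (Z i) v.
rewrite /indic /E /before /level /top; have [lt|lt|eij] := ltngtP i j; try lia.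
by rewrite (val_inj eij) eqxx in ij.
Qed.

Lemma tdinv_small : (tdinv_cols (colset A) S)%:Z =
  \sum_(j < k) \sum_(x in colset A j) \sum_(i < k | i != j)
    indic (before i (S i) j (level (colset A) S j x))
  - \sum_(j < k) \sum_(x in colset A j) \sum_(i < k | i != j)
     indic (before i (level (colset A) S i x) j (level (colset A) S j x)).
Proof.
rewrite -sumrB Posz_sum; apply: eq_bigr => j _; rewrite -sumrB Posz_sum.
apply: eq_bigr => x _; rewrite -sumrB Posz_sum; apply: eq_bigr => i ij.
rewrite /indic /before /level; have [lt|lt|eij] := ltngtP i j; try lia.
by rewrite (val_inj eij) eqxx in ij.
Qed.

(** By [topE] the upper bound S (i+1) + M lies just below the top of column i, so for i < j
    exceeding it is the comparison with that top. For j < i the two terms on the right coincide,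
    which extends the sum to all pairs. *)
Lemma pathdinv_glue : (pathdinv_cols M.+1 Z S)%:Z =
  \sum_(j < k) \sum_(v in Z j) \sum_(i < k | i != j)
    indic (if (i < j)%N then S i.+1 - 1 <= level Z S j v
         else S i.+1 + M%:Z + 1 < level Z S j v)
  - \sum_(j < k) \sum_(v in Z j) \sum_(i < k | i != j) indic (before i (E i) j (level Z S j v)).
Proof.
rewrite -sumrB Posz_sum; apply: eq_bigr => j _; rewrite -sumrB Posz_sum.
apply: eq_bigr => v _; rewrite -sumrB Posz_sum big_mkcond [RHS]big_mkcond /=.
apply: eq_bigr => i _; rewrite /E topE /indic /before -val_eqE /=.
by have [lt|lt|eij] := ltngtP i j => //=; lia.
Qed.

(** For each u the sum over all columns j is evaluated by [sum_before]. The columns of t_u must then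
    be removed, M in total over all u, each accounting for k - 1 minus its [n_above]: this is the
    source of [drop_stat]. *)
Lemma sum_big_pairs :
  \sum_(j < k) \sum_(u < M | j \notin tnth t u) \sum_(i < k | i != j)
     indic (before i (fu u i) j (fu u j)) =
  \sum_(j < k) (j * M)%N%:Z - M%:Z * (k%:Z - 1) + (drop_stat f t)%:Z.
Proof.
rewrite (exchange_big_dep predT) //=.
have -> : \sum_(j < k) (j * M)%N%:Z = \sum_(u < M) \sum_(j < k) (j : nat)%:Z.
  by rewrite sumr_const card_ord -mulr_natr natz mulr_suml; apply: eq_bigr => j _; lia.
have -> : M%:Z * (k%:Z - 1) = \sum_(u < M) \sum_(j in tnth t u) (k%:Z - 1).
  under eq_bigr do rewrite sumr_const -mulr_natl natz.
  by rewrite -mulr_suml -Posz_sum sumt.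
rewrite drop_statE size_tuple Posz_sum -sumrB -big_split /=; apply: eq_bigr => u _.
rewrite -(sum_before (fu u)) Posz_sum -(tnth_nth set0) -addrA -sumrN -big_split /=.
rewrite [X in _ = X + _](bigID (fun j => j \notin tnth t u)) /= -addrA -[LHS]addr0.
congr (_ + _); rewrite (eq_bigl (fun j => j \in tnth t u)); last by move=> j; rewrite negbK.
rewrite -big_split /= big1 // => j _; rewrite sum_before_above -/(fu u).
by rewrite /fu; move: (n_above _ _) (k%:Z) => a b; lia.
Qed.

(** The final height f j - cnt j equals S (j+1) + 1, so the particles end at the starting levels of
    the following columns, raised by one. *)
Lemma final_statE : (final_stat f cnt)%:Z =
  \sum_(j < k) \sum_(i < k | i != j) \sum_(s < cnt j)
      indic (before j (S j.+1 + (s : nat)%:Z + 1) i (S i.+1)).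
Proof.
rewrite Posz_sum; apply: eq_bigr => j _; rewrite Posz_sum exchange_big /=.
apply: eq_bigr => s _; rewrite /final_cost -sum1_card Posz_sum big_mkcond [RHS]big_mkcond /=.
apply: eq_bigr => i _; rewrite inE /f !dyck_level_rec -val_eqE /= /indic /before.
have [lt|lt|eij] := ltngtP i j.
- by rewrite /=; case: ifP; lia.
- by rewrite /=; case: ifP; lia.
by rewrite (val_inj eij) /=; case: ifP; lia.
Qed.

(** Comparisons with column tops cancel between pathdinv and coinv, and [column_identity] evaluates
    what remains. Apart from [drop_stat], the right-hand side depends on t only through the counts
    [cnt]. *)
Lemma dinv_glue :
  (pathdinv_cols M.+1 Z S)%:Z - (coinv_cols Z S)%:Z =
  (tdinv_cols (colset A) S)%:Z + (final_stat f cnt)%:Z - (drop_stat f t)%:Z.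
Proof.
(* [column_identity] takes functions on nat, so column data are extended by 0 beyond k. *)
pose ext (g : 'I_k -> nat) (j : nat) : nat := oapp g 0%N (insub j).
have extE g (j : 'I_k) : ext g j = g j by rewrite /ext valK.
pose x := ext (fun j => #|colset A j|); pose e := ext cnt.
have cntM j : (cnt j <= M)%N by rewrite -[X in (_ <= X)%N](size_tuple t) count_size.
have S0 : S 0%N = 0 by rewrite /S /dyck_level height_sum big_pred0 // muln0.
have Sk : S k = 0 by rewrite /S /dyck_level height_card cardA mulnC subrr.
have Spos j : (j <= k)%N -> 0 <= S j by move=> /dyckA; rewrite /S /dyck_level; lia.
have Srec j : (j < k)%N -> S j.+1 = S j + (x j)%:Z - (e j)%:Z - 1.
  move=> jk; have xE : x j = #|colset A (Ordinal jk)| := extE _ (Ordinal jk).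
  have eE : e j = cnt (Ordinal jk) := extE _ (Ordinal jk).
  by rewrite xE eE; exact: (dyck_level_rec (Ordinal jk)).
have eM j : (j < k)%N -> (e j <= M)%N.
  by move=> jk; rewrite (extE cnt (Ordinal jk) : e j = _).
have sume : (\sum_(j < k) e j = M)%N.
  rewrite -[RHS]sumt; transitivity (\sum_(j < k) \sum_(u < M) (j \in tnth t u))%N.
    apply: eq_bigr => j _; rewrite /e extE /cnt -sum1_count big_tuple big_mkcond /=.
    by apply: eq_bigr => u _; case: (_ \in _).
  rewrite exchange_big; apply: eq_bigr => u _; rewrite -sum1_card [RHS]big_mkcond /=.
  by apply: eq_bigr => j _; case: (_ \in _).
have main := column_identity S0 Sk Spos Srec eM (fun j => erefl (x j + M - e j)%N) sume.
rewrite pathdinv_glue coinv_glue tdinv_small sum_big_pairs final_statE.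
have -> : \sum_(j < k) \sum_(v in Z j) \sum_(i < k | i != j)
    indic (if (i < j)%N then S i.+1 - 1 <= level Z S j v
         else S i.+1 + M%:Z + 1 < level Z S j v) =
  \sum_(j < k) \sum_(i < k | i != j) \sum_(s < x j + M - e j)
     indic (if (i < j)%N then S i.+1 - 1 <= S j + (s : nat)%:Z
          else S i.+1 + M%:Z + 1 < S j + (s : nat)%:Z).
  apply: eq_bigr => j _; rewrite exchange_big; apply: eq_bigr => i _.
  rewrite /level (sum_rk _ _ (fun s => indic (if (i < j)%N then S i.+1 - 1 <= S j + s%:Z
          else S i.+1 + M%:Z + 1 < S j + s%:Z))).
  suff -> : #|Z j| = (x j + M - e j)%N by [].
  by rewrite /Z card_colset_glue /x /e !extE addnBA ?cntM.
rewrite main.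
have -> : \sum_(j < k) \sum_(x0 in colset A j) \sum_(i < k | i != j)
    indic (before i (S i) j (level (colset A) S j x0)) =
  \sum_(j < k) \sum_(i < k | i != j) \sum_(s < x j) indic (before i (S i) j (S j + (s : nat)%:Z)).
  apply: eq_bigr => j _; rewrite exchange_big; apply: eq_bigr => i _.
  rewrite /level (sum_rk _ _ (fun s => indic (before i (S i) j (S j + s%:Z)))).
  by rewrite /x extE.
have -> : \sum_(j < k) \sum_(i < k | i != j) \sum_(s < e j)
      indic (before j (S j.+1 + (s : nat)%:Z + 1) i (S i.+1)) =
  \sum_(j < k) \sum_(i < k | i != j) \sum_(s < cnt j)
      indic (before j (S j.+1 + (s : nat)%:Z + 1) i (S i.+1)).
  by apply: eq_bigr => j _; apply: eq_bigr => i _; rewrite /e extE.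
ring.
Qed.

End DinvGlue.

(** Both branches of [hess_sign] preserve the relation between the sum and the size. Only tuples of
    sets of total cardinal M survive, as [dinv_glue] requires. *)
Lemma hess_sign_size (A : pzRingType) (z : nat) (bs : seq nat) :
  sumn bs != (size bs + z)%N -> hess_sign A z bs = 0.
Proof.
elim: bs z => [|b bs IH] z /= ne; first by rewrite (_ : (z == 0)%N = false) //; lia.
case: eqP => [bz|_]; case: eqP => [b0|_]; rewrite ?mul0r ?mul1r ?subr0 ?sub0r //.
- by rewrite b0 in bz.
- by apply: IH; lia.
- by rewrite IH ?oppr0 //; lia.
Qed.

Lemma tdinv_cols_ext (k L : nat) (S1 S2 : nat -> int) (Z : 'I_k -> {set 'I_L}) :
  (forall j : 'I_k, S1 j = S2 j) -> tdinv_cols Z S1 = tdinv_cols Z S2.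
Proof.
move=> E; apply: eq_bigr => j _; apply: eq_bigr => v _; apply: eq_bigr => i _.
by rewrite /level !E.
Qed.

(** * From glued words to stacks with prescribed excess *)

Section ByExcess.
Variables (k N M : nat) (A : {set 'I_k * 'I_N}) (t : M.-tuple {set 'I_k}).
Variable e : {ffun 'I_k -> 'I_M.+1}.
Hypothesis te : forall j, count (fun B : {set 'I_k} => j \in B) t = e j.

(** Column j has #|A_j| + M - e_j = #|A_j| + (M + 1) - (e_j + 1) boxes: the slope M + 1 of the line
    is traded for the e_j + 1 boxes of the stack. Levels above the line thus become levels above the
    stack. *)
Lemma height_glue (j : nat) : (j <= k)%N ->
  (height (glue A t) j + wsum e j = height A j + M.+1 * j)%N.
Proof.
elim: j => [|j IH] jk; first by rewrite !height_sum /wsum !big_pred0 // muln0.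
have := IH (ltnW jk); rewrite (height_rec _ (Ordinal jk)) (height_rec A (Ordinal jk)).
rewrite (wsum_rec e (Ordinal jk)) card_colset_glue te mulnS /=.
have := ltn_ord (e (Ordinal jk)).
move: (M.+1 * j)%N => w; lia.
Qed.

Lemma dyck_level_glue (j : nat) : (j <= k)%N ->
  dyck_level M.+1 (glue A t) j = (height A j)%:Z - (wsum e j)%:Z.
Proof.
by move=> /height_glue; rewrite /dyck_level; move: (M.+1 * j)%N => w; lia.
Qed.

Lemma sum_card_tuple : (\sum_(u < M) #|tnth t u| = \sum_j e j)%N.
Proof.
transitivity (\sum_(u < M) \sum_(j < k) (j \in tnth t u))%N.
  by apply: eq_bigr => u _; rewrite -sum1_card big_mkcond /=; apply: eq_bigr => j _; case: (_ \in _).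
rewrite exchange_big; apply: eq_bigr => j _; rewrite -te -sum1_count big_tuple [RHS]big_mkcond /=.
by apply: eq_bigr => u _; case: (_ \in _).
Qed.

Lemma dyck_glue : [forall j : 'I_k.+1, (M.+1 * j <= height (glue A t) j)%N] =
  [forall j : 'I_k.+1, (wsum e j <= height A j)%N].
Proof.
apply: eq_forallb => j; have := height_glue (_ : j <= k)%N.
rewrite -ltnS ltn_ord => /(_ isT).
move: (M.+1 * j)%N => w; lia.
Qed.

Lemma area_glue : (\sum_(x < k) (height (glue A t) x.+1 - M.+1 * x.+1) =
  \sum_(x < k) (height A x.+1 - wsum e x.+1))%N.
Proof.
apply: eq_bigr => x _; have := height_glue (ltn_ord x).
move: (M.+1 * x.+1)%N => w; lia.
Qed.

Hypothesis sume : (\sum_j e j = M)%N.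

Lemma card_glue : (#|glue A t| == k * M.+1)%N = (#|A| == k + M)%N.
Proof.
have := height_glue (leqnn k); rewrite !height_card wsum_full // [(M.+1 * k)%N]mulnC.
move: (k * M.+1)%N => w; lia.
Qed.

Lemma weight_glue (F : fieldType) (q : F) : q != 0 ->
  #|A| = (k + M)%N -> (forall j, (j <= k)%N -> (wsum e j <= height A j)%N) ->
  q ^ ((pathdinv_cols M.+1 (colset (glue A t)) (dyck_level M.+1 (glue A t)))%:Z
       - (coinv_cols (colset (glue A t)) (dyck_level M.+1 (glue A t)))%:Z) =
  let S := fun j => (height A j)%:Z - (wsum e j)%:Z in
  let f := fun j : 'I_k => S j + #|colset A j|%:Z in
  q ^+ tdinv_cols (colset A) S * (q ^+ final_stat f (fun j => e j) * q^-1 ^+ drop_stat f t).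
Proof.
move=> q0 cA dA.
rewrite dinv_glue; first last.
- by rewrite sum_card_tuple sume.
- by move=> j jk; have := height_glue jk; have := dA j jk; move: (M.+1 * j)%N => w; lia.
- by apply/eqP; rewrite card_glue cA.
rewrite /= !expfzDr // -exprnN mulrA; congr (_ * _ * _).
- congr (_ ^+ _); apply: tdinv_cols_ext => j; apply: dyck_level_glue; exact: ltnW.
- congr (_ ^+ _); apply: eq_bigr => j _; rewrite te; apply: eq_bigr => s _.
  by apply: eq_card => i; rewrite !inE !te !dyck_level_glue // ltnW.
- rewrite -exprVn; congr (_ ^+ _); rewrite !drop_statE; apply: eq_bigr => u _.
  apply: eq_bigr => j _; apply: n_above_ext => i.
  by rewrite dyck_level_glue // ltnW.
Qed.

End ByExcess.

Lemma sum_by_count (V : nmodType) (k M : nat) (g : M.-tuple {set 'I_k} -> V) :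
  (forall t : M.-tuple {set 'I_k}, (\sum_(u < M) #|tnth t u|)%N != M -> g t = 0) ->
  \sum_t g t = \sum_(e : {ffun 'I_k -> 'I_M.+1} | (\sum_j e j == M)%N)
    \sum_(t : M.-tuple {set 'I_k} | [forall j, count (fun B : {set 'I_k} => j \in B) t == e j]) g t.
Proof.
move=> g0.
pose c (t : M.-tuple {set 'I_k}) : {ffun 'I_k -> 'I_M.+1} :=
  [ffun j => inord (count (fun B : {set 'I_k} => j \in B) t)].
have cE (t : M.-tuple {set 'I_k}) j : count (fun B : {set 'I_k} => j \in B) t = c t j.
  by rewrite ffunE inordK // ltnS -[X in (_ <= X)%N](size_tuple t) count_size.
rewrite (bigID (fun t : M.-tuple {set 'I_k} => (\sum_(u < M) #|tnth t u| == M)%N)) /=.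
rewrite [X in _ + X]big1 ?addr0 //.
rewrite (partition_big c (fun e => (\sum_j e j == M)%N)) /=; last first.
  by move=> t; rewrite (sum_card_tuple (cE t)).
apply: eq_bigr => e /eqP sume; apply: eq_bigl => t.
apply/andP/forallP => [[_ /eqP <-] j|te]; first by rewrite cE.
have E : c t = e by apply/ffunP => j; apply: val_inj; rewrite /= -cE; exact/eqP.
by rewrite (sum_card_tuple (cE t)) E sume !eqxx.
Qed.

(** The large letter u occupies k - #|t_u| columns and its exponent is k - 1 + s u - u; cancelling k
    gives the Hessenberg condition. [jt_ok] makes the truncated subtraction exact, and follows back
    from #|t_u| <= k. *)
Lemma jt_exps_rect (k : nat) (la : seq nat) (s : 'S_(size la)) (t : (size la).-tuple {set 'I_k}) :
  (0 < k)%N -> (forall i, (i < size la)%N -> nth 0%N la i = k.-1) ->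
  jt_ok s && [forall u, (k - #|tnth t u| == nth 0 (jt_exps s) u)%N] =
  [forall u : 'I_(size la), (nth 0 [seq #|B| | B : {set 'I_k} <- t] u + s u == u.+1)%N].
Proof.
move=> k0 lak.
have ts (u : 'I_(size la)) : nth 0%N [seq #|B| | B : {set 'I_k} <- t] u = #|tnth t u|.
  by rewrite (nth_map set0) ?size_tuple // -tnth_nth.
have es (u : 'I_(size la)) : nth 0%N (jt_exps s) u = (k.-1 + s u - u)%N.
  by rewrite /jt_exps (nth_map u) ?size_enum_ord // nth_ord_enum lak.
have tk u : (#|tnth t u| <= k)%N by rewrite -[X in (_ <= X)%N]card_ord max_card.
apply/andP/forallP => [[/forallP ok /forallP H] u|H].
  by have := ok u; have := eqP (H u); rewrite ts es lak //; have := tk u; lia.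
split; apply/forallP => u; have := eqP (H u); rewrite ts ?es ?lak //; have := tk u; lia.
Qed.

Lemma wld_jacobi_trudi (F : fieldType) (q t : F) (k : nat) (la : seq nat) (N : nat)
    (m : 'X_{1..N}) :
  q != 0 -> (0 < k)%N -> (forall i, (i < size la)%N -> nth 0%N la i = k.-1) ->
  (wld_series q t (k + size la) k N)@_m = jt_sum la (wpf_series q t (size la).+1 k) m.
Proof.
move=> q0 k0 lak; set M := size la.
have symF := wpf_symfun t M.+1 k q0.
rewrite (@wld_coef F q t k M N m (nth 0%N m)); last by move=> v; rewrite (mnm_nth 0%N).
pose ok (C : {set 'I_k * 'I_(N + M)}) := (#|C| == k * M.+1)%N && [forall j : 'I_k.+1, (M.+1 * j <= height C j)%N].
pose wt (C : {set 'I_k * 'I_(N + M)}) : F :=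
  t ^+ (\sum_(x < k) (height C x.+1 - M.+1 * x.+1))%N *
  q ^ ((pathdinv_cols M.+1 (colset C) (dyck_level M.+1 C))%:Z
       - (coinv_cols (colset C) (dyck_level M.+1 C))%:Z).
(* The meeting point of the two sides: the Jacobi-Trudi side arrives by summing the signs over s,
   the stacked side by grouping the tuples B according to how many of their sets contain each
   column. *)
transitivity (\sum_(A : {set 'I_k * 'I_N}) \sum_(B : M.-tuple {set 'I_k})
  if ok (glue A B) && content A (nth 0%N m)
  then wt (glue A B) * hess_sign F 0 [seq #|B| | B : {set 'I_k} <- B] else 0); last first.
  rewrite /jt_sum.
  transitivity (\sum_(s : 'S_M) \sum_(A : {set 'I_k * 'I_N}) \sum_(B : M.-tuple {set 'I_k})
    if ok (glue A B) && content A (nth 0%N m) then wt (glue A B) * ((-1) ^+ s *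
      ([forall u : 'I_M, (nth 0 [seq #|B| | B : {set 'I_k} <- B] u + s u == u.+1)%N])%:R) else 0).
    rewrite [RHS]exchange_big; apply: eq_bigr => A _; rewrite [RHS]exchange_big; apply: eq_bigr => B _.
    case: ifP => _; last by rewrite big1.
    by rewrite -mulr_sumr sum_perm_hess // size_map size_tuple.
  apply: eq_bigr => s _; have sz : size (jt_exps s) = M by rewrite size_map size_enum_ord.
  rewrite (@coef_of_at _ _ symF (N + M)); last by rewrite size_cat size_tuple sz.
  rewrite /coef_at (@wpf_coef F q t M.+1 k (N + M) _ (nth 0%N (m ++ jt_exps s))) //; last first.
    by move=> v; rewrite mnmE.
  rewrite [X in _ = _ * X]big_mkcond [X in _ = _ * X]sum_glue mulr_sumr; apply: eq_bigr => A _.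
  rewrite mulr_sumr; apply: eq_bigr => B _; rewrite content_glue.
  have -> : content A (nth 0%N (m ++ jt_exps s)) = content A (nth 0%N m).
    by apply: eq_forallb => v; rewrite nth_cat size_tuple ltn_ord.
  have -> : [forall u : 'I_M, (k - #|tnth B u| == nth 0 (m ++ jt_exps s) (N + u))%N] =
            [forall u : 'I_M, (k - #|tnth B u| == nth 0 (jt_exps s) u)%N].
    by apply: eq_forallb => u; rewrite nth_cat size_tuple ltnNge leq_addr /= addKn.
  rewrite -(jt_exps_rect s B k0 lak) -/(wt _) /ok.
  case: (#|_| == _) => /=; last by rewrite mulr0.
  case: (content _ _) => /=; last by rewrite andbF mulr0.
  rewrite andbT; case: [forall j, _] => /=; last by rewrite andbF mulr0.
  by rewrite andbT; case: (jt_ok s); case: [forall u, _]; rewrite /= ?mulr0 ?mulr1 ?mul0r // mulrC.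
rewrite (exchange_big_dep predT) //=; apply: eq_bigr => A _.
rewrite (sum_by_count (g := fun B : M.-tuple {set 'I_k} =>
  if ok (glue A B) && content A (nth 0%N m)
  then wt (glue A B) * hess_sign F 0 [seq #|B| | B : {set 'I_k} <- B] else 0)); last first.
  move=> B ne; case: ifP => // _; rewrite hess_sign_size ?mulr0 // size_map size_tuple addn0.
  by move: ne; rewrite sumnE big_map big_tuple.
rewrite big_mkcondr; apply: eq_bigr => e /eqP sume.
case: ifP => [/and3P[/eqP cA ctA /forallP dA]|cond].
  have dA' j : (j <= k)%N -> (wsum e j <= height A j)%N.
    by rewrite -ltnS => jk; exact: (dA (Ordinal jk)).
  pose S j := (height A j)%:Z - (wsum e j)%:Z.
  pose f (j : 'I_k) := S j + #|colset A j|%:Z.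
  (* The base is 1/q because [drop_stat] enters the dinv with a minus sign; the collapsed value is
     then inverse to the factor q^[final_stat]. *)
  have [_ /(_ erefl) main] := drop_sumE q^-1 f (etrans sume (esym (addn0 M))).
  transitivity (t ^+ (\sum_(x < k) (height A x.+1 - wsum e x.+1))%N * q ^+ tdinv_cols (colset A) S *
    (q ^+ final_stat f (fun j => e j) * drop_sum q^-1 M 0 f (fun j => e j))).
    by rewrite main -exprMn mulfV // expr1n mulr1.
  rewrite /drop_sum !mulr_sumr; apply: eq_bigr => B /forallP Be.
  have te j := eqP (Be j).
  have okB : ok (glue A B).
    rewrite /ok (dyck_glue A te); apply/andP; split; last exact/forallP.
    by rewrite (card_glue A te sume); apply/eqP.
  rewrite okB ctA /wt (area_glue A te) (weight_glue te sume q0 cA dA').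
  by rewrite [hess_sign _ _ _ * _]mulrC !mulrA.
rewrite big1 // => B /forallP Be; have te j := eqP (Be j).
rewrite /ok (card_glue A te sume) (dyck_glue A te) -andbA.
by rewrite [[forall j, _] && _]andbC cond.
Qed.

Lemma wld_degree (F : fieldType) (q t : F) (n k N : nat) :
  (msize (wld_series q t n k N) <= n.+1)%N.
Proof.
apply: leq_trans (msize_sum _ _ _) _; apply/bigmax_leqP => p _.
apply: leq_trans (msizeZ_le _ _) _; rewrite mprodXE msizeX mdeg_sum ltnS.
by under eq_bigr do rewrite mdeg1; rewrite sum1_card card_ord.
Qed.

Lemma qvar_neq0 : qvar != 0.
Proof. by rewrite tofrac_eq0 -msize_poly_eq0 msizeX mdeg1. Qed.

Local Close Scope ring_scope.

Theorem theorem1p3 (n k : nat) (k_gt0 : 1 <= k) (le_kn : k <= n) :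
  schur_perp (nseq (n - k) (k - 1))
    (wpf_series qvar tvar (n - k + 1) k)
    (wld_series qvar tvar n k).
Proof.
rewrite addn1; apply: schur_perp_intro.
- by elim: (n - k) => //= d; case: d => //= d ->; rewrite /geq /= leqnn.
- exact: wpf_symfun qvar_neq0.
- by exists n.+1 => N; exact: wld_degree.
move=> N m; rewrite -[X in wld_series _ _ X](subnKC le_kn).
rewrite -[X in (k + X)%N](size_nseq (n - k) (k - 1)%N).
rewrite -[X in wpf_series _ _ X.+1](size_nseq (n - k) (k - 1)%N).
apply: wld_jacobi_trudi => // [|i]; first exact: qvar_neq0.
by rewrite size_nseq nth_nseq subn1 => ->.
Qed.
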